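(* For $\mathcal L_2$-a.e. $\lambda\in\{z\in\mathbb C:\ 2^{-1/2}\le|z|\le2\cdot5^{-5/8}\}$, the measure $\nu_\lambda$ is absolutely continuous with density in $L^2(\mathbb R^2)$; in particular $\mathcal L_2(A_\lambda)>0$. Moreover, for any $2^{-1/2}<r<R<2\cdot5^{-5/8}$, $$\dim_H\{\lambda\in\mathbb C:\ r<|\lambda|<R,\ d\nu_\lambda/dx\notin L^2(\mathbb R^2)\}\le4-\frac{\log 2}{-\log r},$$ where $d\nu_\lambda/dx\notin L^2$ includes the case that $\nu_\lambda$ is not absolutely continuous.
   Context: $\mathcal L_2$ is area measure on $\mathbb C\cong\mathbb R^2$. $\nu_\lambda$ is the distribution of the random series $\sum_{n\ge0}\pm\lambda^n$ with independent fair signs; $A_\lambda=\{\sum_{n\ge0}a_n\lambda^n:a_n\in\{-1,1\}\}$ is its support. $\dim_H$ is Hausdorff dimension. *)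

(* Defs.v *)
(* The complex plane C is modelled as R * R
   (first component = real part, second = imaginary part). *)
From HB Require Import structures.
From mathcomp Require Import all_boot all_order all_algebra.
From mathcomp Require Import all_classical all_reals all_analysis.
Set Implicit Arguments. Unset Strict Implicit. Unset Printing Implicit Defensive.
Import Order.TTheory GRing.Theory Num.Theory numFieldNormedType.Exports.
Local Open Scope classical_set_scope.
Local Open Scope ring_scope.

Section Defs.
Variable R : realType.

Definition leb2 := (@lebesgue_measure R \x @lebesgue_measure R)%E.

Definition cmul (p q : R * R) : R * R :=
  (p.1 * q.1 - p.2 * q.2, p.1 * q.2 + p.2 * q.1).
Definition cpow (p : R * R) (n : nat) : R * R := iter n (cmul p) (1, 0).
Definition cabs (p : R * R) : R := Num.sqrt (p.1 ^+ 2 + p.2 ^+ 2).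
Definition cscale (c : R) (p : R * R) : R * R := (c * p.1, c * p.2).
Definition cadd (p q : R * R) : R * R := (p.1 + q.1, p.2 + q.2).
Definition cdist (p q : R * R) : R := cabs (p.1 - q.1, p.2 - q.2).

Definition sgn (b : bool) : R := if b then 1 else -1.

Definition psum (lam : R * R) (s : nat -> bool) (n : nat) : R * R :=
  foldr cadd (0, 0) [seq cscale (sgn (s k)) (cpow lam k) | k <- iota 0 n].

Definition Aset (lam : R * R) : set (R * R) :=
  fun z : R * R => exists s : nat -> bool, psum lam s @ \oo --> z.

Definition fair_indep_signs d (Omega : measurableType d) (P : probability Omega R)
    (eps : nat -> Omega -> bool) : Prop :=
  (forall n, measurable [set w | eps n w]) /\
  (forall (F : seq nat) (b : nat -> bool), uniq F ->
     P [set w | forall n, n \in F -> eps n w = b n] = ((2 ^- size F : R))%:E).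

(** nu_lambda: the distribution of the random series  sum_{n>=0} eps_n lambda^n,
    i.e. nu A = P(the series converges and its sum lies in A).  For |lambda| < 1
    (the only case used) the series converges for every sign sequence. *)
Definition nu d (Omega : measurableType d) (P : probability Omega R)
    (eps : nat -> Omega -> bool) (lam : R * R) (A : set (R * R)) : \bar R :=
  P [set w | exists z, psum lam (fun n => eps n w) @ \oo --> z /\ A z].

Definition has_L2_density (mu : set (R * R) -> \bar R) : Prop :=
  exists f : R * R -> R,
    [/\ measurable_fun setT f, (forall x, 0 <= f x),
        (forall A : set (R * R), measurable A ->
           mu A = (\int[leb2]_(x in A) (f x)%:E)%E)
      & (\int[leb2]_x ((f x) ^+ 2)%:E < +oo)%E].

Definition diam (U : set (R * R)) : \bar R :=
  ereal_sup ([set 0%E] `|` [set (cdist x y)%:E | x in U & y in U]).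

Definition hcontrib (s : R) (U : set (R * R)) : \bar R :=
  if U == set0 then 0%E else ((fine (diam U)) `^ s)%:E.

Definition hausdorff_delta (s delta : R) (E : set (R * R)) : \bar R :=
  ereal_inf [set (\sum_(0 <= n <oo) hcontrib s (U n))%E | U in
     [set U : nat -> set (R * R) |
        E `<=` \bigcup_n U n /\ forall n, (diam (U n) <= delta%:E)%E]].

Definition hausdorff_measure (s : R) (E : set (R * R)) : \bar R :=
  ereal_sup [set hausdorff_delta s delta E | delta in [set delta : R | 0 < delta]].

Definition dimH (E : set (R * R)) : \bar R :=
  ereal_inf [set s%:E | s in [set s : R | 0 <= s /\ hausdorff_measure s E = 0%E]].

End Defs.

(* Main.v *)
Require Import Defs.
From HB Require Import structures.
From mathcomp Require Import all_boot all_order all_algebra.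
From mathcomp Require Import complex.
From mathcomp Require Import all_classical all_reals all_analysis measurable_realfun.
From mathcomp Require Import ring lra zify.
Set Implicit Arguments. Unset Strict Implicit. Unset Printing Implicit Defensive.
Import Order.TTheory GRing.Theory Num.Theory numFieldNormedType.Exports.
Local Open Scope classical_set_scope.
Local Open Scope ring_scope.

(* Let s = log 2 / (- log r), so that 2 < s <= 3 and 1/2 = r^s.  At level j let f_j(lam) be
   the average over sign words a of length j L of the normalised indicators of squares of
   side rho_j ~ 2^-j at the partial sums x_a(lam).  Off the real axis the sign polynomials
   have no near-double zero for |lam| < 2 * 5^(-5/8) (transversality).  Hence a pair of
   words first disagreeing at n has x_a - x_b of size < rho_j only within
   tau = O(rho_j r^-n) of one simple zero, and there the sum over a lattice of mesh ~ 4^-j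
   of a kernel of x_a - x_b changes, under a perturbation of size rho_j, only by an
   O(n tau) fraction: translating the lattice absorbs the perturbation.  So the squared
   L2 distance of f_j(lam) and f_{j+1}(lam + w), averaged over lam, is O(j^4 2^(j (2 - s))).

   By Jensen this controls the averages of f_j over dyadic cells of side rho_j.  For b < 1
   at most O(j^4 (2^(4 - s) / b)^j) cells of level j are bad, i.e. see the average jump by
   more than b^j in squared L2 norm on passing to a child.  A parameter that eventually
   lies in good cells only has averages converging geometrically in L2, to a density of
   nu_lam; the other parameters form a limsup of bad cells, null for H^t if t > 4 - s.
   The real axis is H^t-null for t > 1.  Since 4 - s < 2 off the inner boundary, t = 2
   gives the almost everywhere statement; there nu_lam(A_lam) = 1 forces A_lam to have
   positive area. *)

(** Bounding the two kernels of a pair separately gives about r^(-2n) per pair; weighted by the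
    frequency 2^-n this stays bounded because r^2 > 1/2, but it shows no decay in j and hence says
    nothing about the size of the exceptional set. Translating gains the factor n rho_j r^-n, and
    the mean becomes rho_j^(s - 2) up to powers of j: since s <= 3, the largest terms are those with
    r^n ~ rho_j. Lattice sums in place of integrals over lam make a translation a finite reindexing.
    A translation must be rounded to the lattice at a cost of only O(rho_j tau), which fixes the
    mesh at order rho_j^2.

    The number 2 * 5^(-5/8) comes from transversality. If a polynomial with coefficients in [-1, 1]
    and constant coefficient 1 or -1 had a nonreal double zero of modulus B, comparing weighted
    norms on the circle of squared radius t would give t^4 <= B^8 / (1 - t). The largest value of
    t^4 (1 - t) is 256/3125, at t = 4/5, and this is the eighth power of 2 * 5^(-5/8). *)

Local Notation Re := complex.Re.
Local Notation Im := complex.Im.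

(** * Transversality *)

Section ComplexModulus.
Variable R : rcfType.
Implicit Types z w : R[i].
Local Notation nm := Normc.normc.

Lemma nmD z w : nm (z + w) <= nm z + nm w.
Proof. exact: le_normcD. Qed.

Lemma nmN z : nm (- z) = nm z.
Proof. exact: normcN. Qed.

Lemma nmM z w : nm (z * w) = nm z * nm w.
Proof. exact: Normc.normcM. Qed.

Lemma nmV z : nm z^-1 = (nm z)^-1.
Proof. exact: Normc.normcV. Qed.

Lemma nm0 : nm (0 : R[i]) = 0.
Proof. exact: Normc.normc0. Qed.

Lemma nm1 : nm (1 : R[i]) = 1.
Proof. exact: Normc.normc1. Qed.

Lemma nm_ge0 z : 0 <= nm z.
Proof. by case: z => a b; exact: sqrtr_ge0. Qed.

Lemma nm_eq0 z : (nm z == 0) = (z == 0).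
Proof.
apply/eqP/eqP => [|->]; [exact: Normc.eq0_normc | exact: nm0].
Qed.

Lemma nm_gt0 z : (0 < nm z) = (z != 0).
Proof. by rewrite lt_def nm_eq0 nm_ge0 andbT. Qed.

Lemma nmX z n : nm (z ^+ n) = nm z ^+ n.
Proof. by elim: n => [|n IH]; rewrite ?expr0 ?nm1 // !exprS nmM IH. Qed.

Lemma nmBC z w : nm (z - w) = nm (w - z).
Proof. by rewrite -nmN opprB. Qed.

Lemma nmB z w : nm (z - w) <= nm z + nm w.
Proof. by rewrite -(nmN w); exact: nmD. Qed.

Lemma nmB_ge z w : nm z - nm w <= nm (z - w).
Proof. by rewrite lerBlDr; apply: le_trans (nmD _ _); rewrite subrK. Qed.

Lemma nm_dist z w v : nm (z - v) <= nm (z - w) + nm (w - v).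
Proof. by apply: le_trans (nmD _ _); rewrite addrA subrK. Qed.

Lemma nm_real (x : R) : nm (x%:C)%C = `|x|.
Proof. by rewrite /= expr0n /= addr0 sqrtr_sqr. Qed.

Lemma normRe_le z : `|Re z| <= nm z.
Proof.
case: z => a b /=; rewrite -sqrtr_sqr ler_wsqrtr // lerDl; exact: sqr_ge0.
Qed.

Lemma normIm_le z : `|Im z| <= nm z.
Proof.
case: z => a b /=; rewrite -sqrtr_sqr ler_wsqrtr // lerDr; exact: sqr_ge0.
Qed.

Lemma nm_sqr z : nm z ^+ 2 = Re z ^+ 2 + Im z ^+ 2.
Proof. by case: z => a b /=; rewrite sqr_sqrtr // addr_ge0 ?sqr_ge0. Qed.

Lemma nm_le_ReIm z : nm z <= `|Re z| + `|Im z|.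
Proof.
rewrite -(@ler_pXn2r _ 2) ?nnegrE ?nm_ge0 ?addr_ge0 //.
rewrite nm_sqr -(real_normK (num_real (Re z))) -(real_normK (num_real (Im z))).
by have := normr_ge0 (Re z); have := normr_ge0 (Im z); nra.
Qed.

End ComplexModulus.

Section Transversality.
Variable R : rcfType.
Local Notation nm := (@Normc.normc R).
Local Notation cpoly := (map_poly (real_complex R)).

(** * A weighted norm invariant under reversal of a quadratic factor *)

Section WeightedNorm.
Variables (t : R) (K : nat).
Implicit Types f g h : {poly R}.

(** By Parseval, for [t > 0] and degrees below [K] this is the mean of [f] times the conjugate of
    [g] over the circle of squared radius [t]. On that circle the conjugate of z is t / z, so X^2 +
    b X + m and (m / t) X^2 + b X + t have the same modulus there. *)
Definition wdot f g := \sum_(k < K) f`_k * g`_k * t ^+ k.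

Lemma wdotC f g : wdot f g = wdot g f.
Proof. by apply: eq_bigr => i _; rewrite (mulrC f`_i). Qed.

Lemma wdotDl f g h : wdot (f + g) h = wdot f h + wdot g h.
Proof. by rewrite -big_split /=; apply: eq_bigr => i _; rewrite coefD !mulrDl. Qed.

Lemma wdotZl a f h : wdot (a *: f) h = a * wdot f h.
Proof. by rewrite mulr_sumr; apply: eq_bigr => i _; rewrite coefZ !mulrA. Qed.

Lemma wdotX f g : (size f < K)%N -> wdot ('X * f) ('X * g) = t * wdot f g.
Proof.
rewrite /wdot; case: K => // K' sf.
rewrite big_ord_recl big_ord_recr /= !coefXM /= !mul0r add0r.
rewrite (nth_default _ (s := f)) // !mul0r addr0 mulr_sumr.
by apply: eq_bigr => i _; rewrite !coefXM /= exprS; ring.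
Qed.

Definition quadp (a b c : R) : {poly R} := a *: 'X^2 + b *: 'X + c%:P.

(* The squared norm depends only on the autocorrelations of [h], which the
   reversal of the (rescaled) quadratic factor leaves unchanged. *)
Lemma wdot_quad_rev b m h : t != 0 -> ((size h).+2 < K)%N ->
  wdot (quadp 1 b m * h) (quadp 1 b m * h) =
  wdot (quadp (m / t) b t * h) (quadp (m / t) b t * h).
Proof.
move=> t0 sh.
have E a c : quadp a b c * h = a *: ('X * ('X * h)) + b *: ('X * h) + c *: h.
  by rewrite /quadp !mulrDl -!scalerAl mul_polyC expr2 mulrA.
rewrite !E.
have sXh : (size ('X * h)%R < K)%N.
  apply: leq_ltn_trans (ltnW sh).
  by apply: leq_trans (size_polyMleq _ _) _; rewrite size_polyX.
have shK : (size h < K)%N := ltnW (ltnW sh).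
rewrite !(wdotDl, wdotZl).
rewrite !(wdotC _ (_ + _)) !(wdotDl, wdotZl).
rewrite !wdotX //.
rewrite (wdotC h ('X * h)) (wdotC h ('X * ('X * h))).
by field.
Qed.

(** Reversing both quadratic factors keeps the norm and turns the constant coefficient m^2 h_0 into
    t^2 h_0, whose square is at most the squared norm. *)
Lemma wdot_quad2_lb b m h : 0 < t -> ((size h).+4 < K)%N ->
  forall f, f = quadp 1 b m * (quadp 1 b m * h) ->
  t ^+ 4 * f`_0 ^+ 2 <= m ^+ 4 * wdot f f.
Proof.
move=> t0 sh f fE.
have q0 a c : (quadp a b c)`_0 = c.
  by rewrite /quadp !coefD !coefZ coefXn coefX coefC /= !mulr0 !add0r.
have tn0 : t != 0 by rewrite gt_eqF.
have sq a c : (size (quadp a b c) <= 3)%N.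
  rewrite /quadp; apply: leq_trans (size_polyD _ _) _; rewrite geq_max.
  rewrite (leq_trans (size_polyC_leq1 _)) // andbT.
  apply: leq_trans (size_polyD _ _) _; rewrite geq_max.
  by rewrite !(leq_trans (size_scale_leq _ _)) // ?size_polyXn ?size_polyX.
have sqh a c : ((size (quadp a b c * h)%R).+2 < K)%N.
  by have := size_polyMleq (quadp a b c) h; have := sq a c; lia.
pose g := quadp (m / t) b t * (quadp (m / t) b t * h).
have -> : wdot f f = wdot g g.
  by rewrite fE wdot_quad_rev // mulrCA wdot_quad_rev // ltnW // ltnW.
have -> : f`_0 = m ^+ 2 * h`_0 by rewrite fE !coef0M q0; ring.
have gE : g`_0 = t ^+ 2 * h`_0 by rewrite /g !coef0M !q0; ring.
have : g`_0 ^+ 2 <= wdot g g.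
  rewrite /wdot; case: (K) sh => // K' _; rewrite big_ord_recl /= expr0 mulr1 -expr2.
  rewrite lerDl; apply: sumr_ge0 => i _.
  by rewrite mulr_ge0 ?exprn_ge0 ?(ltW t0) // -expr2 sqr_ge0.
rewrite gE => /(ler_wpM2l (exprn_even_ge0 m (isT : ~~ odd 4))).
by apply: le_trans; rewrite le_eqVlt; apply/orP; left; apply/eqP; ring.
Qed.

End WeightedNorm.

Lemma horner_cpoly_lin (a b : R) (z : R[i]) :
  (cpoly (a%:P + b *: 'X)).[z] = (a%:C + b%:C * z)%C.
Proof. by rewrite rmorphD /= map_polyC map_polyZ map_polyX !hornerE. Qed.

Lemma size2_polyE (p : {poly R}) : (size p <= 2)%N ->
  p = (p`_0)%:P + p`_1 *: 'X.
Proof.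
move=> sp; apply/polyP => i; rewrite coefD coefC coefZ coefX.
case: i => [|[|i]] /=; rewrite ?mulr0 ?mulr1 ?addr0 ?add0r //.
by rewrite nth_default // (leq_trans sp).
Qed.

(** For real [a] and [b] the imaginary part of a + b z is b Im z, so a real linear remainder that is
    small at [z] has small coefficients, at the price of one factor 1 / eta. This is where the
    distance to the real axis enters. *)
Lemma lin_coef_bound (a b e eta : R) (z : R[i]) :
  0 < eta <= 1 -> eta <= `|Im z| -> nm z <= 1 -> nm (a%:C + b%:C * z)%C <= e ->
  `|b| <= e / eta /\ `|a| <= 2 * (e / eta).
Proof.
move=> /andP[eta0 eta1] hz z1 h.
have e0 : 0 <= e := le_trans (nm_ge0 _) h.
have hb : `|b| <= e / eta.
  rewrite ler_pdivlMr //; apply: le_trans h; apply: le_trans (normIm_le _).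
  have -> : Im (a%:C + b%:C * z)%C = b * Im z by case: (z) => x y /=; ring.
  by rewrite normrM ler_wpM2l.
split=> //.
have ee : e <= e / eta by rewrite ler_pdivlMr // ler_piMr.
have : nm (a%:C)%C <= nm (a%:C + b%:C * z)%C + nm (b%:C * z)%C.
  by apply: le_trans (nmB _ _); rewrite addrK.
rewrite nmM !nm_real => H; apply: le_trans H _.
have : `|b| * nm z <= `|b| * 1 by rewrite ler_wpM2l.
by lra.
Qed.

Lemma geo45_le5 (K : nat) : \sum_(k < K) (4/5 : R) ^+ k <= 5.
Proof.
suff -> : \sum_(k < K) (4/5 : R) ^+ k = 5 - 5 * (4/5) ^+ K.
  have : 0 <= (4/5 : R) ^+ K by apply: exprn_ge0; lra.
  lra.
elim: K => [|K IH]; first by rewrite big_ord0 expr0; ring.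
by rewrite big_ord_recr /= IH exprS; field.
Qed.

(* A double zero at [z] is also a double zero at its conjugate; dividing both out
   and reversing the quadratic factor replaces Jensen's formula. *)
Lemma near_double_zero_bound (e B : R) (g p h : {poly R}) (b m : R) :
  0 <= e <= 1 -> 0 <= m <= B ^+ 2 ->
  (forall k, `|g`_k| <= 1) -> `|g`_0| = 1 ->
  (size p <= 4)%N -> (forall k, `|p`_k| <= e) ->
  g = quadp 1 b m * (quadp 1 b m * h) + p ->
  256/625 * (1 - 2 * e) <= B ^+ 8 * (5 + 12 * e).
Proof.
move=> /andP[e0 e1] /andP[m0 mB] g1 g0 sp pe gE.
set f := quadp 1 b m * (quadp 1 b m * h) in gE.
have fE : f = g - p by rewrite gE addrK.
pose K := (size h).+4.+1.
(* With the optimal weight 4/5 the geometric series of the weights sums to 5. *)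
have := @wdot_quad2_lb (4/5) K b m h ltac:(lra) (leqnn _) f erefl => H.
have fub : wdot (4/5) K f f <= 5 + 12 * e.
  have : wdot (4/5) K f f <= \sum_(k < K) ((4/5 : R) ^+ k + (k < 4)%N%:R * (3 * e)).
    apply: ler_sum => k _; rewrite fE coefB.
    have t0 : 0 <= (4/5 : R) ^+ k by apply: exprn_ge0; lra.
    have t1 : (4/5 : R) ^+ k <= 1 by apply: exprn_ile1; lra.
    have := g1 k; rewrite ler_norml => /andP[a1 a2].
    have := pe k; rewrite ler_norml => /andP[b1 b2].
    case: (ltnP k 4) => k4; rewrite ?mul1r ?mul0r ?addr0.
      (* Only the four lowest coefficients are affected by [p]; each square grows by at most 2e +
         e^2 <= 3e. *)
      have : (g`_k - p`_k) * (g`_k - p`_k) <= 1 + 3 * e by nra.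
      by move: (_ * _) => X HX; nra.
    rewrite (nth_default _ (leq_trans sp k4)) subr0 -[leRHS]mul1r ler_wpM2r //; nra.
  move=> HH; apply: le_trans HH _; rewrite big_split /= lerD ?geo45_le5 //.
  rewrite -mulr_suml; have -> : 12 * e = 4 * (3 * e) by ring.
  rewrite ler_wpM2r //; first by lra.
  rewrite -natr_sum ler_nat -(big_mkord xpredT (fun i => (i < 4)%N : nat)).
  rewrite (@big_cat_nat _ _ _ 4) //=.
  rewrite [X in (_ + X)%N]big1_seq ?addn0 //; last first.
    by move=> i; rewrite mem_index_iota => /andP[_ /andP[i4 _]]; rewrite ltnNge i4.
  by rewrite !big_nat_recr //= big_nil.
have f0 : 1 - 2 * e <= f`_0 ^+ 2.
  rewrite fE coefB; have := pe 0%N; rewrite ler_norml => /andP[b1 b2].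
  have /eqP := g0; rewrite eqr_norml => /andP[/orP[/eqP->|/eqP->] _]; nra.
have m4 : m ^+ 4 <= B ^+ 8.
  have -> : B ^+ 8 = (B ^+ 2) ^+ 4 by rewrite -exprM.
  by rewrite ler_pXn2r // nnegrE ?sqr_ge0.
have -> : 256/625 = (4/5 : R) ^+ 4 by field.
apply: le_trans (_ : (4/5) ^+ 4 * f`_0 ^+ 2 <= _).
  by rewrite ler_wpM2l // exprn_ge0 //; lra.
apply: le_trans H _; apply: le_trans (_ : m ^+ 4 * (5 + 12 * e) <= _).
  by rewrite ler_wpM2l // exprn_ge0.
by rewrite ler_wpM2r //; lra.
Qed.

(** Suppose [g] and its derivative are both small at [z]. Dividing twice by the real quadratic [q]
    with zeros [z] and its conjugate leaves linear remainders [r1], [r2] that are small, because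
    g(z) = r1(z) and g'(z) = q'(z) r2(z) + r1'(z). So [g] is q^2 h up to a cubic with small
    coefficients, which [near_double_zero_bound] excludes. All constants are explicit, hence [delta]
    does not depend on the degree of [g]. *)
Lemma transversality (B eta : R) : 0 < eta -> 0 <= B -> 5 * B ^+ 8 < 256/625 ->
  exists2 delta : R, 0 < delta &
  forall (g : {poly R}) (z : R[i]),
    (forall k, `|g`_k| <= 1) -> `|g`_0| = 1 ->
    nm z <= B -> eta <= `|Im z| ->
    nm (cpoly g).[z] < delta -> delta <= nm (cpoly g^`()).[z].
Proof.
move=> eta0' B0 B8.
have B1 : B < 1.
  rewrite ltNge; apply/negP => B1; have : 1 <= B ^+ 8 by apply: exprn_ege1. lra.
pose et := Num.min eta 1.
have et0 : 0 < et <= 1 by rewrite /et lt_min eta0' ltr01 /= ge_min lexx orbT.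
have [et_gt0 et_le1] := andP et0.
pose D := 256/625 - 5 * B ^+ 8.
have D0 : 0 < D by rewrite /D; lra.
(* At error [e] the inequality of [near_double_zero_bound] reads D <= (512/625 + 12 B^8) e, and the
   factor in front of [e] is below 14 because B < 1. *)
pose e := Num.min 1 (D / 14).
have e0 : 0 < e by rewrite lt_min ltr01 divr_gt0.
have e1 : e <= 1 by rewrite ge_min lexx.
have eD : e <= D / 14 by rewrite ge_min lexx orbT.
(* Two linear remainders and one division by q'(z) lose three factors 1 / et; each coefficient of
   [q * r2 + r1] is at most six times the resulting unit. *)
pose d := e * et ^+ 3 / 6.
have d0 : 0 < d by rewrite !mulr_gt0 // ?exprn_gt0 ?invr_gt0.
exists d => // g z g1 g0 zB zeta' gz; rewrite leNgt; apply/negP => g'z.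
have zeta : et <= `|Im z| by apply: le_trans zeta'; rewrite ge_min lexx.
have z1 : nm z <= 1 by lra.
pose b := - (2 * Re z); pose m := nm z ^+ 2.
pose q := quadp 1 b m.
have sq : size q = 3%N.
  rewrite /q /quadp scale1r -addrA size_polyDl ?size_polyXn //.
  apply: leq_ltn_trans (size_polyD _ _) _; rewrite gtn_max ltnS.
  rewrite (leq_ltn_trans (size_polyC_leq1 _)) // andbT.
  by rewrite (leq_trans (size_scale_leq _ _)) // size_polyX.
have q0 : q != 0 by rewrite -size_poly_eq0 sq.
pose g1' := g %/ q; pose r1 := g %% q; pose h := g1' %/ q; pose r2 := g1' %% q.
have gE : g = q * g1' + r1 by rewrite mulrC; exact: divp_eq.
have g1E : g1' = q * h + r2 by rewrite mulrC; exact: divp_eq.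
have sr1 : (size r1 <= 2)%N by rewrite -ltnS -sq ltn_modp.
have sr2 : (size r2 <= 2)%N by rewrite -ltnS -sq ltn_modp.
have qz : (cpoly q).[z] = 0.
  rewrite /q /quadp !rmorphD /= !map_polyZ map_polyXn map_polyX map_polyC !hornerE.
  rewrite /m nm_sqr /b; case: (z) => x y /=.
  by apply/eqP; rewrite eq_complex /=; apply/andP; split; apply/eqP; ring.
have q'z : (cpoly q^`()).[z] = (0 +i* (2 * Im z))%C.
  rewrite /q /quadp !poly.derivE addr0 !rmorphD /= !map_polyZ /= !rmorphMn /= map_polyX map_polyC !hornerE /b.
  case: (z) => x y /=.
  by apply/eqP; rewrite eq_complex /=; apply/andP; split; apply/eqP; ring.
pose u := et^-1.
have etu : et * u = 1 by rewrite /u divff // gt_eqF.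
have u1 : 1 <= u by rewrite invf_ge1.
have [be al] : `|r1`_1| <= d * u /\ `|r1`_0| <= 2 * (d * u).
  apply: (lin_coef_bound et0 zeta z1); rewrite -horner_cpoly_lin -size2_polyE //.
  suff -> : (cpoly r1).[z] = (cpoly g).[z] by exact: ltW.
  by rewrite [in RHS]gE rmorphD rmorphM /= hornerD hornerM qz mul0r add0r.
have g'E : (cpoly g^`()).[z] =
   ((cpoly q^`()).[z] * (cpoly r2).[z] + (r1`_1)%:C)%C.
  have r1' : r1^`() = (r1`_1)%:P.
    apply/polyP => i; rewrite coef_deriv coefC.
    by case: i => [|i] //=; rewrite nth_default ?mul0rn // (leq_trans sr1).
  have g1z : (cpoly g1').[z] = (cpoly r2).[z].
    by rewrite {1}g1E rmorphD rmorphM /= hornerD hornerM qz mul0r add0r.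
  rewrite {1}gE derivD derivM r1' !rmorphD !rmorphM /= !(hornerD, hornerM) qz.
  by rewrite mul0r addr0 g1z map_polyC hornerC.
have r2z : nm (cpoly r2).[z] <= d * u ^+ 2.
  have nq' : 2 * et <= nm (cpoly q^`()).[z].
    rewrite q'z /= expr0n /= add0r sqrtr_sqr normrM ger0_norm // ler_wpM2l //.
  have : nm ((cpoly q^`()).[z] * (cpoly r2).[z]) <= d + d * u.
    have -> : (cpoly q^`()).[z] * (cpoly r2).[z] = (cpoly g^`()).[z] - (r1`_1)%:C%C.
      by rewrite g'E addrK.
    by apply: le_trans (nmB _ _) _; rewrite nm_real lerD // ltW.
  rewrite nmM => H.
  have H2 : 2 * et * nm (cpoly r2).[z] <= d + d * u.
    by apply: le_trans H; rewrite ler_wpM2r ?nm_ge0.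
  have du : d <= d * u by rewrite ler_peMr // ltW.
  have H3 : et * nm (cpoly r2).[z] <= d * u by lra.
  have : u * (et * nm (cpoly r2).[z]) <= u * (d * u) by rewrite ler_wpM2l //; lra.
  by rewrite mulrA (mulrC u et) etu mul1r mulrCA -expr2.
have [ep ga] : `|r2`_1| <= d * u ^+ 2 * u /\ `|r2`_0| <= 2 * (d * u ^+ 2 * u).
  by apply: (lin_coef_bound et0 zeta z1); rewrite -horner_cpoly_lin -size2_polyE.
pose v := d * u ^+ 3.
have vE : d * u ^+ 2 * u = v by rewrite /v; ring.
rewrite vE in ep ga.
have duv : d * u <= v.
  rewrite /v exprS; apply: ler_wpM2l; first exact: ltW.
  by rewrite ler_peMr ?exprn_ege1 //; lra.
have v0 : 0 <= v by rewrite /v mulr_ge0 ?exprn_ge0 //; lra.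
have v6 : 6 * v = e.
  rewrite /v /d.
  have -> : 6 * (e * et ^+ 3 / 6 * u ^+ 3) = e * (et * u) ^+ 3 by rewrite exprMn; field.
  by rewrite etu expr1n mulr1.
have hb : `|b| <= 2.
  rewrite /b normrN normrM ger0_norm //; have := normRe_le z; lra.
have hm : `|m| <= 1 by rewrite /m normrX ger0_norm ?nm_ge0 // exprn_ile1 ?nm_ge0.
pose p := q * r2 + r1.
have pE : p = Poly [:: m * r2`_0 + r1`_0; b * r2`_0 + m * r2`_1 + r1`_1;
                      r2`_0 + b * r2`_1; r2`_1].
  rewrite /p {1}(size2_polyE sr2) {1}(size2_polyE sr1) /q /quadp /=.
  rewrite !cons_poly_def -!mul_polyC !polyCD !polyCM polyC0; ring.
have M (x y a c : R) : `|x| <= a -> `|y| <= c -> `|x * y| <= a * c.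
  by move=> *; rewrite normrM ler_pM.
have := @near_double_zero_bound e B g p h b m.
rewrite (ltW e0) e1 sqr_ge0 /m ler_pXn2r ?nnegrE ?nm_ge0 // zB => /(_ isT isT g1 g0).
have sp : (size p <= 4)%N.
  by rewrite pE; apply: leq_trans (size_Poly _) _.
have pe k : `|p`_k| <= e.
  rewrite pE coef_Poly -v6.
  case: k => [|[|[|[|k]]]] /=.
  - apply: le_trans (ler_normD _ _) _; have := M _ _ _ _ hm ga; lra.
  - apply: le_trans (ler_normD _ _) _; have := M _ _ _ _ hm ep.
    have := M _ _ _ _ hb ga; have := ler_normD (b * r2`_0) (m * r2`_1); lra.
  - apply: le_trans (ler_normD _ _) _; have := M _ _ _ _ hb ep; lra.
  - lra.
  - rewrite nth_nil normr0; lra.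
move=> /(_ sp pe) H.
have {}H := H ltac:(by rewrite /p -/q {1}gE g1E; ring).
have B81 : B ^+ 8 <= 1 by apply: exprn_ile1 => //; exact: ltW.
have : 12 * e * B ^+ 8 <= 12 * e * 1 by apply: ler_wpM2l => //; lra.
by rewrite /D in eD D0; lra.
Qed.

End Transversality.

(** * Lattice sums of a kernel and their perturbation *)

Section TentKernel.
Variable R : realType.
Local Notation nm := (@Normc.normc R).

Definition tent (x : R) : R := Num.max 0 (1 - `|x|).

Lemma tent_ge0 x : 0 <= tent x.
Proof. by rewrite le_max lexx. Qed.

Lemma tent_le1 x : tent x <= 1.
Proof. by rewrite ge_max ler01 /= gerBl. Qed.

Lemma tent_eq0 x : 1 <= `|x| -> tent x = 0.
Proof. by move=> h; apply/max_idPl; rewrite subr_le0. Qed.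

Lemma tent_lip x y : `|tent x - tent y| <= `|x - y|.
Proof.
have h1 := ler_normB x y; have := lerB_dist x y; have := lerB_dist y x.
rewrite (distrC y x) /tent => h2 h3.
case: (leP (1 - `|x|) 0) => hx; case: (leP (1 - `|y|) 0) => hy;
  rewrite ler_norml; apply/andP; split; lra.
Qed.

(* The correlation [v |-> <phi, phi (. - v)>] of the normalised indicator [phi] of a
   square of side [rho]. *)
Definition ker (rho : R) (v : R[i]) : R :=
  rho ^- 2 * (tent (Re v / rho) * tent (Im v / rho)).

Lemma ker_ge0 rho v : 0 <= ker rho v.
Proof. by rewrite mulr_ge0 ?invr_ge0 ?sqr_ge0 // mulr_ge0 ?tent_ge0. Qed.

Lemma ker_le rho v : ker rho v <= rho ^- 2.
Proof.
rewrite -[leRHS]mulr1 ler_wpM2l ?invr_ge0 ?sqr_ge0 //.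
by rewrite -[leRHS]mulr1 ler_pM ?tent_ge0 ?tent_le1.
Qed.

Lemma ker_eq0 rho v : 0 < rho -> 2 * rho <= nm v -> ker rho v = 0.
Proof.
move=> rho0 h; rewrite /ker.
have : rho <= `|Re v| \/ rho <= `|Im v|.
  case: (lerP rho `|Re v|); first by left.
  case: (lerP rho `|Im v|); first by right.
  by have := nm_le_ReIm v; lra.
have H x : rho <= `|x| -> tent (x / rho) = 0.
  by move=> hx; rewrite tent_eq0 // normrM normfV (gtr0_norm rho0) ler_pdivlMr ?mul1r.
by case=> /H ->; rewrite ?(mulr0, mul0r).
Qed.

Lemma ker_lip rho v w : 0 < rho -> `|ker rho v - ker rho w| <= 2 * rho ^- 3 * nm (v - w).
Proof.
move=> rho0; rewrite /ker -mulrBr normrM ger0_norm ?invr_ge0 ?sqr_ge0 //.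
have -> : 2 * rho ^- 3 * nm (v - w) = rho ^- 2 * (nm (v - w) / rho + nm (v - w) / rho).
  by field; rewrite gt_eqF.
rewrite ler_wpM2l ?invr_ge0 ?sqr_ge0 //.
set a := tent _; set b := tent _; set c := tent _; set d := tent _.
have ac : `|a - c| <= nm (v - w) / rho.
  apply: le_trans (tent_lip _ _) _; rewrite -mulrBl normrM normfV (gtr0_norm rho0).
  rewrite ler_wpM2r ?invr_ge0 ?(ltW rho0) //; apply: le_trans (normRe_le _).
  by rewrite le_eqVlt; apply/orP; left; apply/eqP; case: (v) => ? ?; case: (w) => ? ?.
have bd : `|b - d| <= nm (v - w) / rho.
  apply: le_trans (tent_lip _ _) _; rewrite -mulrBl normrM normfV (gtr0_norm rho0).
  rewrite ler_wpM2r ?invr_ge0 ?(ltW rho0) //; apply: le_trans (normIm_le _).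
  by rewrite le_eqVlt; apply/orP; left; apply/eqP; case: (v) => ? ?; case: (w) => ? ?.
have -> : a * b - c * d = (a - c) * b + c * (b - d) by ring.
apply: le_trans (ler_normD _ _) _; rewrite !normrM lerD //.
  by apply: le_trans ac; rewrite ler_piMr // ger0_norm ?tent_ge0 ?tent_le1.
by apply: le_trans bd; rewrite ler_piMl // ger0_norm ?tent_ge0 ?tent_le1.
Qed.

End TentKernel.

Section LatticeSums.
Variable R : realType.

(** A summand supported away from the ends of the window does not notice a translation by [v]. This
    plays the role of translation invariance of an integral. *)
Lemma sum_shift (K : nat) (v : int) (F : int -> R) :
  (forall i : int, F i != 0 -> (0 <= i < K%:Z)%R /\ (0 <= i - v < K%:Z)%R) ->
  \sum_(i < K) F (i%:Z + v) = \sum_(i < K) F i%:Z.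
Proof.
move=> H.
have E1 (i : 'I_K) : F (i%:Z + v) = \sum_(j < K) if j%:Z == i%:Z + v then F j%:Z else 0.
  have [F0|/H [h1 _]] := eqVneq (F (i%:Z + v)) 0.
    by rewrite F0 big1 // => j _; case: eqP => // ->.
  have jK : (absz (i%:Z + v)%R < K)%N by lia.
  have jE : (Ordinal jK : nat)%:Z = i%:Z + v by rewrite /=; lia.
  rewrite (bigD1 (Ordinal jK)) //= jE eqxx big1 ?addr0 // => j /eqP jne.
  case: eqP => // jE'; exfalso; apply: jne; apply: val_inj => /=; lia.
have E2 (j : 'I_K) : F j%:Z = \sum_(i < K) if j%:Z == i%:Z + v then F j%:Z else 0.
  have [F0|/H [_ h1]] := eqVneq (F j%:Z) 0.
    by rewrite F0 big1 // => i _; case: eqP.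
  have iK : (absz (j%:Z - v)%R < K)%N by lia.
  have iE : (Ordinal iK : nat)%:Z = j%:Z - v by rewrite /=; lia.
  rewrite (bigD1 (Ordinal iK)) //= iE subrK eqxx big1 ?addr0 // => i /eqP ine.
  case: eqP => // jE'; exfalso; apply: ine; apply: val_inj => /=; lia.
rewrite (eq_bigr _ (fun i _ => E1 i)) exchange_big /=.
by apply: eq_bigr => j _; rewrite [RHS]E2.
Qed.

Lemma sum_shift2 (K : nat) (v w : int) (F : int -> int -> R) :
  (forall i j : int, F i j != 0 ->
     [/\ (0 <= i < K%:Z)%R, (0 <= i - v < K%:Z)%R,
         (0 <= j < K%:Z)%R & (0 <= j - w < K%:Z)%R]) ->
  \sum_(i < K) \sum_(j < K) F (i%:Z + v) (j%:Z + w) =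
  \sum_(i < K) \sum_(j < K) F i%:Z j%:Z.
Proof.
move=> H.
rewrite (sum_shift (v := v) (F := fun i => \sum_(j < K) F i (j%:Z + w))).
  by apply: eq_bigr => i _; apply: sum_shift => j /H [].
move=> i Fi.
have [j Fj] : exists j : 'I_K, F i (j%:Z + w) != 0.
  apply/existsP; rewrite -[[exists _, _]]negbK negb_exists; apply: contra Fi.
  by move=> /forallP h; rewrite big1 // => j _; apply/eqP; move: (h j); rewrite negbK.
by have [] := H _ _ Fj.
Qed.

Lemma count_near (K : nat) (kap a y : R) : 0 < kap -> 0 <= y ->
  \sum_(i < K) (`|kap * i%:R + a| <= y)%R%:R <= 2 * y / kap + 1.
Proof.
move=> kap0 y0; set p := fun i : nat => `|kap * i%:R + a| <= y.
have y2 : 0 <= 2 * y / kap by rewrite divr_ge0 // ?mulr_ge0 // ltW.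
have -> : \sum_(i < K) (p i)%:R = (#|[pred i : 'I_K | p i]|)%:R :> R.
  by rewrite -sum1_card natr_sum [RHS]big_mkcond /=; apply: eq_bigr => i _; rewrite inE; case: (p i).
case: (pickP [pred i : 'I_K | p i]) => [i1 pi1|A0]; last first.
  by rewrite eq_card0 //; lra.
have [i0 pi0 i0min] := arg_minnP (fun i : 'I_K => i : nat) pi1.
pose m := Num.truncn (2 * y / kap).
suff cA : (#|[pred i : 'I_K | p i]| <= m.+1)%N.
  apply: le_trans (_ : (m.+1)%:R <= _); first by rewrite ler_nat.
  by rewrite -natr1 lerD2r truncn_le.
rewrite cardE -(size_map val) -(size_iota i0 m.+1).
apply: uniq_leq_size; first by rewrite map_inj_uniq ?enum_uniq //; exact: val_inj.
move=> k /mapP[l]; rewrite mem_enum => pi ->{k}.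
rewrite mem_iota i0min //= addnS ltnS -leq_subLR truncn_ge_nat //.
rewrite natrB ?i0min // ler_pdivlMr //.
move: (pi) (pi0); rewrite !inE /p !ler_norml => /andP[_ h1] /andP[h2 _].
rewrite mulrBl; lra.
Qed.

End LatticeSums.

Section Powers.
Variable R : rcfType.
Local Notation nm := (@Normc.normc R).

(** Bernoulli's inequality in the form (1 + u)^n (1 - n u) <= 1. *)
Lemma expr1D_le2 (u : R) n : 0 <= u -> n%:R * u <= 1/2 -> (1 + u) ^+ n <= 2.
Proof.
move=> u0 h.
have H k : (k <= n)%N -> (1 + u) ^+ k * (1 - k%:R * u) <= 1.
  elim: k => [|k IH] kn; first by rewrite expr0 mul0r subr0 mulr1.
  apply: le_trans (IH (ltnW kn)); rewrite exprS -natr1.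
  have X0 : 0 <= (1 + u) ^+ k by rewrite exprn_ge0 //; lra.
  have inner : (1 + u) * (1 - (k%:R + 1) * u) <= 1 - k%:R * u.
    by have := ler0n R k; nra.
  by have := ler_wpM2l X0 inner; lra.
have := H n (leqnn _); have : 0 <= (1 + u) ^+ n by rewrite exprn_ge0 //; lra.
by move: (_ ^+ n) => X; nra.
Qed.

(** Dividing by the lower bound [rr] instead of one factor [M] keeps the exponent [n] and covers
    [n = 0]. *)
Lemma nm_expB (a b : R[i]) (M rr : R) n : 0 < rr -> rr <= M -> nm a <= M -> nm b <= M ->
  nm (a ^+ n - b ^+ n) <= n%:R * nm (a - b) * M ^+ n / rr.
Proof.
move=> rr0 rM aM bM; have M0 : 0 < M := lt_le_trans rr0 rM.
elim: n => [|n IH]; first by rewrite !expr0 subrr nm0 !mul0r.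
have -> : a ^+ n.+1 - b ^+ n.+1 = a * (a ^+ n - b ^+ n) + (a - b) * b ^+ n.
  by rewrite !exprS; ring.
apply: le_trans (nmD _ _) _; rewrite !nmM nmX.
apply: le_trans (_ : M * (n%:R * nm (a - b) * M ^+ n / rr) + nm (a - b) * M ^+ n <= _).
  apply: lerD; first by rewrite ler_pM ?nm_ge0.
  by rewrite ler_wpM2l ?nm_ge0 // lerXn2r ?nnegrE ?nm_ge0 // ltW.
rewrite exprS -natr1.
have -> : (n%:R + 1) * nm (a - b) * (M * M ^+ n) / rr =
  M * (n%:R * nm (a - b) * M ^+ n / rr) + nm (a - b) * M ^+ n * (M / rr).
  by field; rewrite gt_eqF.
rewrite lerD2l ler_peMr ?mulr_ge0 ?nm_ge0 ?exprn_ge0 ?(ltW M0) //.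
by rewrite ler_pdivlMr // mul1r.
Qed.

End Powers.

Ltac nneg := repeat first [ done | apply: ltW; assumption | exact: sqr_ge0 | apply: addr_ge0 | apply: mulr_ge0
  | apply: exprn_ge0 | rewrite invr_ge0 | apply: nm_ge0 ].

(** * Translating the lattice sum of one pair of words *)

Section PairShift.
Variable R : realType.
Local Notation nm := (@Normc.normc R).

Definition lpt (z0 : R[i]) (kap : R) (i j : int) : R[i] :=
  z0 + ((kap * i%:~R) +i* (kap * j%:~R))%C.

Lemma lptD z0 kap i j v w :
  lpt z0 kap (i + v) (j + w) = lpt z0 kap i j + lpt 0 kap v w.
Proof.
rewrite /lpt add0r -addrA; congr (_ + _).
by apply/eqP; rewrite eq_complex /= !intrD !mulrDr !eqxx.
Qed.

Variables (rr B dl C1 Lc mu : R).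
Hypotheses (rr_gt0 : 0 < rr) (B_ge0 : 0 <= B) (dl_gt0 : 0 < dl) (C1_ge1 : 1 <= C1)
  (Lc_ge0 : 0 <= Lc).

(** Constants in units of [rho] or [tau]. [A]: both kernels vanish where the modulus of [H] exceeds
    [A * rho]; the rest is the zone. [A1]: diameter of the zone. [A2]: length of the translation.
    [A3] and [A4]: the zone enlarged by one and by two translations. [A5]: how well the translation
    imitates [e]. [A6]: the final constant. *)
Let A := 2 + C1.
Let A1 := 4 * A / dl.
Let A2 := C1 / dl + 2 * C1.
Let A3 := A1 + A2.
Let A4 := A3 + A2.
Let A5 := 2 * A2 * (A + B * A4) / rr + 2 * A3 * B * A2 / rr + A2 * B * (A2 + A3)
          + 2 * B * C1 + C1 * A3.
Let A6 := (2 * A5 + Lc * A2) * (2 * A3 + C1) ^+ 2.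

Let C1_ge0 : 0 <= C1. Proof. exact: le_trans ler01 C1_ge1. Qed.
Let A_ge0 : 0 <= A. Proof. by rewrite /A addr_ge0. Qed.
Let A1_ge0 : 0 <= A1.
Proof. by rewrite /A1 divr_ge0 ?mulr_ge0 ?(ltW dl_gt0). Qed.
Let A2_ge0 : 0 <= A2.
Proof. by rewrite /A2 addr_ge0 ?divr_ge0 ?(ltW dl_gt0) // mulr_ge0. Qed.
Let A3_ge0 : 0 <= A3. Proof. by rewrite /A3 addr_ge0. Qed.
Let A4_ge0 : 0 <= A4. Proof. by rewrite /A4 addr_ge0. Qed.
Let A5_ge0 : 0 <= A5.
Proof.
by rewrite /A5; nneg.
Qed.
Variables (rho kap : R) (K n : nat) (z0 : R[i]) (D : R[i] -> Prop)
  (G G1 e : R[i] -> R[i]) (chi : R[i] -> R).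
Hypotheses (rho_gt0 : 0 < rho) (rho_le1 : rho <= 1) (kap_gt0 : 0 < kap)
  (kap_le : kap <= C1 * rho ^+ 2).
Hypotheses (D_ge : forall z, D z -> rr <= nm z) (D_le1 : forall z, D z -> nm z <= 1)
  (D_diam : forall z w, D z -> D w -> B * nm (w - z) <= dl / 2).
Hypotheses (G_taylor : forall z w, D z -> D w ->
    nm (G w - G z - G1 z * (w - z)) <= B * nm (w - z) ^+ 2)
  (G_lip : forall z w, D z -> D w -> nm (G w - G z) <= B * nm (w - z))
  (G1_lip : forall z w, D z -> D w -> nm (G1 w - G1 z) <= B * nm (w - z))
  (G1_le : forall z, D z -> nm (G1 z) <= B)
  (G_trans : forall z, D z -> nm (G z) < dl -> dl <= nm (G1 z)).
Hypotheses (e_le : forall z, D z -> nm (e z) <= C1 * rho)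
  (e_lip : forall z w, D z -> D w -> nm (e w - e z) <= C1 * rho * nm (w - z)).
Hypotheses (chi01 : forall z, 0 <= chi z <= 1)
  (chi_lip : forall z w, `|chi z - chi w| <= Lc * nm (z - w))
  (chi_D : forall z w, chi z != 0 -> nm w <= mu -> D (z + w))
  (chi_K : forall (i j v : int), chi (lpt z0 kap i j) != 0 -> `|kap * v%:~R| <= mu ->
     (0 <= i + v < K%:Z)%R /\ (0 <= j + v < K%:Z)%R).

(** Where z^n G(z) is of size [rho], [G] is at most of size [tau]; as the derivative of [G] is at
    least [dl] there, [tau] is also the length scale of the zone. *)
Let tau := rho / rr ^+ n.
Let H z := z ^+ n * G z.
Hypotheses (tau1 : A * tau < dl) (tau2 : A2 * tau <= mu)
  (tau3 : n%:R * (A4 * tau / rr) <= 1/2).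

Let tau_gt0 : 0 < tau. Proof. by rewrite divr_gt0 ?exprn_gt0. Qed.

Let rr1 z : D z -> rr <= 1. Proof. by move=> Dz; exact: le_trans (D_ge Dz) (D_le1 Dz). Qed.

Let rho_tau z : D z -> rho <= tau.
Proof.
move=> Dz; rewrite /tau ler_pdivlMr ?exprn_gt0 // ler_piMr ?(ltW rho_gt0) //.
by apply: exprn_ile1; [exact: ltW | exact: rr1 Dz].
Qed.

Let kap_tau z : D z -> kap <= C1 * tau.
Proof.
move=> Dz; apply: le_trans kap_le _; rewrite ler_wpM2l //.
by apply: le_trans (rho_tau Dz); rewrite expr2 ler_piMr // ltW.
Qed.

Let Zs z := D z /\ nm (H z) <= A * rho.

Let powD z : D z -> 0 < nm z ^+ n /\ rr ^+ n <= nm z ^+ n.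
Proof.
move=> Dz; have rz := D_ge Dz; split; first by rewrite exprn_gt0 // (lt_le_trans rr_gt0).
by rewrite lerXn2r // nnegrE ?nm_ge0 // ltW.
Qed.

Let Zs_G z : Zs z -> nm (G z) <= A * tau.
Proof.
case=> Dz; rewrite nmM nmX => h.
have [p1 p2] := powD Dz; have r0 : 0 < rr ^+ n by rewrite exprn_gt0.
rewrite /tau mulrA ler_pdivlMr //; apply: le_trans h; rewrite mulrC.
by rewrite ler_wpM2r ?nm_ge0.
Qed.

(** On the zone [G1] is at least [dl], and [D] is so small that the quadratic Taylor term takes at
    most half of the linear one. Hence the zone is a single cluster of diameter O(tau). *)
Let Zs_close z w : Zs z -> Zs w -> nm (w - z) <= A1 * tau.
Proof.
move=> Hz Hw; have [Dz _] := Hz; have [Dw _] := Hw.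
have Gz := Zs_G Hz; have Gw := Zs_G Hw.
have G1z : dl <= nm (G1 z) by apply: G_trans => //; apply: le_lt_trans tau1.
set x := nm (w - z).
have x0 : 0 <= x by exact: nm_ge0.
have h1 : dl * x <= nm (G1 z * (w - z)) by rewrite nmM ler_wpM2r ?nm_ge0.
have h2 : nm (G1 z * (w - z)) <= nm (G w) + nm (G z) + B * x ^+ 2.
  apply: le_trans (_ : nm (G w - G z) + nm (G w - G z - G1 z * (w - z)) <= _).
    apply: le_trans (nmB _ _); rewrite opprB addrCA subrr addr0; exact: lexx.
  by apply: lerD; [exact: nmB | exact: G_taylor].
have h3 : B * x ^+ 2 <= dl / 2 * x by rewrite expr2 mulrA ler_wpM2r // D_diam.
have -> : A1 * tau = (4 * (A * tau)) / dl by rewrite /A1; ring.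
rewrite ler_pdivlMr //; lra.
Qed.

Section AtZero.
Variable zs : R[i].
Hypothesis Zzs : Zs zs.

Let Dzs : D zs. Proof. by case: Zzs. Qed.
Let x := nm zs.
Let G1zs : dl <= nm (G1 zs).
Proof. by apply: G_trans => //; apply: le_lt_trans tau1; exact: Zs_G. Qed.
(** A Newton step: the derivative of [H] at [zs] is [zs ^+ n * G1 zs] up to the term n zs^(n-1)
    G(zs), which is smaller by a factor of order n tau. The lattice vector [v] is this step rounded
    down in each coordinate. *)
Let vhat := e zs / (zs ^+ n * G1 zs).
Let v1 := Num.floor (Re vhat / kap).
Let v2 := Num.floor (Im vhat / kap).
Let v := lpt 0 kap v1 v2.

Let x_n : 0 < x ^+ n. Proof. by have [] := powD Dzs. Qed.
Let x_n1 : x ^+ n <= 1. Proof. by rewrite exprn_ile1 ?nm_ge0 // D_le1. Qed.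

Let den_neq0 : zs ^+ n * G1 zs != 0.
Proof. by rewrite -nm_gt0 nmM nmX mulr_gt0 // (lt_le_trans dl_gt0). Qed.

Let floor_err (y : R) : `|kap * (Num.floor (y / kap))%:~R - y| <= kap.
Proof.
have /andP[h1 h2] := floor_itv (y / kap).
rewrite intrD in h2.
move: h1 h2; rewrite ler_pdivlMr // ltr_pdivrMr // => h1 h2.
rewrite ler_norml; apply/andP; split; lra.
Qed.

Let v_err : nm (v - vhat) <= 2 * kap.
Proof.
apply: le_trans (nm_le_ReIm _) _.
have h1 := floor_err (Re vhat); have h2 := floor_err (Im vhat).
rewrite /v /lpt add0r -/v1 -/v2; rewrite -/v1 in h1; rewrite -/v2 in h2.
by move: h1 h2; case: (vhat) => a b /= h1 h2; lra.
Qed.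

Let kap_rho : kap <= C1 * rho.
Proof.
apply: le_trans kap_le _; rewrite ler_wpM2l //.
by rewrite expr2 ler_piMr // ltW.
Qed.

(** The weight [x ^+ n] is kept because the increments of [H] carry the same power; bounding [v] by
    a multiple of [tau] alone would lose a factor (x / rr)^n. *)
Let v_xn : nm v * x ^+ n <= A2 * rho.
Proof.
have h : nm vhat * x ^+ n <= C1 / dl * rho.
  rewrite /vhat nmM nmV nmM nmX -/x invfM mulrA mulrAC mulfVK ?gt_eqF //.
  rewrite mulrAC ler_pM ?nm_ge0 ?invr_ge0 ?nm_ge0 ?e_le // lef_pV2 ?posrE //.
  exact: lt_le_trans G1zs.
have h2 : nm v <= nm vhat + 2 * kap.
  by apply: le_trans (_ : _ <= nm vhat + nm (v - vhat)) _;
    [rewrite -{1}(subrKC vhat v); exact: nmD | rewrite lerD2l].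
apply: le_trans (_ : (nm vhat + 2 * kap) * x ^+ n <= _).
  by rewrite ler_wpM2r // ltW.
have h3 : 2 * kap * x ^+ n <= 2 * kap by rewrite ler_piMr // mulr_ge0 // ltW.
by have := kap_rho; rewrite /A2 !mulrDl; lra.
Qed.

Let v_le : nm v <= A2 * tau.
Proof.
have [_ p2] := powD Dzs.
rewrite /tau mulrA ler_pdivlMr ?exprn_gt0 //; apply: le_trans v_xn.
by rewrite ler_wpM2l ?nm_ge0.
Qed.

Let M := x + A4 * tau.

(** Within distance [A4 * tau] of [zs] all n-th powers are at most twice [x ^+ n], because n tau is
    small. *)
Let M_n : M ^+ n <= 2 * x ^+ n.
Proof.
have x0 : 0 < x by apply: lt_le_trans rr_gt0 (D_ge Dzs).
have -> : M = x * (1 + A4 * tau / x) by rewrite /M; field; rewrite gt_eqF.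
rewrite exprMn mulrC ler_wpM2r ?(ltW x_n) //.
have u0 : 0 <= A4 * tau / x.
  by apply: divr_ge0 (ltW x0); exact: mulr_ge0 (ltW tau_gt0).
apply: expr1D_le2 => //; apply: le_trans tau3; rewrite ler_wpM2l //.
apply: ler_wpM2l; first exact: mulr_ge0 (ltW tau_gt0).
rewrite lef_pV2 ?posrE //; exact: D_ge.
Qed.

(* [v] is chosen so that translating [lam] by [v] moves [H lam] by [e lam], up to a
   relative error of order [n * tau]. *)
Let H_shift z : D z -> D (z + v) -> nm (z - zs) <= A3 * tau ->
  nm (H (z + v) - (H z + e z)) <= A5 * n.+1%:R * rho * tau.
Proof.
move=> Dz Dzv zz.
have A4t : 0 <= A4 * tau := mulr_ge0 A4_ge0 (ltW tau_gt0).
have M0 : 0 <= M := addr_ge0 (nm_ge0 _) A4t.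
have rM : rr <= M.
  by rewrite /M (le_trans (D_ge Dzs)) // lerDl.
have t0 := ltW tau_gt0.
have zvz : nm (z + v - zs) <= A4 * tau.
  rewrite addrAC /A4 mulrDl; apply: le_trans (nmD _ _) _; exact: lerD.
have zM : nm z <= M.
  rewrite -(subrKC zs z); apply: le_trans (nmD _ _) _; rewrite lerD2l.
  by apply: le_trans zz _; rewrite ler_wpM2r // /A4 lerDl.
have zsM : x <= M by rewrite lerDl.
have zvM : nm (z + v) <= M.
  by rewrite -(subrKC zs (z + v)); apply: le_trans (nmD _ _) _; rewrite lerD2l.
have vE : e zs = zs ^+ n * G1 zs * vhat by rewrite /vhat mulrC mulfVK.
(* In this order: change of the power times the small value of [G], change of the power times change
   of [G], Taylor remainder, drift of the derivative, rounding of [vhat], drift of [e]. Each is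
   O(rho tau), the first two with an extra factor [n]. *)
have E : H (z + v) - (H z + e z) =
  ((z + v) ^+ n - z ^+ n) * G (z + v) + (z ^+ n - zs ^+ n) * (G (z + v) - G z)
  + zs ^+ n * (G (z + v) - G z - G1 z * (z + v - z))
  + zs ^+ n * ((G1 z - G1 zs) * v)
  + zs ^+ n * G1 zs * (v - vhat) - (e z - e zs).
  by rewrite /H vE; ring.
have nv0 := nm_ge0 v.
have T1 : nm (((z + v) ^+ n - z ^+ n) * G (z + v)) <=
    2 * A2 * (A + B * A4) / rr * (n%:R * rho * tau).
  rewrite nmM; apply: le_trans (_ : (n%:R * nm v * (2 * x ^+ n) / rr) * ((A + B * A4) * tau) <= _).
    apply: ler_pM; rewrite ?nm_ge0 //.
      have := nm_expB n rr_gt0 rM zvM zM; rewrite (addrAC z) subrr add0r => h.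
      apply: le_trans h _; rewrite ler_wpM2r ?invr_ge0 ?(ltW rr_gt0) //.
      by rewrite ler_wpM2l // mulr_ge0.
    apply: le_trans (_ : nm (G zs) + nm (G (z + v) - G zs) <= _).
      by rewrite -{1}(subrKC (G zs) (G (z + v))); exact: nmD.
    rewrite mulrDl lerD ?Zs_G // -mulrA.
    apply: le_trans (G_lip Dzs Dzv) _; exact: ler_wpM2l.
  have -> : n%:R * nm v * (2 * x ^+ n) / rr * ((A + B * A4) * tau) =
    nm v * x ^+ n * (2 * (A + B * A4) / rr * n%:R * tau) by ring.
  have -> : 2 * A2 * (A + B * A4) / rr * (n%:R * rho * tau) =
    A2 * rho * (2 * (A + B * A4) / rr * n%:R * tau) by ring.
  by apply: ler_wpM2r => //; nneg.
have T2 : nm ((z ^+ n - zs ^+ n) * (G (z + v) - G z)) <=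
    2 * A3 * B * A2 / rr * (n%:R * rho * tau).
  rewrite nmM; apply: le_trans (_ : (n%:R * (A3 * tau) * (2 * x ^+ n) / rr) * (B * nm v) <= _).
    apply: ler_pM; rewrite ?nm_ge0 //.
      apply: le_trans (nm_expB n rr_gt0 rM zM zsM) _.
      rewrite ler_wpM2r ?invr_ge0 ?(ltW rr_gt0) //.
      by rewrite ler_pM ?mulr_ge0 ?exprn_ge0 ?nm_ge0 // ler_wpM2l.
    by apply: le_trans (G_lip Dz Dzv) _; rewrite (addrAC z) subrr add0r.
  have -> : n%:R * (A3 * tau) * (2 * x ^+ n) / rr * (B * nm v) =
    nm v * x ^+ n * (2 * A3 * B / rr * n%:R * tau) by ring.
  have -> : 2 * A3 * B * A2 / rr * (n%:R * rho * tau) =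
    A2 * rho * (2 * A3 * B / rr * n%:R * tau) by ring.
  by apply: ler_wpM2r => //; nneg.
have T3 : nm (zs ^+ n * (G (z + v) - G z - G1 z * (z + v - z))) <= A2 * B * A2 * (rho * tau).
  rewrite nmM nmX -/x; apply: le_trans (_ : x ^+ n * (B * nm v ^+ 2) <= _).
    rewrite ler_wpM2l ?(ltW x_n) //; apply: le_trans (G_taylor Dz Dzv) _.
    by rewrite (addrAC z) subrr add0r.
  have -> : x ^+ n * (B * nm v ^+ 2) = nm v * x ^+ n * (B * nm v) by ring.
  have -> : A2 * B * A2 * (rho * tau) = A2 * rho * (B * (A2 * tau)) by ring.
  by rewrite ler_pM ?mulr_ge0 ?(ltW x_n) // ler_wpM2l.
have T4 : nm (zs ^+ n * ((G1 z - G1 zs) * v)) <= A2 * B * A3 * (rho * tau).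
  rewrite !nmM nmX -/x; apply: le_trans (_ : x ^+ n * (B * (A3 * tau) * nm v) <= _).
    rewrite ler_wpM2l ?(ltW x_n) // ler_wpM2r //.
    by apply: le_trans (G1_lip Dzs Dz) _; rewrite ler_wpM2l.
  have -> : x ^+ n * (B * (A3 * tau) * nm v) = nm v * x ^+ n * (B * (A3 * tau)) by ring.
  have -> : A2 * B * A3 * (rho * tau) = A2 * rho * (B * (A3 * tau)) by ring.
  by apply: ler_wpM2r => //; nneg.
have T5 : nm (zs ^+ n * G1 zs * (v - vhat)) <= 2 * B * C1 * (rho * tau).
  rewrite !nmM nmX -/x; apply: le_trans (_ : 1 * B * (2 * kap) <= _).
    by rewrite ler_pM ?mulr_ge0 ?nm_ge0 ?(ltW x_n) // ler_pM ?nm_ge0 ?(ltW x_n) // G1_le.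
  (* The rounding error is of the order of the mesh, and here the mesh has to be O(rho^2). *)
  have : kap <= C1 * (rho * tau).
    apply: le_trans kap_le _; rewrite ler_wpM2l //.
    by rewrite expr2 ler_wpM2l ?(ltW rho_gt0) // (rho_tau Dzs).
  move=> /(ler_wpM2l (mulr_ge0 (ler0n R 2) B_ge0)); lra.
have T6 : nm (e z - e zs) <= C1 * A3 * (rho * tau).
  apply: le_trans (e_lip Dzs Dz) _.
  have -> : C1 * A3 * (rho * tau) = C1 * rho * (A3 * tau) by ring.
  by rewrite ler_wpM2l // mulr_ge0 ?(ltW rho_gt0).
rewrite E.
have D5 a b c d f : nm (a + b + c + d + f) <= nm a + nm b + nm c + nm d + nm f.
  by do 4 (apply: le_trans (nmD _ _) _; apply: lerD => //).
apply: le_trans (nmB _ _) _; apply: le_trans (lerD (D5 _ _ _ _ _) (lexx _)) _.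
have rt : 0 <= rho * tau by rewrite mulr_ge0 // ltW.
set Q1 := 2 * A2 * (A + B * A4) / rr in T1.
set Q2 := 2 * A3 * B * A2 / rr in T2.
have Q1_0 : 0 <= Q1.
  by rewrite /Q1; nneg.
have Q2_0 : 0 <= Q2 by rewrite /Q2; nneg.
have AE : A5 * n.+1%:R * rho * tau =
  (Q1 + Q2 + A2 * B * (A2 + A3) + 2 * B * C1 + C1 * A3) * (n.+1%:R * (rho * tau)).
  by rewrite /A5 -/Q1 -/Q2; ring.
rewrite AE.
have nn : rho * tau <= n.+1%:R * (rho * tau).
  by rewrite ler_peMl // ler1n.
have n1 : n%:R * rho * tau <= n.+1%:R * (rho * tau).
  by rewrite -mulrA ler_wpM2r // ler_nat.
set X := n.+1%:R * (rho * tau) in nn n1 *.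
have C10 := C1_ge0.
have m1 := ler_wpM2l Q1_0 n1; have m2 := ler_wpM2l Q2_0 n1.
have m3 := ler_wpM2l (mulr_ge0 (mulr_ge0 A2_ge0 B_ge0) A2_ge0) nn.
have m4 := ler_wpM2l (mulr_ge0 (mulr_ge0 A2_ge0 B_ge0) A3_ge0) nn.
have m5 := ler_wpM2l (mulr_ge0 (mulr_ge0 (ler0n R 2) B_ge0) C10) nn.
have m6 := ler_wpM2l (mulr_ge0 C10 A3_ge0) nn.
move: T1 T2 T3 T4 T5 T6 m1 m2 m3 m4 m5 m6.
move: (nm _) (nm _) (nm _) (nm _) (nm _) (nm _) => n0 n2 n3 n4 n5 n6.
rewrite !mulrDl !mulrDr; lra.
Qed.

Lemma shift_vector : exists v1 v2 : int, nm (lpt 0 kap v1 v2) <= A2 * tau /\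
  forall z, D z -> D (z + lpt 0 kap v1 v2) -> nm (z - zs) <= A3 * tau ->
  nm (H (z + lpt 0 kap v1 v2) - (H z + e z)) <= A5 * n.+1%:R * rho * tau.
Proof. by exists v1, v2; split; [exact: v_le | exact: H_shift]. Qed.

End AtZero.

Let near (a : R) (i : nat) := `|kap * i%:R + a| <= A3 * tau.

(** Each kernel alone contributes up to rho^-2 at O((tau / kap)^2) lattice points of the zone.
    Reindexing the unperturbed sum by the translation matches its terms with the perturbed ones;
    kernel and cutoff being Lipschitz, a factor of order (n + 1) tau is gained. *)
Lemma pair_shift_bound :
  `|\sum_(i < K) \sum_(j < K) chi (lpt z0 kap i j) *
     (ker rho (H (lpt z0 kap i j) + e (lpt z0 kap i j)) - ker rho (H (lpt z0 kap i j)))|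
  <= A6 * n.+1%:R * rho ^- 2 * tau ^+ 3 * kap ^- 2.
Proof.
have t0 := ltW tau_gt0.
pose P (i j : int) := lpt z0 kap i j.
have chiD z : chi z != 0 -> D z.
  move=> h; rewrite -(addr0 z); apply: chi_D => //; rewrite nm0.
  by apply: le_trans tau2; exact: mulr_ge0.
have kH z : ker rho (H z) != 0 -> nm (H z) <= A * rho.
  apply: contraR; rewrite -ltNge => h; rewrite ker_eq0 //.
  by apply: le_trans (ltW h); rewrite ler_wpM2r ?(ltW rho_gt0) // /A lerDl.
have kHe z : D z -> ker rho (H z + e z) != 0 -> nm (H z) <= A * rho.
  move=> Dz; apply: contraR; rewrite -ltNge => h; rewrite ker_eq0 //.
  have h1 := e_le Dz; have := nmB_ge (H z) (- e z); rewrite opprK nmN.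
  by rewrite /A mulrDl in h; lra.
(* If no lattice point in the support of [chi] lies in the zone, all terms vanish; otherwise any
   such point serves as [zs], and no actual zero has to be found. *)
case: (pickP [pred p : 'I_K * 'I_K | (chi (P p.1 p.2) != 0)
   && (nm (H (P p.1 p.2)) <= A * rho)]) => [[i0 j0] /= /andP[c0 h0]|noz]; last first.
  rewrite big1 ?normr0; last first.
    move=> i _; rewrite big1 // => j _; have [->|c0] := eqVneq (chi (lpt z0 kap i j)) 0.
      by rewrite mul0r.
    have hn : ~~ (nm (H (P i j)) <= A * rho).
      by apply/negP => hn; have := noz (i, j); rewrite /= c0 hn.
    have -> : ker rho (H (lpt z0 kap i j)) = 0.
      by apply/eqP; move: hn; apply: contraR; exact: kH.
    have -> : ker rho (H (lpt z0 kap i j) + e (lpt z0 kap i j)) = 0.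
      by apply/eqP; move: hn; apply: contraR; apply: kHe; exact: chiD.
    by rewrite subrr mulr0.
  by nneg.
have Zzs : Zs (P i0 j0) by split => //; exact: chiD.
have [v1 [v2 [vle Hsh]]] := shift_vector Zzs.
set v := lpt 0 kap v1 v2 in vle Hsh.
set zs := P i0 j0 in Zzs Hsh.
have vmu : nm v <= mu by apply: le_trans vle tau2.
have vmu1 : `|kap * v1%:~R| <= mu.
  by apply: le_trans vmu; apply: le_trans (normRe_le _); rewrite /v /lpt add0r.
have vmu2 : `|kap * v2%:~R| <= mu.
  by apply: le_trans vmu; apply: le_trans (normIm_le _); rewrite /v /lpt add0r.
have mu0 : 0 <= mu := le_trans (normr_ge0 _) vmu1.
pose F (i j : int) := chi (P i j) * ker rho (H (P i j)).
have Fsh := @sum_shift2 R K v1 v2 F.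
have {}Fsh : \sum_(i < K) \sum_(j < K) F i j =
    \sum_(i < K) \sum_(j < K) F (i%:Z + v1) (j%:Z + v2).
  rewrite Fsh // => i j; rewrite mulf_eq0 negb_or => /andP[c1 _].
  have k0 : `|kap * (0 : int)%:~R| <= mu by rewrite mulr0 normr0.
  have [a1 a2] := chi_K c1 k0; rewrite !addr0 in a1 a2.
  have [] := chi_K (v := - v1) c1 _; first by rewrite mulrNz mulrN normrN.
  have [] := chi_K (v := - v2) c1 _; first by rewrite mulrNz mulrN normrN.
  by [].
(* The perturbed term minus the translated unperturbed one; it is nonzero only within [A3 * tau] of
   [zs]. *)
pose U (i j : int) := chi (P i j) * ker rho (H (P i j) + e (P i j))
   - chi (P i j + v) * ker rho (H (P i j + v)).
have -> : \sum_(i < K) \sum_(j < K) chi (lpt z0 kap i j) *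
     (ker rho (H (lpt z0 kap i j) + e (lpt z0 kap i j)) - ker rho (H (lpt z0 kap i j)))
   = \sum_(i < K) \sum_(j < K) U i j.
  transitivity (\sum_(i < K) \sum_(j < K) chi (P i j) * ker rho (H (P i j) + e (P i j))
     - \sum_(i < K) \sum_(j < K) F i j).
    rewrite -sumrB; apply: eq_bigr => i _; rewrite -sumrB; apply: eq_bigr => j _.
    by rewrite mulrBr.
  rewrite Fsh -sumrB; apply: eq_bigr => i _; rewrite -sumrB; apply: eq_bigr => j _.
  by rewrite /U /F /P lptD.
pose b := (2 * A5 + Lc * A2) * n.+1%:R * rho ^- 2 * tau.
have b0 : 0 <= b by rewrite /b; nneg.
have Pv i j : nm (P i j - (P i j + v)) = nm v by rewrite opprD addrA subrr add0r nmN.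
have Ub (i j : 'I_K) : `|U i j| <= b *
   ((near (Re z0 - Re zs) i)%:R * (near (Im z0 - Im zs) j)%:R).
  have [U0|Une] := eqVneq (U i j) 0; first by rewrite U0 normr0; nneg.
  have [DP [DPv Pzs]] : D (P i j) /\ D (P i j + v) /\ nm (P i j - zs) <= A3 * tau.
    have [E0|] := eqVneq (chi (P i j) * ker rho (H (P i j) + e (P i j))) 0.
      have : chi (P i j + v) * ker rho (H (P i j + v)) != 0.
        by apply: contra Une; rewrite /U E0 => /eqP ->; rewrite subrr.
      rewrite mulf_eq0 negb_or => /andP[c1 /kH h1].
      have D1 := chiD _ c1.
      have D2 : D (P i j) by rewrite -(addrK v (P i j)); apply: chi_D => //; rewrite nmN.
      split=> //; split=> //.
      have := Zs_close Zzs (conj D1 h1); have := nm_dist (P i j) (P i j + v) zs.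
      rewrite (Pv i j) /A3 mulrDl; lra.
    rewrite mulf_eq0 negb_or => /andP[c1 h1].
    have D1 := chiD _ c1.
    split=> //; split; first exact: chi_D.
    have := Zs_close Zzs (conj D1 (kHe _ D1 h1)); rewrite /A3 mulrDl.
    have : 0 <= A2 * tau by nneg.
    lra.
  have -> : near (Re z0 - Re zs) i.
    apply: le_trans Pzs; apply: le_trans (normRe_le _).
    rewrite le_eqVlt; apply/orP; left; apply/eqP; congr `|_|.
    rewrite /P /lpt; case: (z0) => a1 a2; case: (zs) => a3 a4 /=; ring.
  have -> : near (Im z0 - Im zs) j.
    apply: le_trans Pzs; apply: le_trans (normIm_le _).
    rewrite le_eqVlt; apply/orP; left; apply/eqP; congr `|_|.
    rewrite /P /lpt; case: (z0) => a1 a2; case: (zs) => a3 a4 /=; ring.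
  rewrite !mulr1.
  have -> : U i j = chi (P i j) * (ker rho (H (P i j) + e (P i j)) - ker rho (H (P i j + v)))
     + (chi (P i j) - chi (P i j + v)) * ker rho (H (P i j + v)) by rewrite /U; ring.
  apply: le_trans (ler_normD _ _) _.
  rewrite (normrM (chi _)) (normrM (chi _ - chi _)).
  have /andP[c0' c1'] := chi01 (P i j).
  have m1 : `|chi (P i j)| * `|ker rho (H (P i j) + e (P i j)) - ker rho (H (P i j + v))|
     <= 1 * (2 * rho ^- 3 * (A5 * n.+1%:R * rho * tau)).
    apply: ler_pM => //; first by rewrite ger0_norm.
    apply: le_trans (ker_lip _ _ rho_gt0) _; rewrite nmBC.
    apply: ler_wpM2l; first by nneg.
    exact: Hsh.
  have m2 : `|chi (P i j) - chi (P i j + v)| * `|ker rho (H (P i j + v))|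
     <= Lc * (A2 * tau) * rho ^- 2.
    apply: ler_pM => //; last by rewrite ger0_norm ?ker_ge0 ?ker_le.
    apply: le_trans (chi_lip _ _) _; apply: ler_wpM2l => //.
    by rewrite Pv.
  apply: le_trans (lerD m1 m2) _.
  have -> : b = 1 * (2 * rho ^- 3 * (A5 * n.+1%:R * rho * tau))
     + n.+1%:R * (Lc * (A2 * tau) * rho ^- 2).
    by rewrite /b; field; rewrite gt_eqF.
  rewrite lerD2l ler_peMl ?ler1n //; nneg.
apply: le_trans (ler_norm_sum _ _ _) _.
apply: le_trans (_ : \sum_(i < K) \sum_(j < K) b *
   ((near (Re z0 - Re zs) i)%:R * (near (Im z0 - Im zs) j)%:R) <= _).
  apply: ler_sum => i _; apply: le_trans (ler_norm_sum _ _ _) _.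
  by apply: ler_sum => j _; exact: Ub.
have -> : \sum_(i < K) \sum_(j < K) b *
   ((near (Re z0 - Re zs) i)%:R * (near (Im z0 - Im zs) j)%:R) =
   b * ((\sum_(i < K) (near (Re z0 - Re zs) i)%:R) * (\sum_(j < K) (near (Im z0 - Im zs) j)%:R)).
  rewrite big_distrlr /= mulr_sumr; apply: eq_bigr => i _.
  by rewrite mulr_sumr.
have y0 : 0 <= A3 * tau by nneg.
have cnt a : \sum_(i < K) (near a i)%:R <= (2 * A3 + C1) * tau / kap.
  apply: le_trans (count_near _ _ kap_gt0 y0) _.
  have -> : (2 * A3 + C1) * tau / kap = 2 * (A3 * tau) / kap + C1 * tau / kap by ring.
  by rewrite lerD2l ler_pdivlMr // mul1r; apply: kap_tau; exact: chiD c0.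
have -> : A6 * n.+1%:R * rho ^- 2 * tau ^+ 3 * kap ^- 2 =
  b * (((2 * A3 + C1) * tau / kap) * ((2 * A3 + C1) * tau / kap)).
  by rewrite /A6 /b; field; rewrite !gt_eqF.
apply: ler_wpM2l => //; apply: ler_pM => //; apply: sumr_ge0 => i _; exact: ler0n.
Qed.

End PairShift.

Section PairShiftUniform.
Variable R : realType.
Local Notation nm := (@Normc.normc R).

(** Fixes [c] and [A6] before the scale, the words and the lattice are known; (n + 1) tau <= c
    implies the three smallness conditions on [tau]. *)
Lemma pair_shift_uniform (rr B dl C1 Lc mu : R) :
  0 < rr -> 0 <= B -> 0 < dl -> 1 <= C1 -> 0 <= Lc -> 0 < mu ->
  exists c A6 : R, [/\ 0 < c, c <= 1, 0 <= A6 &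
  forall (rho kap : R) (K n : nat) (z0 : R[i]) (D : R[i] -> Prop)
    (G G1 e : R[i] -> R[i]) (chi : R[i] -> R),
  0 < rho -> rho <= 1 -> 0 < kap -> kap <= C1 * rho ^+ 2 ->
  (forall z, D z -> rr <= nm z) -> (forall z, D z -> nm z <= 1) ->
  (forall z w, D z -> D w -> B * nm (w - z) <= dl / 2) ->
  (forall z w, D z -> D w -> nm (G w - G z - G1 z * (w - z)) <= B * nm (w - z) ^+ 2) ->
  (forall z w, D z -> D w -> nm (G w - G z) <= B * nm (w - z)) ->
  (forall z w, D z -> D w -> nm (G1 w - G1 z) <= B * nm (w - z)) ->
  (forall z, D z -> nm (G1 z) <= B) ->
  (forall z, D z -> nm (G z) < dl -> dl <= nm (G1 z)) ->
  (forall z, D z -> nm (e z) <= C1 * rho) ->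
  (forall z w, D z -> D w -> nm (e w - e z) <= C1 * rho * nm (w - z)) ->
  (forall z, 0 <= chi z <= 1) ->
  (forall z w, `|chi z - chi w| <= Lc * nm (z - w)) ->
  (forall z w, chi z != 0 -> nm w <= mu -> D (z + w)) ->
  (forall (i j v : int), chi (lpt z0 kap i j) != 0 -> `|kap * v%:~R| <= mu ->
     (0 <= i + v < K%:Z)%R /\ (0 <= j + v < K%:Z)%R) ->
  n.+1%:R * (rho / rr ^+ n) <= c ->
  `|\sum_(i < K) \sum_(j < K) chi (lpt z0 kap i j) *
     (ker rho (lpt z0 kap i j ^+ n * G (lpt z0 kap i j) + e (lpt z0 kap i j))
      - ker rho (lpt z0 kap i j ^+ n * G (lpt z0 kap i j)))|
  <= A6 * n.+1%:R * rho ^- 2 * (rho / rr ^+ n) ^+ 3 * kap ^- 2].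
Proof.
move=> rr0 B0 dl0 C1_1 Lc0 mu0.
have C10 : 0 <= C1 by lra.
pose A := 2 + C1; pose A1 := 4 * A / dl; pose A2 := C1 / dl + 2 * C1.
pose A3 := A1 + A2; pose A4 := A3 + A2.
have A_0 : 0 <= A by rewrite /A; lra.
have A1_0 : 0 <= A1 by rewrite /A1; nneg.
have A2_0 : 0 <= A2 by rewrite /A2; nneg.
have A4_0 : 0 <= A4 by rewrite /A4 /A3; nneg.
pose c := Num.min (Num.min 1 (dl / (A + 1) / 2)) (Num.min (mu / (A2 + 1)) (rr / (2 * (A4 + 1)))).
have c0 : 0 < c.
  by rewrite !lt_min ltr01 !divr_gt0 ?mulr_gt0 //; lra.
have c1 : c <= 1 by rewrite !ge_min lexx.
have ca : c <= dl / (A + 1) / 2 by rewrite !ge_min lexx !orbT.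
have cb : c <= mu / (A2 + 1) by rewrite !ge_min lexx !orbT.
have cc : c <= rr / (2 * (A4 + 1)) by rewrite !ge_min lexx !orbT.
pose A5 := 2 * A2 * (A + B * A4) / rr + 2 * A3 * B * A2 / rr + A2 * B * (A2 + A3)
          + 2 * B * C1 + C1 * A3.
pose A6 := (2 * A5 + Lc * A2) * (2 * A3 + C1) ^+ 2.
exists c, A6; split=> //; last first.
  move=> rho kap K n z0 D G G1 e chi h1 h2 h3 h4 h5 h6 h7 h8 h9 h10 h11 h12 h13 h14 h15 h16 h17 h18 htau.
  have tau0 : 0 < rho / rr ^+ n by rewrite divr_gt0 ?exprn_gt0.
  have tc : rho / rr ^+ n <= c.
    by apply: le_trans htau; rewrite ler_peMl ?(ltW tau0) // ler1n.
  have tcn : n%:R * (rho / rr ^+ n) <= c.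
    by apply: le_trans htau; rewrite ler_wpM2r ?(ltW tau0) // ler_nat.
  apply: (pair_shift_bound rr0 B0 dl0 C1_1 Lc0 h1 h2 h3 h4 h5 h6 h7 h8 h9 h10 h11 h12 h13 h14 h15 h16 h17 h18).
  - rewrite -/A; move: (le_trans tc ca); rewrite -mulrA -invfM ler_pdivlMr; last by lra.
    move: (rho / _) tau0 => t t0 h; have := mulr_ge0 A_0 (ltW t0); clearbody A; lra.
  - rewrite -/A -/A2; move: (le_trans tc cb); rewrite ler_pdivlMr; last by lra.
    move: (rho / _) tau0 => t t0 h; have := mulr_ge0 A2_0 (ltW t0); clearbody A2; lra.
  - rewrite -/A -/A1 -/A2 -/A3 -/A4.
    move: (le_trans tcn cc); rewrite ler_pdivlMr; last by lra.
    move: (rho / _) tau0 => t t0 h.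
    have : 0 <= n%:R * t by rewrite mulr_ge0 // ltW.
    have -> : n%:R * (A4 * t / rr) = A4 * (n%:R * t) / rr by ring.
    by rewrite ler_pdivrMr //; move: (n%:R * t) h => u; clearbody A4; lra.
rewrite /A6 /A5; nneg.
Qed.

End PairShiftUniform.

(** * Horner bounds for polynomials with coefficients of modulus at most 2 *)

Section PolynomialBounds.
Variable R : rcfType.
Local Notation nm := (@Normc.normc R).
Local Notation cpoly := (map_poly (real_complex R)).
Implicit Types p : {poly R}.
Variables (q : R).
Hypothesis q1 : 0 <= q < 1.
Let B0 := 2 / (1 - q).
Let B1 := 2 / (1 - q) ^+ 2.

Let q0 : 0 <= q. Proof. by case/andP: q1. Qed.
Let q1' : 0 < 1 - q. Proof. by case/andP: q1 => _; rewrite subr_gt0. Qed.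
Let B0_ge0 : 0 <= B0. Proof. by rewrite divr_ge0 // ltW. Qed.
Let B1_ge0 : 0 <= B1. Proof. by rewrite divr_ge0 // exprn_ge0 // ltW. Qed.

(** Horner induction: removing the constant coefficient preserves the coefficient bound. The
    constants of the following lemmas are fixed points of the resulting recursions, such as B0 = B0
    q + 2 and B1 = B0 + B1 q, so they serve every degree. *)
Lemma bounded_coef_ind (C : R) (T : {poly R} -> Prop) : T 0 ->
  (forall (p : {poly R}) c, (forall k, `|p`_k| <= C) -> `|c| <= C -> T p -> T (p * 'X + c%:P)) ->
  forall p : {poly R}, (forall k, `|p`_k| <= C) -> T p.
Proof.
move=> T0 TS; elim/poly_ind => // p c IH h.
have hp k : `|p`_k| <= C.
  by have := h k.+1; rewrite coefD coefMX coefC /= addr0.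
apply: TS => //; last exact: IH.
by have := h 0%N; rewrite coefD coefMX coefC /= add0r.
Qed.

Lemma horner_cpoly_cons p (c : R) (z : R[i]) :
  (cpoly (p * 'X + c%:P)).[z] = (cpoly p).[z] * z + (c%:C)%C.
Proof. by rewrite rmorphD rmorphM /= map_polyX map_polyC !hornerE. Qed.

Lemma horner_cpoly_deriv_cons p (c : R) (z : R[i]) :
  (cpoly (p * 'X + c%:P)^`()).[z] = (cpoly p).[z] + (cpoly p^`()).[z] * z.
Proof.
rewrite derivD derivM derivC derivX addr0 mulr1 addrC.
by rewrite rmorphD rmorphM /= map_polyX !hornerE.
Qed.

Lemma cpoly_bound p z : (forall k, `|p`_k| <= 2) -> nm z <= q -> nm (cpoly p).[z] <= B0.
Proof.
move=> hp zq; move: p hp; apply: bounded_coef_ind; first by rewrite map_poly0 horner0 nm0.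
move=> p c hp hc IH; rewrite horner_cpoly_cons.
apply: le_trans (nmD _ _) _; rewrite nmM nm_real.
apply: le_trans (lerD (ler_pM (nm_ge0 _) (nm_ge0 _) IH zq) hc) _.
by rewrite le_eqVlt; apply/orP; left; apply/eqP; rewrite /B0; field; rewrite gt_eqF.
Qed.

Lemma cpoly_deriv_bound p z : (forall k, `|p`_k| <= 2) -> nm z <= q ->
  nm (cpoly p^`()).[z] <= B1.
Proof.
move=> hp zq; move: p hp; apply: bounded_coef_ind; first by rewrite deriv0 map_poly0 horner0 nm0.
move=> p c hp hc IH; rewrite horner_cpoly_deriv_cons.
apply: le_trans (nmD _ _) _; rewrite nmM.
apply: le_trans (lerD (cpoly_bound hp zq) (ler_pM (nm_ge0 _) (nm_ge0 _) IH zq)) _.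
by rewrite le_eqVlt; apply/orP; left; apply/eqP; rewrite /B0 /B1; field; rewrite gt_eqF.
Qed.

Lemma cpoly_lip p z w : (forall k, `|p`_k| <= 2) -> nm z <= q -> nm w <= q ->
  nm ((cpoly p).[w] - (cpoly p).[z]) <= B1 * nm (w - z).
Proof.
move=> hp zq wq; move: p hp; apply: bounded_coef_ind.
  by rewrite map_poly0 !horner0 subrr nm0 mulr_ge0 ?nm_ge0.
move=> p c hp hc IH; rewrite !horner_cpoly_cons.
have -> : (cpoly p).[w] * w + (c%:C)%C - ((cpoly p).[z] * z + (c%:C)%C) =
   ((cpoly p).[w] - (cpoly p).[z]) * w + (cpoly p).[z] * (w - z) by ring.
apply: le_trans (nmD _ _) _; rewrite !nmM.
apply: le_trans (lerD (ler_pM (nm_ge0 _) (nm_ge0 _) IH wq)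
  (ler_wpM2r (nm_ge0 _) (cpoly_bound hp zq))) _.
by rewrite le_eqVlt; apply/orP; left; apply/eqP; rewrite /B0 /B1; field; rewrite gt_eqF.
Qed.

Lemma cpoly_deriv_lip p z w : (forall k, `|p`_k| <= 2) -> nm z <= q -> nm w <= q ->
  nm ((cpoly p^`()).[w] - (cpoly p^`()).[z]) <= 2 * B1 / (1 - q) * nm (w - z).
Proof.
move=> hp zq wq; move: p hp; apply: bounded_coef_ind.
  by rewrite deriv0 map_poly0 !horner0 subrr nm0; nneg.
move=> p c hp hc IH; rewrite !horner_cpoly_deriv_cons.
have -> : (cpoly p).[w] + (cpoly p^`()).[w] * w - ((cpoly p).[z] + (cpoly p^`()).[z] * z) =
   ((cpoly p).[w] - (cpoly p).[z]) + (((cpoly p^`()).[w] - (cpoly p^`()).[z]) * w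
     + (cpoly p^`()).[z] * (w - z)) by ring.
apply: le_trans (nmD _ _) _; apply: le_trans (lerD (cpoly_lip hp zq wq) (nmD _ _)) _.
rewrite !nmM.
apply: le_trans (lerD (lexx _) (lerD (ler_pM (nm_ge0 _) (nm_ge0 _) IH wq)
  (ler_wpM2r (nm_ge0 _) (cpoly_deriv_bound hp zq)))) _.
by rewrite le_eqVlt; apply/orP; left; apply/eqP; rewrite /B0 /B1; field; rewrite gt_eqF.
Qed.

Lemma cpoly_taylor p z w : (forall k, `|p`_k| <= 2) -> nm z <= q -> nm w <= q ->
  nm ((cpoly p).[w] - (cpoly p).[z] - (cpoly p^`()).[z] * (w - z)) <=
  B1 / (1 - q) * nm (w - z) ^+ 2.
Proof.
move=> hp zq wq; move: p hp; apply: bounded_coef_ind.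
  by rewrite deriv0 map_poly0 !horner0 subrr mul0r subrr nm0; nneg.
move=> p c hp hc IH; rewrite !horner_cpoly_cons horner_cpoly_deriv_cons.
have -> : (cpoly p).[w] * w + (c%:C)%C - ((cpoly p).[z] * z + (c%:C)%C)
    - ((cpoly p).[z] + (cpoly p^`()).[z] * z) * (w - z) =
   ((cpoly p).[w] - (cpoly p).[z] - (cpoly p^`()).[z] * (w - z)) * z
     + ((cpoly p).[w] - (cpoly p).[z]) * (w - z) by ring.
apply: le_trans (nmD _ _) _; rewrite !nmM.
apply: le_trans (lerD (ler_pM (nm_ge0 _) (nm_ge0 _) IH zq)
  (ler_wpM2r (nm_ge0 _) (cpoly_lip hp zq wq))) _.
by rewrite le_eqVlt; apply/orP; left; apply/eqP; rewrite /B0 /B1; field; rewrite gt_eqF.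
Qed.

End PolynomialBounds.

(** * Energy of sign words *)

Section SignPolynomials.
Variable R : realType.
Local Notation nm := (@Normc.normc R).
Local Notation cpoly := (map_poly (real_complex R)).
Implicit Types (a b : nat -> bool).

Definition spoly (M : nat) (a : nat -> bool) : {poly R} := \poly_(k < M) sgn R (a k).

Definition spt (M : nat) (a : nat -> bool) (z : R[i]) : R[i] := (cpoly (spoly M a)).[z].

Lemma normr_sgn (b : bool) : `|sgn R b| = 1.
Proof. by case: b; rewrite /sgn ?normrN normr1. Qed.

Lemma spoly_diff_le2 M a b k : `|(spoly M a - spoly M b)`_k| <= 2.
Proof.
rewrite coefB !coef_poly; case: ifP => _; last by rewrite subrr normr0.
by apply: le_trans (ler_normB _ _) _; rewrite !normr_sgn.
Qed.

(** For words that first disagree at [n]: the difference of their polynomials divided by X^n. *)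
Definition spdiff M a b n : {poly R} := drop_poly n (spoly M a - spoly M b).

Lemma spt_diff M a b n z : (forall k, (k < n)%N -> a k = b k) ->
  spt M a z - spt M b z = z ^+ n * (cpoly (spdiff M a b n)).[z].
Proof.
move=> h.
have -> : spt M a z - spt M b z = (cpoly (spoly M a - spoly M b)).[z].
  by rewrite rmorphB /= hornerD hornerN.
rewrite -{1}(poly_take_drop n (spoly M a - spoly M b)).
have -> : take_poly n (spoly M a - spoly M b) = 0.
  apply/polyP => k; rewrite coef_take_poly coef0; case: ifP => // kn.
  by rewrite coefB !coef_poly h // subrr.
by rewrite add0r rmorphM /= map_polyXn !hornerE mulrC.
Qed.

Lemma spdiff_le2 M a b n k : `|(spdiff M a b n)`_k| <= 2.
Proof. by rewrite coef_drop_poly spoly_diff_le2. Qed.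

Lemma spdiff_0 M a b n : (n < M)%N -> a n != b n -> `|(spdiff M a b n)`_0| = 2.
Proof.
move=> nM ab; rewrite coef_drop_poly add0n coefB !coef_poly nM.
move: ab; case: (a n); case: (b n) => // _; rewrite /sgn.
  by rewrite opprK -[1 + 1]/(2%:R) ger0_norm.
by rewrite -opprD normrN ger0_norm.
Qed.

Lemma spdiff_transversal (B eta : R) : 0 < eta -> 0 <= B -> 5 * B ^+ 8 < 256/625 ->
  exists2 dl : R, 0 < dl &
  forall M a b n (z : R[i]), (n < M)%N -> a n != b n ->
    nm z <= B -> eta <= `|Im z| ->
    nm (cpoly (spdiff M a b n)).[z] < dl -> dl <= nm (cpoly (spdiff M a b n)^`()).[z].
Proof.
move=> eta0 B0 B8; have [d d0 H] := transversality eta0 B0 B8.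
(* Differences of signs lie in {-2, 0, 2}; halving them gives the normalisation that
   [transversality] asks for. *)
exists (2 * d); first by rewrite mulr_gt0.
move=> M a b n z nM ab zB ze.
set G := spdiff M a b n.
have := H (2^-1 *: G) z.
have c2 : nm ((2^-1 : R)%:C)%C = 2^-1 by rewrite nm_real ger0_norm // invr_ge0.
rewrite derivZ !map_polyZ !hornerZ !nmM c2.
have g1 k : `|(2^-1 *: G)`_k| <= 1.
  rewrite coefZ normrM ger0_norm ?invr_ge0 // mulrC ler_pdivrMr // mul1r.
  exact: spdiff_le2.
have g0 : `|(2^-1 *: G)`_0| = 1.
  by rewrite coefZ normrM ger0_norm ?invr_ge0 // spdiff_0 // mulVf.
move=> /(_ g1 g0 zB ze) HH; move: HH; set X := nm _; set Y := nm _ => HH hX.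
suff : d <= 2^-1 * Y by lra.
by apply: HH; lra.
Qed.

Lemma card_same_prefix (M n : nat) (a : M.-tuple bool) : (n <= M)%N ->
  (#|[pred b : M.-tuple bool | take n a == take n b]| <= 2 ^ (M - n))%N.
Proof.
move=> nM.
have -> : (2 ^ (M - n) = #|{: (M - n).-tuple bool}|)%N by rewrite card_tuple card_bool.
rewrite -(card_in_image (f := fun b : M.-tuple bool => [tuple of drop n b])); last first.
  move=> b c; rewrite !inE => /eqP h1 /eqP h2 /(congr1 val) /= h3.
  by apply: val_inj => /=; rewrite -(cat_take_drop n b) -(cat_take_drop n c) -h1 -h2 h3.
exact: max_card.
Qed.

End SignPolynomials.

Section Energy.
Variable R : realType.
Local Notation nm := (@Normc.normc R).
Local Notation cpoly := (map_poly (real_complex R)).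

Lemma dist_segment (b u v : R) : u <= b -> v <= b -> 0 <= u -> 0 <= v -> `|u - v| <= b.
Proof. by move=> *; rewrite ler_norml; apply/andP; split; lra. Qed.

Lemma tuple_diff (M : nat) (a b : M.-tuple bool) : a != b ->
  exists n, [/\ (n < M)%N, nth false a n != nth false b n &
    forall k, (k < n)%N -> nth false a k = nth false b k].
Proof.
move=> ab.
have ex : exists n, (n < M)%N && (nth false a n != nth false b n).
  case: (pickP [pred k : 'I_M | nth false a k != nth false b k]) => [k hk|h0].
    by exists k; rewrite ltn_ord.
  exfalso; move/eqP: ab; apply; apply: eq_from_tnth => k.
  by have /negbFE/eqP := h0 k; rewrite !(tnth_nth false).
case: (ex_minnP ex) => n /andP[nM nab] nmin; exists n; split=> // k kn.
apply/eqP; apply: contraTT kn => hk; rewrite -leqNgt; case: (ltnP k M) => kM.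
  by apply: nmin; rewrite kM.
by apply: leq_trans kM; exact: ltnW.
Qed.

(** * The bound for pairs disagreeing at n against their frequency *)

Section Weights.
Variables (rr s c A6 CK : R).
Hypotheses (rr0 : 0 < rr) (s0 : 0 < s) (s3 : s <= 3) (rs : 2^-1 = rr `^ s)
  (c0 : 0 < c) (c1 : c <= 1) (A60 : 0 <= A6).
Variables (rho kap : R) (K M : nat).
Hypotheses (rho0 : 0 < rho) (kap0 : 0 < kap) (KCK : K%:R * kap <= CK)
  (rM : rr ^+ M <= rho).

Let tau n := rho / rr ^+ n.
Let T0 := K%:R ^+ 2 * rho ^- 2.
Let T n := if n.+1%:R * tau n <= c then A6 * n.+1%:R * rho ^- 2 * tau n ^+ 3 * kap ^- 2 else T0.
Let X := rho `^ s * rho ^- 2 * kap ^- 2.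

Lemma half_pow n : 2 ^- n = (rr ^+ n) `^ s.
Proof. by rewrite -exprVn rs -[LHS]powR_mulrn ?powR_ge0 // powRAC powR_mulrn // ltW. Qed.

Let T0_le : T0 <= CK ^+ 2 * (rho ^- 2 * kap ^- 2).
Proof.
rewrite /T0; have -> : K%:R ^+ 2 * rho ^- 2 = (K%:R * kap) ^+ 2 * (rho ^- 2 * kap ^- 2).
  by field; rewrite !gt_eqF.
apply: ler_wpM2r; first by nneg.
by rewrite ler_pXn2r // nnegrE ?mulr_ge0 ?(ltW kap0) // (le_trans _ KCK) // mulr_ge0 ?(ltW kap0).
Qed.

Lemma weight_eq_bound : 2 ^- M * T0 <= CK ^+ 2 * X.
Proof.
apply: le_trans (_ : rho `^ s * (CK ^+ 2 * (rho ^- 2 * kap ^- 2)) <= _).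
  apply: ler_pM; [by nneg | by rewrite /T0; nneg | | exact: T0_le].
  rewrite half_pow ge0_ler_powR ?nnegrE ?(ltW s0) ?(ltW rho0) // exprn_ge0 //; exact: ltW.
by rewrite /X le_eqVlt; apply/orP; left; apply/eqP; ring.
Qed.

(** The frequency 2^-n times the s-th power of [tau n] is exactly rho^s. If (n + 1) tau <= c then
    tau <= 1 and tau^3 <= tau^s. Otherwise 1 <= M tau / c, and multiplying the trivial bound by the
    s-th power of this quantity costs only (M / c)^3. *)
Lemma weight_bound n : (n < M)%N ->
  2 ^- n * T n <= (A6 + CK ^+ 2 / c ^+ 3) * M%:R ^+ 3 * X.
Proof.
move=> nM.
have t0 : 0 < tau n by rewrite /tau divr_gt0 ?exprn_gt0.
have M1 : 1 <= (M%:R : R) by rewrite ler1n (leq_trans _ nM).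
have n1M : (n.+1%:R : R) <= M%:R by rewrite ler_nat.
have X0 : 0 <= X by rewrite /X; apply: mulr_ge0; [apply: mulr_ge0 | ]; rewrite ?powR_ge0; nneg.
have half : 2 ^- n * tau n `^ s = rho `^ s.
  rewrite half_pow -powRM ?exprn_ge0 ?(ltW rr0) ?(ltW t0) //.
  by rewrite /tau mulrC mulfVK // gt_eqF // exprn_gt0.
have M3 : (M%:R : R) <= M%:R ^+ 3 by rewrite -{1}(expr1 M%:R) ler_weXn2l.
rewrite /T; case: ifPn => [good|].
  have t1 : tau n <= 1.
    apply: le_trans c1; apply: le_trans good; rewrite ler_peMl ?(ltW t0) // ler1n //.
  have t3 : tau n ^+ 3 <= tau n `^ s.
    by rewrite -powR_mulrn ?(ltW t0) //; apply: ger_powR => //; rewrite t0.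
  apply: le_trans (_ : A6 * M%:R ^+ 3 * X <= _); last first.
    apply: ler_wpM2r => //; apply: ler_wpM2r; first by nneg.
    by rewrite lerDl; nneg.
  apply: le_trans (_ : 2 ^- n * (A6 * M%:R ^+ 3 * rho ^- 2 * tau n `^ s * kap ^- 2) <= _).
    apply: ler_wpM2l; first by nneg.
    apply: ler_wpM2r; first by nneg.
    apply: ler_pM => //; [by nneg | by nneg | ].
    apply: ler_wpM2r; first by nneg.
    by apply: ler_wpM2l => //; apply: le_trans M3.
  have -> : 2 ^- n * (A6 * M%:R ^+ 3 * rho ^- 2 * tau n `^ s * kap ^- 2) =
     (2 ^- n * tau n `^ s) * (A6 * M%:R ^+ 3 * rho ^- 2 * kap ^- 2) by ring.
  by rewrite half /X le_eqVlt; apply/orP; left; apply/eqP; ring.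
rewrite -ltNge => bad.
have y1 : 1 <= M%:R * tau n / c.
  rewrite ler_pdivlMr // mul1r; apply: le_trans (ltW bad) _.
  by rewrite ler_wpM2r ?(ltW t0).
have p1 : 1 <= (M%:R * tau n / c) `^ s.
  by rewrite -[leLHS](powRr0 (M%:R * tau n / c)); apply: ler_powR => //; exact: ltW.
have Mc1 : 1 <= M%:R / c by rewrite ler_pdivlMr // mul1r (le_trans c1).
have Mcs : (M%:R / c) `^ s <= (M%:R / c) ^+ 3.
  by rewrite -[leRHS]powR_mulrn ?(le_trans ler01) //; apply: ler_powR.
have h2n : 2 ^- n <= rho `^ s * (M%:R / c) ^+ 3.
  apply: le_trans (_ : 2 ^- n * (M%:R * tau n / c) `^ s <= _).
    by rewrite ler_peMr //; nneg.
  rewrite mulrAC powRM ?(ltW t0) //; last exact: le_trans ler01 Mc1.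
  rewrite (mulrC (_ `^ s)) mulrA half ler_wpM2l ?powR_ge0 //.
apply: le_trans (_ : rho `^ s * (M%:R / c) ^+ 3 * (CK ^+ 2 * (rho ^- 2 * kap ^- 2)) <= _).
  by apply: ler_pM => //; rewrite /T0; nneg.
apply: le_trans (_ : CK ^+ 2 / c ^+ 3 * M%:R ^+ 3 * X <= _).
  by rewrite /X le_eqVlt; apply/orP; left; apply/eqP; field; rewrite !gt_eqF.
apply: ler_wpM2r => //; apply: ler_wpM2r; first by nneg.
by rewrite lerDr.
Qed.

End Weights.

Definition xt (M : nat) (a : M.-tuple bool) : R[i] -> R[i] := spt M (nth false a).

(* A pair of sign words first disagreeing at [n] has relative frequency
   [2 ^- n = (rr ^+ n) `^ s], and since the weights [om] sum to zero its lattice sum is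
   of third order in [rho / rr ^+ n] by [pair_shift_uniform] (trivially bounded when this
   ratio is not small); [s <= 3] makes every [n] contribute at most [rho `^ s]. *)
Lemma energy_bound (rr q eta : R) : 0 < rr -> rr < 1 -> 0 <= q < 1 -> 5 * q ^+ 8 < 256/625 ->
  0 < eta ->
  exists2 dm : R, 0 < dm & forall (C1 Lc mu CK s : R),
  1 <= C1 -> 0 <= Lc -> 0 < mu -> 0 <= CK -> 0 < s -> s <= 3 -> 2^-1 = rr `^ s ->
  exists2 Cst : R, 0 <= Cst &
  forall (rho kap : R) (K M : nat) (z0 : R[i]) (D : R[i] -> Prop) (chi : R[i] -> R)
    (I : finType) (om : I -> R) (ep : M.-tuple bool -> I -> R[i] -> R[i]),
  0 < rho -> rho <= 1 -> 0 < kap -> kap <= C1 * rho ^+ 2 -> K%:R * kap <= CK ->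
  rr ^+ M <= rho ->
  (forall z, D z -> [/\ rr <= nm z, nm z <= q & eta <= `|Im z|]) ->
  (forall z w, D z -> D w -> nm (w - z) <= dm) ->
  (forall a p z, D z -> nm (ep a p z) <= C1 / 2 * rho) ->
  (forall a p z w, D z -> D w -> nm (ep a p w - ep a p z) <= C1 / 2 * rho * nm (w - z)) ->
  (forall z, 0 <= chi z <= 1) ->
  (forall z w, `|chi z - chi w| <= Lc * nm (z - w)) ->
  (forall z w, chi z != 0 -> nm w <= mu -> D (z + w)) ->
  (forall (i j v : int), chi (lpt z0 kap i j) != 0 -> `|kap * v%:~R| <= mu ->
     (0 <= i + v < K%:Z)%R /\ (0 <= j + v < K%:Z)%R) ->
  \sum_p om p = 0 ->
  \sum_(i < K) \sum_(j < K) chi (lpt z0 kap i j) * (4 ^- M *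
     \sum_(a : M.-tuple bool) \sum_(b : M.-tuple bool) \sum_p \sum_p' om p * om p' *
       ker rho (xt a (lpt z0 kap i j) + ep a p (lpt z0 kap i j)
                - (xt b (lpt z0 kap i j) + ep b p' (lpt z0 kap i j))))
  <= Cst * (\sum_p `|om p|) ^+ 2 * M.+1%:R ^+ 4 * (rho `^ s * rho ^- 2 * kap ^- 2).
Proof.
move=> rr0 rr1 q01 q8 eta0; have [q0 q1] := andP q01.
have [dl dl0 trans] := spdiff_transversal eta0 q0 q8.
have q1' : 0 < 1 - q by rewrite subr_gt0.
pose B1 := 2 / (1 - q) ^+ 2; pose B := 2 * B1 / (1 - q).
have B1_0 : 0 < B1 by rewrite divr_gt0 // exprn_gt0.
have B_0 : 0 < B by rewrite divr_gt0 // mulr_gt0.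
have B1B' : B1 / (1 - q) <= B.
  by apply: ler_wpM2r; [rewrite invr_ge0 ltW | lra].
have B1B : B1 <= B.
  by apply: le_trans B1B'; rewrite ler_pdivlMr // ler_piMr //; [exact: ltW | lra].
(* On domains of this diameter the quadratic Taylor term takes at most half of the linear one. *)
exists (dl / (2 * B)); first by rewrite divr_gt0 // mulr_gt0.
move=> C1 Lc mu CK s C11 Lc0 mu0 CK0 s0 s3 rs.
have [c [A6 [c0 c1 A60 Hpair]]] := pair_shift_uniform rr0 (ltW B_0) dl0 C11 Lc0 mu0.
exists (A6 + CK ^+ 2 / c ^+ 3 + CK ^+ 2); first by nneg.
move=> rho kap K M z0 D chi I om ep rho0 rho1 kap0 kapC KCK rM Dz Ddiam ep_le ep_lip chi01
  chi_lip chiD chiK om0.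
pose P (i j : 'I_K) := lpt z0 kap i j.
pose T0 := K%:R ^+ 2 * rho ^- 2.
pose T n := if n.+1%:R * (rho / rr ^+ n) <= c
  then A6 * n.+1%:R * rho ^- 2 * (rho / rr ^+ n) ^+ 3 * kap ^- 2 else T0.
pose X := rho `^ s * rho ^- 2 * kap ^- 2.
have X0 : 0 <= X by rewrite /X; apply: mulr_ge0; [apply: mulr_ge0 | ]; rewrite ?powR_ge0; nneg.
have T0_0 : 0 <= T0 by rewrite /T0; nneg.
have T_0 n : 0 <= T n by rewrite /T; case: ifP => // _; nneg.
(* Adding [T n] for every common prefix, not only at the first disagreement, overcounts harmlessly
   and reduces the sum over pairs to prefix counts. *)
pose W (a b : M.-tuple bool) := \sum_(n < M) (take n a == take n b)%:R * T n + (a == b)%:R * T0.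
pose S a b p p' := \sum_(i < K) \sum_(j < K) chi (P i j) *
   (ker rho (xt a (P i j) + ep a p (P i j) - (xt b (P i j) + ep b p' (P i j)))
    - ker rho (xt a (P i j) - xt b (P i j))).
have CE : C1 * rho = C1 / 2 * rho + C1 / 2 * rho by field.
have S_triv a b p p' : `|S a b p p'| <= T0.
  apply: le_trans (ler_norm_sum _ _ _) _.
  apply: le_trans (_ : \sum_(i < K) \sum_(j < K) rho ^- 2 <= _); last first.
    by rewrite !sumr_const card_ord -mulrnA /T0 -[rho ^- 2 *+ _]mulr_natl natrM expr2.
  apply: ler_sum => i _; apply: le_trans (ler_norm_sum _ _ _) _; apply: ler_sum => j _.
  have /andP[h0 h1] := chi01 (P i j).
  rewrite normrM -[leRHS]mul1r; apply: ler_pM => //; first by rewrite ger0_norm.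
  have k1 := ker_le rho (xt a (P i j) + ep a p (P i j) - (xt b (P i j) + ep b p' (P i j))).
  have k2 := ker_le rho (xt a (P i j) - xt b (P i j)).
  have k3 := ker_ge0 rho (xt a (P i j) + ep a p (P i j) - (xt b (P i j) + ep b p' (P i j))).
  have k4 := ker_ge0 rho (xt a (P i j) - xt b (P i j)).
  exact: dist_segment.
have S_W a b p p' : `|S a b p p'| <= W a b.
  have [->|ab] := eqVneq a b.
    apply: le_trans (S_triv _ _ _ _) _; rewrite /W eqxx mul1r lerDr.
    by apply: sumr_ge0 => n _; rewrite mulr_ge0.
  have [n [nM nab pre]] := tuple_diff ab.
  apply: le_trans (_ : T n <= _); last first.
    rewrite /W (bigD1 (Ordinal nM)) //=.
    have -> : take n a == take n b.
      apply/eqP; apply: (@eq_from_nth _ false).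
        by rewrite !size_take !size_tuple.
      move=> k; rewrite size_take size_tuple nM => kn.
      by rewrite !nth_take // pre.
    rewrite mul1r -addrA lerDl; apply: addr_ge0; last exact: mulr_ge0.
    by apply: sumr_ge0 => k _; exact: mulr_ge0.
  rewrite /T; case: (boolP (n.+1%:R * (rho / rr ^+ n) <= c)) => [hn|_]; last exact: S_triv.
  set G := spdiff R M (nth false a) (nth false b) n.
  have G2 : forall k, `|G`_k| <= 2 := spdiff_le2 R M (nth false a) (nth false b) n.
  have E z : xt a z - xt b z = z ^+ n * (cpoly G).[z] := spt_diff M z pre.
  have -> : S a b p p' = \sum_(i < K) \sum_(j < K) chi (P i j) *
    (ker rho (P i j ^+ n * (cpoly G).[P i j] + (ep a p (P i j) - ep b p' (P i j)))
    - ker rho (P i j ^+ n * (cpoly G).[P i j])).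
    apply: eq_bigr => i _; apply: eq_bigr => j _.
    congr (_ * (ker rho _ - ker rho _)); last exact: E.
    by rewrite -(E (P i j)); ring.
  have qz z : D z -> nm z <= q by move=> /Dz[].
  apply: (Hpair rho kap K n z0 D (fun z => (cpoly G).[z]) (fun z => (cpoly G^`()).[z])
    (fun z => ep a p z - ep b p' z) chi) => //.
  - by move=> z /Dz[].
  - by move=> z /qz h; apply: le_trans h _; exact: ltW.
  - move=> z w hz hw; apply: le_trans (ler_wpM2l (ltW B_0) (Ddiam _ _ hz hw)) _.
    by rewrite le_eqVlt; apply/orP; left; apply/eqP; field; rewrite !gt_eqF.
  - move=> z w hz hw; apply: le_trans (cpoly_taylor q01 G2 (qz _ hz) (qz _ hw)) _.
    by apply: ler_wpM2r => //; nneg.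
  - move=> z w hz hw; apply: le_trans (cpoly_lip q01 G2 (qz _ hz) (qz _ hw)) _.
    by apply: ler_wpM2r => //; nneg.
  - by move=> z w hz hw; exact: (cpoly_deriv_lip q01 G2 (qz _ hz) (qz _ hw)).
  - by move=> z hz; apply: le_trans (cpoly_deriv_bound q01 G2 (qz _ hz)) _.
  - move=> z hz; have [_ h1 h2] := Dz _ hz; exact: trans.
  - move=> z hz; apply: le_trans (nmB _ _) _.
    by rewrite CE; exact: lerD (ep_le _ _ _ hz) (ep_le _ _ _ hz).
  - move=> z w hz hw.
    have -> : ep a p w - ep b p' w - (ep a p z - ep b p' z) =
       (ep a p w - ep a p z) - (ep b p' w - ep b p' z) by ring.
    apply: le_trans (nmB _ _) _.
    by rewrite CE mulrDl; exact: lerD (ep_lip _ _ _ _ hz hw) (ep_lip _ _ _ _ hz hw).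
have -> : \sum_(i < K) \sum_(j < K) chi (lpt z0 kap i j) * (4 ^- M *
     \sum_(a : M.-tuple bool) \sum_(b : M.-tuple bool) \sum_p \sum_p' om p * om p' *
       ker rho (xt a (lpt z0 kap i j) + ep a p (lpt z0 kap i j)
                - (xt b (lpt z0 kap i j) + ep b p' (lpt z0 kap i j)))) =
   4 ^- M * \sum_(a : M.-tuple bool) \sum_(b : M.-tuple bool) \sum_p \sum_p' om p * om p' * S a b p p'.
  transitivity (\sum_(i < K) \sum_(j < K) 4 ^- M *
     \sum_(a : M.-tuple bool) \sum_(b : M.-tuple bool) \sum_p \sum_p' om p * om p' * (chi (P i j) *
   (ker rho (xt a (P i j) + ep a p (P i j) - (xt b (P i j) + ep b p' (P i j)))
    - ker rho (xt a (P i j) - xt b (P i j))))).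
    apply: eq_bigr => i _; apply: eq_bigr => j _; rewrite mulrCA; congr (_ * _).
    rewrite mulr_sumr; apply: eq_bigr => a _; rewrite mulr_sumr; apply: eq_bigr => b _.
    (* As the weights [om] sum to zero, the unperturbed kernel, which depends neither on [p] nor on
       [p'], can be subtracted from every term. This creates the differences that cancel under
       translation. *)
    transitivity (chi (P i j) * ((\sum_p \sum_p' om p * om p' *
       ker rho (xt a (P i j) + ep a p (P i j) - (xt b (P i j) + ep b p' (P i j))))
       - (\sum_p om p) * (\sum_p' om p') * ker rho (xt a (P i j) - xt b (P i j)))).
      by rewrite om0 mul0r mul0r subr0.
    rewrite big_distrlr /= mulr_suml -sumrB mulr_sumr; apply: eq_bigr => p _.
    rewrite mulr_suml -sumrB mulr_sumr; apply: eq_bigr => p' _; ring.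
  under eq_bigr do rewrite -mulr_sumr.
  rewrite -mulr_sumr; congr (_ * _).
  under eq_bigr do rewrite exchange_big /=.
  rewrite exchange_big /=; apply: eq_bigr => a _.
  under eq_bigr do rewrite exchange_big /=.
  rewrite exchange_big /=; apply: eq_bigr => b _.
  under eq_bigr do rewrite exchange_big /=.
  rewrite exchange_big /=; apply: eq_bigr => p _.
  under eq_bigr do rewrite exchange_big /=.
  rewrite exchange_big /=; apply: eq_bigr => p' _.
  by rewrite mulr_sumr; apply: eq_bigr => i _; rewrite mulr_sumr.
apply: le_trans (ler_norm _) _; rewrite normrM ger0_norm; last by nneg.
pose Om := \sum_p `|om p|.
have Om0 : 0 <= Om by apply: sumr_ge0.
apply: le_trans (_ : 4 ^- M * (Om ^+ 2 * \sum_(a : M.-tuple bool) \sum_(b : M.-tuple bool) W a b) <= _).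
  apply: ler_wpM2l; first by nneg.
  rewrite mulr_sumr; apply: le_trans (ler_norm_sum _ _ _) _; apply: ler_sum => a _.
  rewrite mulr_sumr; apply: le_trans (ler_norm_sum _ _ _) _; apply: ler_sum => b _.
  rewrite expr2 {1}/Om mulr_suml mulr_suml.
  apply: le_trans (ler_norm_sum _ _ _) _; apply: ler_sum => p _.
  rewrite mulr_sumr mulr_suml.
  apply: le_trans (ler_norm_sum _ _ _) _; apply: ler_sum => p' _.
  by rewrite !normrM; apply: ler_wpM2l; [exact: mulr_ge0|exact: S_W].
rewrite mulrCA -/Om -/X.
have -> : (A6 + CK ^+ 2 / c ^+ 3 + CK ^+ 2) * Om ^+ 2 * M.+1%:R ^+ 4 * X =
  Om ^+ 2 * ((A6 + CK ^+ 2 / c ^+ 3 + CK ^+ 2) * M.+1%:R ^+ 4 * X) by ring.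
apply: ler_wpM2l; first by nneg.
have Wsum : \sum_(a : M.-tuple bool) \sum_(b : M.-tuple bool) W a b <=
   \sum_(n < M) 4 ^+ M * (2 ^- n * T n) + 4 ^+ M * (2 ^- M * T0).
  have pre (a : M.-tuple bool) n : (n <= M)%N ->
     \sum_(b : M.-tuple bool) (take n a == take n b)%:R <= 2 ^+ M * 2 ^- n :> R.
    move=> nM.
    have -> : \sum_(b : M.-tuple bool) (take n a == take n b)%:R =
       (#|[pred b : M.-tuple bool | take n a == take n b]|)%:R :> R.
      rewrite -sum1_card natr_sum [RHS]big_mkcond /=; apply: eq_bigr => b _.
      by rewrite inE; case: (_ == _).
    apply: le_trans (_ : (2 ^ (M - n))%:R <= _); first by rewrite ler_nat card_same_prefix.
    by rewrite natrX -{2}(subnK nM) exprD mulfK // expf_neq0.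
  have c2 : (4 : R) ^+ M = 2 ^+ M * 2 ^+ M by rewrite -exprMn; congr (_ ^+ _); ring.
  apply: le_trans (_ : \sum_(a : M.-tuple bool) (\sum_(n < M) (2 ^+ M * (2 ^- n * T n))
       + 2 ^+ M * (2 ^- M * T0)) <= _).
    apply: ler_sum => a _; rewrite big_split /= exchange_big /=; apply: lerD.
      apply: ler_sum => n _; rewrite -mulr_suml mulrA; apply: ler_wpM2r => //.
      by apply: pre; exact: ltnW.
    rewrite -mulr_suml mulrA; apply: ler_wpM2r => //; apply: le_trans (pre a M (leqnn _)).
    by apply: ler_sum => b _; rewrite !take_oversize ?size_tuple.
  rewrite sumr_const card_tuple card_bool -[leLHS]mulr_natl natrX mulrDr mulr_sumr.
  rewrite c2 le_eqVlt; apply/orP; left; apply/eqP; congr (_ + _); last by ring.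
  by apply: eq_bigr => n _; ring.
apply: le_trans (ler_wpM2l _ Wsum) _; first by nneg.
rewrite -mulr_sumr -mulrDr mulrA mulVf ?mul1r; last by rewrite expf_neq0.
have M1 : (1 : R) <= M.+1%:R by rewrite ler1n.
have M14 : 1 <= (M.+1%:R : R) ^+ 4 by rewrite exprn_ege1.
have HT : \sum_(n < M) 2 ^- n * T n <= (A6 + CK ^+ 2 / c ^+ 3) * M.+1%:R ^+ 4 * X.
  apply: le_trans (_ : \sum_(n < M) (A6 + CK ^+ 2 / c ^+ 3) * M%:R ^+ 3 * X <= _).
    by apply: ler_sum => n _; exact: (weight_bound rr0 s0 s3 rs c0 c1 A60 rho0 kap0 KCK).
  rewrite sumr_const card_ord -[leLHS]mulr_natl mulrA; apply: ler_wpM2r => //.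
  rewrite mulrCA; apply: ler_wpM2l; first by nneg.
  by rewrite -exprS lerXn2r // ?nnegrE // ler_nat.
have HT0 : 2 ^- M * T0 <= CK ^+ 2 * M.+1%:R ^+ 4 * X.
  apply: le_trans (weight_eq_bound rr0 s0 rs rho0 kap0 KCK rM) _; apply: ler_wpM2r => //.
  by rewrite ler_peMr //; nneg.
apply: le_trans (lerD HT HT0) _.
by rewrite le_eqVlt; apply/orP; left; apply/eqP; rewrite /X; ring.
Qed.

End Energy.

(** * Square indicators and a criterion for an L2 density *)

HB.instance Definition _ (R : realType) :=
  Measure.copy (@leb2 R) (@lebesgue_measure R \x @lebesgue_measure R)%E.

Section SquareIndicators.
Variable R : realType.

Lemma integrable_lin_indic d (T : measurableType d) (mu : {measure set T -> \bar R})
    (c : R) (A : set T) : measurable A -> (mu A < +oo)%E ->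
  mu.-integrable setT (fun x => (c * \1_A x)%:E).
Proof.
move=> mA fA; under eq_fun do rewrite EFinM; apply: integrableZl => //.
apply/integrableP; split; first by apply/measurable_EFinP; exact: measurable_indic.
under eq_integral do rewrite gee0_abs ?lee_fin //.
by rewrite integral_indic // setIT.
Qed.

Lemma integral_lin_indic d (T : measurableType d) (mu : {measure set T -> \bar R})
    (I : finType) (c : I -> R) (A : I -> set T) :
  (forall i, measurable (A i)) -> (forall i, mu (A i) < +oo)%E ->
  (\int[mu]_x (\sum_i c i * \1_(A i) x)%:E = (\sum_i c i * fine (mu (A i)))%:E)%E.
Proof.
move=> mA fA; under eq_integral do rewrite -sumEFin.
rewrite integral_sum //; last by move=> i; exact: integrable_lin_indic.
rewrite -sumEFin; apply: eq_bigr => i _.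
under eq_integral do rewrite EFinM.
rewrite integralZl //; last first.
  have := integrable_lin_indic 1 (mA i) (fA i); under eq_fun do rewrite mul1r; exact.
rewrite integral_indic // setIT EFinM fineK // ge0_fin_numE //.
Qed.

Definition sq (rho : R) (p : R[i]) : set (R * R) :=
  `[Re p, Re p + rho[ `*` `[Im p, Im p + rho[.

Lemma measurable_sq rho p : measurable (sq rho p).
Proof. by apply: measurableX; exact: measurable_itv. Qed.

Lemma itvI_co (a b a' b' : R) :
  `[a, b[ `&` `[a', b'[ = `[Num.max a a', Num.min b b'[%classic.
Proof.
apply/seteqP; split => x /=; rewrite !in_itv /= ?ge_max ?lt_min.
  by case=> /andP[-> ->] /andP[-> ->].
by move=> /andP[/andP[-> ->] /andP[-> ->]].
Qed.

Lemma lebesgue_coI (a a' rho : R) : 0 < rho ->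
  lebesgue_measure (`[a, a + rho[ `&` `[a', a' + rho[) = (rho * tent ((a - a') / rho))%:E.
Proof.
move=> r0; rewrite itvI_co lebesgue_measure_itv /= lte_fin.
have -> : rho * tent ((a - a') / rho) = Num.max 0 (rho - `|a - a'|).
  rewrite /tent maxr_pMr ?(ltW r0) // mulr0 mulrBr mulr1 normrM (gtr0_norm (_ : 0 < rho^-1)) ?invr_gt0 //.
  by rewrite mulrCA divff ?mulr1 // gt_eqF.
have E : Num.min (a + rho) (a' + rho) - Num.max a a' = rho - `|a - a'|.
  case: (leP a a') => h; [have h' : a - a' <= 0 by lra | have h' : 0 <= a - a' by lra].
    rewrite (ler0_norm h') minEle lerD2r h; lra.
  rewrite (ger0_norm h') minElt ltrD2r ltNge (ltW h) /=; lra.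
case: ifPn => h.
  rewrite -EFinD; congr EFin; rewrite E.
  by rewrite (max_idPr _) // -E subr_ge0 ltW.
by rewrite (max_idPl _) // -E subr_le0 leNgt.
Qed.

Lemma leb2_sqI (rho : R) (p p' : R[i]) : 0 < rho ->
  leb2 (sq rho p `&` sq rho p') = (rho ^+ 4 * ker rho (p - p'))%:E.
Proof.
move=> r0; rewrite /sq -setXI /leb2 product_measure1E; try (apply: measurableI; exact: measurable_itv).
rewrite [X in (X * _)%E]lebesgue_coI // [X in (_ * X)%E]lebesgue_coI //.
rewrite -EFinM; congr EFin; rewrite /ker.
have -> : Re (p - p') = Re p - Re p' by case: p => ? ?; case: p' => ? ?.
have -> : Im (p - p') = Im p - Im p' by case: p => ? ?; case: p' => ? ?.
by field; rewrite gt_eqF.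
Qed.

Definition phi (rho : R) (p : R[i]) (u : R * R) : R := rho ^- 2 * \1_(sq rho p) u.

Lemma phi_ge0 rho p u : 0 <= phi rho p u.
Proof. by rewrite mulr_ge0 // ?invr_ge0 ?sqr_ge0. Qed.

Lemma measurable_phi rho p : measurable_fun setT (phi rho p).
Proof. by apply: measurable_funM => //; exact: measurable_indic (measurable_sq _ _). Qed.

Lemma integral_sqr_phi (rho : R) (I : finType) (c : I -> R) (p : I -> R[i]) : 0 < rho ->
  (\int[@leb2 R]_u ((\sum_i c i * phi rho (p i) u) ^+ 2)%:E =
   (\sum_i \sum_j c i * c j * ker rho (p i - p j))%:E)%E.
Proof.
move=> r0.
have E u : (\sum_i c i * phi rho (p i) u) ^+ 2 =
   \sum_(ij : I * I) (c ij.1 * c ij.2 * rho ^- 4) * \1_(sq rho (p ij.1) `&` sq rho (p ij.2)) u.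
  rewrite expr2 big_distrlr /= pair_bigA /=; apply: eq_bigr => -[i j] _ /=.
  by rewrite indicI /phi /=; field; rewrite gt_eqF.
under eq_integral do rewrite E.
rewrite integral_lin_indic; last 2 first.
- by move=> i; apply: measurableI; exact: measurable_sq.
- by move=> i; rewrite [X in (X < _)%E]leb2_sqI // ltry.
congr EFin; rewrite pair_bigA /=; apply: eq_bigr => -[i j] _ /=.
by rewrite leb2_sqI //=; field; rewrite gt_eqF.
Qed.

End SquareIndicators.

Section FastConvergence.
Variable R : realType.

Lemma fast_cvg (F : nat -> R) (s ze : R) : 0 < ze < 1 -> 0 <= s ->
  (forall j, `|F j.+1 - F j| <= s * ze ^+ j) ->
  cvgn F /\ forall j, `|F j| <= `|F 0%N| + s / (1 - ze).
Proof.
move=> /andP[z0 z1] s0 H.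
have nz : `|ze| < 1 by rewrite gtr0_norm.
pose d := telescope F.
have FE n : F n = F 0%N + series d n by exact: eq_sum_telescope.
split.
  have cd : cvgn (series d).
    apply: normed_cvg; apply: (series_le_cvg (v_ := geometric s ze)) => //=.
    - by move=> n; rewrite /geometric /= mulr_ge0 // exprn_ge0 // ltW.
    - exact: is_cvg_geometric_series.
  rewrite (_ : F = (fun n => F 0%N + series d n)); last exact/funext.
  by apply: is_cvgD => //; exact: is_cvg_cst.
move=> j; rewrite FE; apply: le_trans (ler_normD _ _) _; rewrite lerD2l.
apply: le_trans (geometric_le_lim j s0 z0 nz).
rewrite /series /=; apply: le_trans (ler_norm_sum _ _ _) _.
by apply: ler_sum => i _; exact: H.
Qed.

End FastConvergence.

Section DensityMeasure.
Local Open Scope ereal_scope.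
Context d (T : measurableType d) (R : realType) (mu : {measure set T -> \bar R}).
Variable f : T -> R.
Hypotheses (mf : measurable_fun setT f) (f0 : forall x, (0 <= f x)%R).

Definition dens (A : set T) : \bar R := \int[mu]_(x in A) (f x)%:E.

Let dens0 : dens set0 = 0. Proof. exact: integral_set0. Qed.
Let dens_ge0 A : 0 <= dens A.
Proof. by apply: integral_ge0 => x _; rewrite lee_fin. Qed.
Let dens_sigma_additive : semi_sigma_additive dens.
Proof.
move=> F mF tF mUF; rewrite /dens ge0_integral_bigcup //.
- by apply: is_cvg_ereal_nneg_natsum_cond => n _ _; exact: dens_ge0.
- by apply: measurable_funTS; exact/measurable_EFinP.
- by move=> x _; rewrite lee_fin.
Qed.
HB.instance Definition _ := isMeasure.Build _ _ _ dens dens0 dens_ge0 dens_sigma_additive.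
Definition dens_measure : {measure set T -> \bar R} := dens.

End DensityMeasure.

(** * Comparing measures on quadrants *)

Section Quadrants.
Variable R : realType.
Local Notation RR := (measurableTypeR R * measurableTypeR R)%type.
Implicit Types (mu nu : {measure set RR -> \bar R}).

Definition quad (x y : R) : set (R * R) := `]-oo, x[ `*` `]-oo, y[.

Lemma measurable_quad x y : measurable (quad x y : set RR).
Proof. by apply: measurableX; exact: measurable_itv. Qed.

Definition quads : set (set (R * R)) := [set A | exists x y, A = quad x y].

Lemma quad_bigcup (x y : R) : quad x y = \bigcup_n quad (x - n.+1%:R^-1) (y - n.+1%:R^-1).
Proof.
apply/seteqP; split => [[u v]|[u v] [n _]]; rewrite /quad /= !in_itv /=; last first.
  have : (0 < n.+1%:R^-1 :> R) by rewrite invr_gt0.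
  move=> e0 [h1 h2]; split; [apply: lt_trans h1 _ | apply: lt_trans h2 _];
    by rewrite ltrBlDr ltrDl.
move=> [ux vy].
pose e := Num.min (x - u) (y - v).
have e0 : 0 < e by rewrite lt_min !subr_gt0 ux.
have [n _ hn] := near_infty_natSinv_lt (PosNum e0).
exists n => //; have := hn n (leqnn n); rewrite /= lt_min => /andP[h1 h2].
by rewrite /= !in_itv /=; split; rewrite ltrBrDr addrC -ltrBrDr.
Qed.

Lemma measurable_quads : @measurable _ RR = <<s quads >>.
Proof.
apply/seteqP; split; last first.
  apply: smallest_sub; first exact: sigma_algebra_measurable.
  by move=> _ [x [y ->]]; exact: measurable_quad.
pose T := g_sigma_algebraType quads.
have half1 (x : R) : (<<s quads >>) (`]-oo, x[ `*` setT).
  rewrite (_ : _ `*` _ = \bigcup_n quad x n%:R).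
    apply: (@bigcupT_measurable _ T) => n; apply: sub_sigma_algebra; by exists x, n%:R.
  apply/seteqP; split => [[u v] [ux _]|[u v] [n _ [ux _]]] //.
  exists (Num.truncn v).+1 => //; split => //=; rewrite in_itv /=; exact: truncnS_gt.
have half2 (y : R) : (<<s quads >>) (setT `*` `]-oo, y[).
  rewrite (_ : _ `*` _ = \bigcup_n quad n%:R y).
    apply: (@bigcupT_measurable _ T) => n; apply: sub_sigma_algebra; by exists n%:R, y.
  apply/seteqP; split => [[u v] [_ vy]|[u v] [n _ [_ vy]]] //.
  exists (Num.truncn u).+1 => //; split => //=; rewrite in_itv /=; exact: truncnS_gt.
have m1 : measurable_fun setT (fst : T -> measurableTypeR R).
  apply: (measurability _ (RGenInftyO.measurableE R)).
  move=> _ [_ [x ->] <-]; rewrite setTI.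
  rewrite (_ : _ @^-1` _ = `]-oo, x[ `*` setT) //; first exact: half1.
  by apply/seteqP; split => [[u v] //=|[u v] [? ?]].
have m2 : measurable_fun setT (snd : T -> measurableTypeR R).
  apply: (measurability _ (RGenInftyO.measurableE R)).
  move=> _ [_ [x ->] <-]; rewrite setTI.
  rewrite (_ : _ @^-1` _ = setT `*` `]-oo, x[) //; first exact: half2.
  by apply/seteqP; split => [[u v] //=|[u v] [? ?]].
move=> A mA.
have := measurable_fun_pair m1 m2 measurableT mA.
rewrite setTI (_ : _ @^-1` A = A) //.
by apply/seteqP; split => [[u v]|[u v]].
Qed.

Lemma quad_cvg mu x y :
  mu (quad (x - n.+1%:R^-1) (y - n.+1%:R^-1)) @[n --> \oo] --> mu (quad x y).
Proof.
pose F n := quad (x - n.+1%:R^-1) (y - n.+1%:R^-1).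
have -> : quad x y = \bigcup_n F n by exact: quad_bigcup.
apply: (@nondecreasing_cvg_mu _ _ _ mu F).
- by move=> n; exact: measurable_quad.
- by apply: bigcupT_measurable => n; exact: measurable_quad.
- move=> m n mn; apply/subsetPset => -[u v]; rewrite /F /quad /= !in_itv /=.
  have : (n.+1%:R^-1 <= m.+1%:R^-1 :> R) by rewrite lef_pV2 ?posrE // ler_nat.
  move=> ? [h1 h2]; split; [apply: lt_le_trans h1 _ | apply: lt_le_trans h2 _];
    by rewrite lerB.
Qed.

(** An open quadrant is the increasing union of quadrants with smaller corners, so both comparisons
    survive the limit e -> 0 with no condition on boundary mass; quadrants form a generating
    pi-system. *)
Lemma measure_eq_quad mu nu : (mu setT < +oo)%E ->
  (forall x y e, 0 < e -> (mu (quad (x - e) (y - e)) <= nu (quad x y))%E) ->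
  (forall x y e, 0 < e -> (nu (quad (x - e) (y - e)) <= mu (quad x y))%E) ->
  forall A : set RR, measurable A -> mu A = nu A.
Proof.
move=> muoo h1 h2.
have H (m1 m2 : {measure set RR -> \bar R}) : (forall x y e, 0 < e -> (m1 (quad (x - e) (y - e)) <= m2 (quad x y))%E) ->
    forall x y, (m1 (quad x y) <= m2 (quad x y))%E.
  move=> h x y; have c := @quad_cvg m1 x y.
  rewrite -(cvg_lim _ c) //; apply: lime_le; first by apply/cvg_ex; eexists; exact: c.
  by apply: nearW => n; apply: h; rewrite invr_gt0.
apply: (@measure_unique _ R RR quads (fun n => quad n%:R n%:R)).
- exact: measurable_quads.
- move=> _ _ [x [y ->]] [x' [y' ->]]; exists (Num.min x x'), (Num.min y y').
  apply/seteqP; split => -[u v]; rewrite /quad /= !in_itv /= !lt_min.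
    by move=> [[-> ->] [-> ->]].
  by move=> [/andP[-> ->] /andP[-> ->]].
- by move=> i; exists i%:R, i%:R.
- rewrite -subTset => -[u v] _.
  exists (maxn (Num.truncn u).+1 (Num.truncn v).+1) => //.
  rewrite /quad /= !in_itv /=; split.
    by apply: lt_le_trans (truncnS_gt u) _; rewrite ler_nat leq_maxl.
  by apply: lt_le_trans (truncnS_gt v) _; rewrite ler_nat leq_maxr.
- by move=> _ [x [y ->]]; apply/eqP; rewrite eq_le H //= H.
- move=> k; apply: le_lt_trans muoo; apply: le_measure; rewrite ?inE //.
  exact: measurable_quad.
Qed.

End Quadrants.

(** * A density from geometric convergence in L2 *)

Section L2Criterion.
Variable R : realType.
Local Notation leb2 := (@leb2 R).

Lemma ae_imp (P Q : R * R -> Prop) : (forall u, P u -> Q u) ->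
  {ae leb2, forall u, P u} -> {ae leb2, forall u, Q u}.
Proof.
move=> PQ [N [mN N0 sN]]; exists N; split => //.
by apply: subset_trans sN => u /=; apply: contra_not; exact: PQ.
Qed.

Lemma le_nneseries_bound (u : nat -> \bar R) (K : \bar R) : (forall n, 0 <= u n)%E ->
  (forall n, \sum_(0 <= j < n) u j <= K)%E -> (\sum_(0 <= j <oo) u j <= K)%E.
Proof.
move=> u0 h; apply: lime_le; first by apply: is_cvg_nneseries => n _ _.
by apply: nearW => n; exact: h.
Qed.

Lemma le_geometric_sum (C z : R) n : 0 <= C -> 0 < z < 1 ->
  \sum_(0 <= j < n) C * z ^+ j <= C / (1 - z).
Proof.
move=> C0 /andP[z0 z1].
have nz : `|z| < 1 by rewrite gtr0_norm.
exact: (geometric_le_lim n C0 z0 nz).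
Qed.

Variables (F : nat -> R * R -> R) (mu : {measure set (measurableTypeR R * measurableTypeR R) -> \bar R}) (C ze b : R).
Hypotheses (mF : forall j, measurable_fun setT (F j)) (F0 : forall j u, 0 <= F j u)
  (ze01 : 0 < ze < 1) (C0 : 0 <= C)
  (L2F : forall j, (\int[leb2]_u ((F j.+1 u - F j u) ^+ 2)%:E <= (C * (ze ^+ 4) ^+ j)%:E)%E)
  (L2F0 : (\int[leb2]_u ((F 0%N u) ^+ 2)%:E < +oo)%E)
  (Fsupp : forall j u, F j u != 0 -> `|u.1| <= b /\ `|u.2| <= b)
  (muoo : (mu setT < +oo)%E)
  (mu_le : forall x y e, 0 < e -> \forall j \near \oo,
     (mu (quad (x - e) (y - e)) <= \int[leb2]_(u in quad x y) (F j u)%:E)%E)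
  (mu_ge : forall x y e, 0 < e -> \forall j \near \oo,
     (\int[leb2]_(u in quad (x - e) (y - e)) (F j u)%:E <= mu (quad x y))%E).

Let z0 : 0 < ze. Proof. by case/andP: ze01. Qed.
Let z1 : ze < 1. Proof. by case/andP: ze01. Qed.
Let z201 : 0 < ze ^+ 2 < 1.
Proof. by rewrite exprn_gt0 //= exprn_ilt1 // ltW. Qed.

(* [S] is integrable, and [(F j.+1 - F j) ^+ 2 <= S * (ze ^+ 2) ^+ j] then gives both
   almost everywhere convergence of [F] and a domination. *)
Let w j (u : R * R) := (ze ^+ 2) ^- j * (F j.+1 u - F j u) ^+ 2.
Let S (u : R * R) : \bar R := (\sum_(0 <= j <oo) (w j u)%:E)%E.

Let w_ge0 j u : 0 <= w j u.
Proof. by rewrite mulr_ge0 ?sqr_ge0 // invr_ge0 exprn_ge0 // exprn_ge0 // ltW. Qed.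

Let mw j : measurable_fun setT (w j).
Proof.
apply: measurable_funM => //; apply: measurable_funX; exact: measurable_funB.
Qed.

Let S_ge0 u : (0 <= S u)%E.
Proof. by apply: nneseries_ge0 => n _ _; rewrite lee_fin. Qed.

Let mS : measurable_fun setT S.
Proof.
apply: ge0_emeasurable_sum => [j u _ _|j _].
  by rewrite lee_fin.
exact/measurable_EFinP.
Qed.

Let S_int : (\int[leb2]_u S u < +oo)%E.
Proof.
rewrite integral_nneseries //; last 2 first.
- by move=> j; apply/measurable_EFinP; exact: mw.
- by move=> j u _; rewrite lee_fin.
apply: (@le_lt_trans _ _ (C / (1 - ze ^+ 2))%:E); last exact: ltry.
apply: le_nneseries_bound => n.
  by apply: integral_ge0 => u _; rewrite lee_fin.
apply: (@le_trans _ _ (\sum_(0 <= j < n) (C * (ze ^+ 2) ^+ j)%:E)%E); last first.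
  by rewrite sumEFin lee_fin le_geometric_sum.
apply: lee_sum => j _; rewrite /w.
under eq_integral do rewrite EFinM.
rewrite ge0_integralZl_EFin //; last 3 first.
- by move=> u _; rewrite lee_fin sqr_ge0.
- apply/measurable_EFinP; apply: measurable_funX; exact: (measurable_funB (mF _) (mF _)).
- by rewrite invr_ge0 exprn_ge0 // exprn_ge0 // ltW.
apply: (@le_trans _ _ (((ze ^+ 2) ^- j)%:E * (C * (ze ^+ 4) ^+ j)%:E)%E).
  apply: lee_wpmul2l; last exact: L2F.
  by rewrite lee_fin invr_ge0 exprn_ge0 // exprn_ge0 // ltW.
rewrite -EFinM lee_fin le_eqVlt; apply/orP; left; apply/eqP.
set X := (ze ^+ 2) ^+ j.
have X0 : X != 0 by rewrite expf_neq0 // expf_neq0 // gt_eqF.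
have -> : (ze ^+ 4) ^+ j = X * X.
  by rewrite /X -exprD -!exprM; congr (_ ^+ _); rewrite mulnDr -mulnDl.
by clearbody X; field.
Qed.

(** Upper limit, [fine] and absolute value make this measurable, finite and nonnegative everywhere;
    where [S] is finite it is the limit of [F]. *)
Let f (u : R * R) : R := `|fine (limn_esup (fun j => (F j u)%:E))|.

Let mf : measurable_fun setT f.
Proof.
apply: measurableT_comp => //; apply: measurableT_comp => //.
by apply: measurable_fun_limn_esup => n; exact/measurable_EFinP.
Qed.

Let f_ge0 u : 0 <= f u. Proof. exact: normr_ge0. Qed.

Let S_fin : {ae leb2, forall u, S u \is a fin_num}.
Proof.
have iS : leb2.-integrable setT S.
  apply/integrableP; split => //.
  by under eq_integral do rewrite gee0_abs //.
by have := integrable_ae measurableT iS; apply: filterS => u; exact.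
Qed.

Let step u : S u \is a fin_num ->
  forall j, `|F j.+1 u - F j u| <= Num.sqrt (fine (S u)) * ze ^+ j.
Proof.
move=> Sfin j.
have wS : w j u <= fine (S u).
  rewrite -lee_fin fineK //.
  have := @nneseries_lim_ge R (fun j => (w j u)%:E) xpredT 0%N j.+1 _.
  move=> /(_ (fun n _ _ => (w_ge0 n u : (0 <= (w n u)%:E)%E))).
  apply: le_trans; rewrite big_nat_recr //= leeDr //.
  by apply: sume_ge0 => n _; rewrite lee_fin.
have s0 : 0 <= fine (S u) by exact: le_trans wS.
rewrite -(@ler_pXn2r _ 2) ?nnegrE ?mulr_ge0 ?sqrtr_ge0 ?exprn_ge0 ?(ltW z0) //.
rewrite real_normK ?num_real // exprMn sqr_sqrtr // -exprM mulnC exprM.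
rewrite -ler_pdivrMr ?exprn_gt0 ?exprn_gt0 // mulrC.
exact: wS.
Qed.

(** From (a + t)^2 <= 2 a^2 + 2 t^2 with t = sqrt S / (1 - ze), the sum of all step bounds. *)
Let K := 2 / (1 - ze) ^+ 2.

Let sqr_bound u y : S u \is a fin_num ->
  `|y| <= `|F 0%N u| + Num.sqrt (fine (S u)) / (1 - ze) ->
  y ^+ 2 <= 2 * F 0%N u ^+ 2 + K * fine (S u).
Proof.
move=> Sfin hy.
have s0 : 0 <= fine (S u) by rewrite fine_ge0.
have z1' : 0 < 1 - ze by rewrite subr_gt0.
set t := Num.sqrt _ / _ in hy.
have t2 : K * fine (S u) = 2 * t ^+ 2.
  by rewrite /t /K exprMn sqr_sqrtr // exprVn; ring.
have t0 : 0 <= t by rewrite divr_ge0 ?sqrtr_ge0 // ltW.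
rewrite t2 -(real_normK (num_real y)) -(real_normK (num_real (F 0%N u))).
have := normr_ge0 y; have := normr_ge0 (F 0%N u).
move: (`|F 0%N u|) (`|y|) hy => a c hy a0 c0.
have h1 : c ^+ 2 <= (a + t) ^+ 2 by rewrite lerXn2r // nnegrE addr_ge0.
apply: le_trans h1 _; have := sqr_ge0 (a - t); rewrite sqrrB sqrrD.
by clearbody t; lra.
Qed.

Let good u : S u \is a fin_num ->
  F ^~ u @ \oo --> f u /\ forall j, `|F j u| <= `|F 0%N u| + Num.sqrt (fine (S u)) / (1 - ze).
Proof.
move=> Sfin.
have s0 : 0 <= Num.sqrt (fine (S u)) by rewrite sqrtr_ge0.
have [/cvg_ex[/= l Fl] Fb] := fast_cvg ze01 s0 (step Sfin).
split => //; rewrite (_ : f u = l) //.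
have l0 : 0 <= l.
  by rewrite -(cvg_lim _ Fl) //; apply: limr_ge; [apply/cvg_ex; exists l | apply: nearW => j; exact: F0].
rewrite /f; have Fl' : (fun j => (F j u)%:E) @ \oo --> l%:E by apply/cvg_EFin => //; exact: nearW.
by rewrite (cvg_limn_einf_sup Fl') /= ger0_norm.
Qed.

Let box : set (R * R) := `[- b, b] `*` `[- b, b].

Let mbox : measurable box.
Proof. by apply: measurableX; exact: measurable_itv. Qed.

Let box_fin : (leb2 box < +oo)%E.
Proof.
rewrite /leb2 /box [X in (X < _)%E]product_measure1E //; try exact: measurable_itv.
rewrite [X in (X * _)%E]lebesgue_measure_itv [X in (_ * X)%E]lebesgue_measure_itv /=.
by case: ifP => _; rewrite ?mule0 ?ltry // -EFinB -EFinM ltry.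
Qed.

Let Q (u : R * R) : \bar R := ((2 * F 0%N u ^+ 2)%:E + K%:E * S u)%E.

Let K0 : 0 <= K. Proof. by rewrite /K divr_ge0 // sqr_ge0. Qed.

Let Q_ge0 u : (0 <= Q u)%E.
Proof.
apply: adde_ge0; first by rewrite lee_fin mulr_ge0 // sqr_ge0.
by apply: mule_ge0 => //; rewrite lee_fin.
Qed.

Let mF02 : measurable_fun setT (fun u => (2 * F 0%N u ^+ 2)%:E).
Proof. by apply/measurable_EFinP; apply: measurable_funM => //; exact: measurable_funX. Qed.

Let mKS : measurable_fun setT (fun u => K%:E * S u)%E.
Proof. exact: measurable_funeM. Qed.

Let mQ : measurable_fun setT Q.
Proof. exact: emeasurable_funD. Qed.

Let Q_int : (\int[leb2]_u Q u < +oo)%E.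
Proof.
rewrite ge0_integralD //; last 2 first.
- by move=> u _; rewrite lee_fin mulr_ge0 ?sqr_ge0.
- by move=> u _; rewrite mule_ge0 ?lee_fin.
rewrite ge0_integralZl_EFin //; under eq_integral do rewrite EFinM.
rewrite ge0_integralZl_EFin //; last 2 first.
- by move=> u _; rewrite lee_fin sqr_ge0.
- by apply/measurable_EFinP; apply: measurable_funX; exact: mF.
by rewrite lte_add_pinfty // lte_mul_pinfty // lee_fin.
Qed.

(** [Q] dominates all squares [F n ^+ 2]. By c <= c^2 + 1 and the common bounded support, adding the
    indicator of the box dominates the functions themselves. *)
Let G (u : R * R) : \bar R := (Q u + (\1_box u)%:E)%E.

Let G_int : leb2.-integrable setT G.
Proof.
apply: integrableD => //.
  apply/integrableP; split => //.
  by under eq_integral do rewrite gee0_abs //.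
have := @integrable_lin_indic R _ _ leb2 1 _ mbox box_fin.
by under eq_fun do rewrite mul1r.
Qed.

Let QE u : S u \is a fin_num -> Q u = (2 * F 0%N u ^+ 2 + K * fine (S u))%:E.
Proof. by move=> Sfin; rewrite /Q -{1}(fineK Sfin) -EFinM -EFinD. Qed.

Let F_cvg_int (D : set (R * R)) : measurable D ->
  (\int[leb2]_(u in D) (F j u)%:E @[j --> \oo] --> \int[leb2]_(u in D) (f u)%:E)%E.
Proof.
move=> mD.
have [] := @dominated_convergence _ _ R leb2 D mD (fun j u => (F j u)%:E)
   (fun u => (f u)%:E) G.
- by move=> n; apply/measurable_EFinP; apply: measurable_funTS; exact: mF.
- by apply/measurable_EFinP; apply: measurable_funTS; exact: mf.
- have := S_fin; apply: ae_imp => u /good[h _] _.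
  by apply/cvg_EFin => //; exact: nearW.
- exact: integrableS G_int.
- have := S_fin; apply: ae_imp => u Sfin n _; have [_ /(_ n) h] := good Sfin.
  rewrite abse_EFin ger0_norm // /G.
  have [F00|Fne] := eqVneq (F n u) 0.
    by rewrite F00 adde_ge0.
  have ub : u \in box.
    have [h1 h2] := Fsupp Fne; rewrite inE /box /= !in_itv /=.
    by rewrite -!ler_norml.
  rewrite indicE ub QE // -EFinD lee_fin.
  apply: le_trans (_ : F n u ^+ 2 + 1 <= _); last by rewrite lerD2r; exact: sqr_bound.
  by move: (F n u) => c; have := sqr_ge0 (c - 1 / 2); rewrite sqrrB; lra.
by move=> _ _; exact.
Qed.

Theorem L2_density_criterion : has_L2_density mu.
Proof.
exists f; split => //.
- move=> A mA; pose nuf := dens_measure leb2 mf f_ge0.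
  rewrite -[RHS]/(nuf A).
  apply: (@measure_eq_quad R mu nuf) => // x y e e0.
    rewrite /nuf /dens_measure /= /dens.
    have c := F_cvg_int (measurable_quad x y).
    rewrite -(cvg_lim _ c) //; apply: lime_ge; first by apply/cvg_ex; eexists; exact: c.
    exact: mu_le.
  rewrite /nuf /dens_measure /= /dens.
  have c := F_cvg_int (measurable_quad (x - e) (y - e)).
  rewrite -(cvg_lim _ c) //; apply: lime_le; first by apply/cvg_ex; eexists; exact: c.
  exact: mu_ge.
- apply: le_lt_trans Q_int; apply: ae_ge0_le_integral => //.
  + by move=> u _; rewrite lee_fin sqr_ge0.
  + by apply/measurable_EFinP; apply: measurable_funX; exact: mf.
  have := S_fin; apply: ae_imp => u Sfin _; rewrite QE // lee_fin.
  apply: sqr_bound => //; have [c h] := good Sfin.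
  rewrite ger0_norm // -(cvg_lim _ c) //; apply: limr_le.
    by apply/cvg_ex; eexists; exact: c.
  by apply: nearW => j; apply: le_trans (h j); exact: ler_norm.
Qed.

End L2Criterion.

(** * Level functions on a square of parameters *)

Section SecondDifference.
Variable R : rcfType.
Local Notation nm := (@Normc.normc R).
Local Notation cpoly := (map_poly (real_complex R)).
Variable q : R.
Hypothesis q1 : 0 <= q < 1.

(** The constant bounds the second derivative on the disc. This mixed difference shows that p(z + w)
    - p(z) is Lipschitz in z with a constant proportional to the size of w, as is required of the
    perturbations [ep]. *)
Lemma cpoly_diff2 (p : {poly R}) (z z' w : R[i]) : (forall k, `|p`_k| <= 2) ->
  nm z <= q -> nm z' <= q -> nm (z + w) <= q -> nm (z' + w) <= q ->
  nm ((cpoly p).[z' + w] - (cpoly p).[z'] - ((cpoly p).[z + w] - (cpoly p).[z])) <=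
  4 / (1 - q) ^+ 3 * nm w * nm (z' - z).
Proof.
move=> hp zq z'q zwq z'wq.
have [q0 q1'] := andP q1; have q1'' : 0 < 1 - q by rewrite subr_gt0.
move: p hp; apply: bounded_coef_ind.
  by rewrite map_poly0 !horner0 !subrr nm0; nneg.
move=> p c hp hc IH; rewrite !horner_cpoly_cons.
set A := (cpoly p).[z' + w] in IH *; set B := (cpoly p).[z'] in IH *.
set C := (cpoly p).[z + w] in IH *; set D := (cpoly p).[z] in IH *.
have -> : A * (z' + w) + (c%:C)%C - (B * z' + (c%:C)%C)
    - (C * (z + w) + (c%:C)%C - (D * z + (c%:C)%C)) =
  (A - B - (C - D)) * (z' + w) + ((B - D) * w + (C - D) * (z' - z)) by ring.
have h1 : nm (B - D) <= 2 / (1 - q) ^+ 2 * nm (z' - z) := cpoly_lip q1 hp zq z'q.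
have h2 : nm (C - D) <= 2 / (1 - q) ^+ 2 * nm w.
  by have := cpoly_lip q1 hp zq zwq; rewrite (addrAC z) subrr add0r.
apply: le_trans (nmD _ _) _; apply: le_trans (lerD (lexx _) (nmD _ _)) _; rewrite !nmM.
apply: le_trans (lerD (ler_pM (nm_ge0 _) (nm_ge0 _) IH z'wq)
  (lerD (ler_wpM2r (nm_ge0 w) h1) (ler_wpM2r (nm_ge0 (z' - z)) h2))) _.
by rewrite le_eqVlt; apply/orP; left; apply/eqP; field; rewrite gt_eqF.
Qed.

End SecondDifference.

Section PrefixAverages.
Variable R : realType.

Lemma sum_tuple_rcons n (G : n.+1.-tuple bool -> R) :
  \sum_(a : n.+1.-tuple bool) G a =
  \sum_(a : n.-tuple bool) (G [tuple of rcons a true] + G [tuple of rcons a false]).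
Proof.
pose f (p : n.-tuple bool * bool) := [tuple of rcons p.1 p.2].
have finj : injective f.
  move=> [a b] [c d] /(congr1 val) /= /rcons_inj [h1 h2].
  by congr (_, _) => //; apply: val_inj.
have fbij : bijective f.
  apply: inj_card_bij => //; rewrite card_prod !card_tuple card_bool.
  by rewrite expnS mulnC.
rewrite (reindex f) /=; last exact: onW_bij.
rewrite -(pair_bigA _ (fun a b => G (f (a, b)))) /=.
by apply: eq_bigr => a _; rewrite big_bool.
Qed.

(** Lets the average of level [j] run over the longer words of level [j.+1], so that the two levels
    are compared word by word. *)
Lemma avg_prefix (N k : nat) (G : (nat -> bool) -> R) :
  (forall a b, (forall i, (i < N)%N -> a i = b i) -> G a = G b) ->
  2 ^- N * \sum_(a : N.-tuple bool) G (nth false a) =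
  2 ^- (N + k) * \sum_(a : (N + k).-tuple bool) G (nth false a).
Proof.
move=> hG; elim: k => [|k IH]; first by rewrite addn0.
rewrite addnS sum_tuple_rcons IH.
have E (a : (N + k).-tuple bool) b : G (nth false (rcons a b)) = G (nth false a).
  apply: hG => i iN; rewrite nth_rcons size_tuple.
  by rewrite (leq_trans iN (leq_addr _ _)).
under [in RHS]eq_bigr do rewrite !E.
rewrite big_split /= -mulr2n -mulr_natl exprS; field.
by rewrite expf_neq0.
Qed.

End PrefixAverages.

Section Refinement.
Variable R : realType.

Lemma indic_setX (A B : set R) (u : R * R) : \1_(A `*` B) u = \1_A u.1 * \1_B u.2 :> R.
Proof.
rewrite !indicE -natrM mulnb; congr ((nat_of_bool _)%:R).
by apply/idP/andP => [/set_mem[h1 h2]|[/set_mem h1 /set_mem h2]];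
  [split; exact: mem_set | apply: mem_set].
Qed.

Lemma indic_co_split (x h t : R) : 0 < h ->
  \1_(`[x, x + 2 * h[) t = \1_(`[x, x + h[) t + \1_(`[x + h, x + h + h[) t :> R.
Proof.
move=> h0; rewrite !indicE -natrD; congr (_%:R).
rewrite !mem_setE !in_itv /=.
case: (leP x t) => h1; case: (ltP t (x + h)) => h2; case: (leP (x + h) t) => h3 //=;
  case: (ltP t (x + 2 * h)) => h4; case: (ltP t (x + h + h)) => h5 //=; exfalso; lra.
Qed.

Definition corner (h : R) (c : bool * bool) : R[i] :=
  ((c.1%:R * h) +i* (c.2%:R * h))%C.

Lemma phi_refine (h : R) (p : R[i]) u : 0 < h ->
  phi (2 * h) p u = 4^-1 * \sum_(c : bool * bool) phi h (p + corner h c) u.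
Proof.
move=> h0; rewrite -(pair_bigA _ (fun a b => phi h (p + corner h (a, b)) u)) /= big_bool !big_bool /=.
rewrite /phi /sq !indic_setX.
have E (c : bool * bool) : Re (p + corner h c) = Re p + c.1%:R * h /\ Im (p + corner h c) = Im p + c.2%:R * h.
  by case: p => ? ?.
rewrite !(fun c => proj1 (E c)) !(fun c => proj2 (E c)) /= !mul1r !mul0r !addr0.
rewrite !(indic_co_split _ _ h0).
by field; rewrite gt_eqF.
Qed.

End Refinement.

Section LevelFunctions.
Variables (R : realType) (ell : R) (L : nat).
Hypothesis ell0 : 0 < ell.
Local Notation nm := (@Normc.normc R).

Definition rho (j : nat) : R := ell / 2 ^+ j.
(** The mesh, of the order of the square of [rho j]; a cell of side [rho j] has [2 ^ j] mesh lengths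
    per side. *)
Definition kap (j : nat) : R := ell / 4 ^+ j.
(* [L] is chosen with [q ^+ L <= 1/4], so that truncating the series after [Nd j] terms
   costs at most a multiple of [4 ^- j], far below the scale [rho j]. *)
Definition Nd (j : nat) : nat := (j * L)%N.

Lemma rho_gt0 j : 0 < rho j. Proof. by rewrite divr_gt0 ?exprn_gt0. Qed.
Lemma kap_gt0 j : 0 < kap j. Proof. by rewrite divr_gt0 ?exprn_gt0. Qed.
Lemma rhoS j : rho j = 2 * rho j.+1.
Proof. by rewrite /rho exprS; field; rewrite expf_neq0. Qed.
Lemma kapS j : kap j = 4 * kap j.+1.
Proof. by rewrite /kap exprS; field; rewrite expf_neq0. Qed.

Definition fj (j : nat) (z : R[i]) (u : R * R) : R :=
  2 ^- Nd j * \sum_(a : (Nd j).-tuple bool) phi (rho j) (xt a z) u.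

Lemma fj_ge0 j z u : 0 <= fj j z u.
Proof. by rewrite mulr_ge0 ?invr_ge0 ?exprn_ge0 // sumr_ge0 // => a _; exact: phi_ge0. Qed.

Lemma measurable_fj j z : measurable_fun setT (fj j z).
Proof.
apply: measurable_funM => //; apply: measurable_sum => a; exact: measurable_phi.
Qed.

(* By [phi_refine], the passage from level [j] at [z] to level [j.+1] at [z + w] is a
   signed combination of five squares of side [rho j.+1]: [None] is the new square and
   [Some c] the four quarters of the old one. *)
Definition om (p : option (bool * bool)) : R := if p is Some _ then 4^-1 else -1.

Definition ep (j : nat) (w : R[i]) (a : (Nd j.+1).-tuple bool) (p : option (bool * bool))
    (z : R[i]) : R[i] :=
  if p is Some c then spt (Nd j) (nth false a) z - xt a z + corner (rho j.+1) c
  else xt a (z + w) - xt a z.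

(** The squared L2 distance between level [j] at [z] and level [j.+1] at [z + w], expanded into the
    quadratic form treated by [energy_bound]. *)
Definition En (j : nat) (w z : R[i]) : R :=
  4 ^- Nd j.+1 * \sum_(a : (Nd j.+1).-tuple bool) \sum_(b : (Nd j.+1).-tuple bool)
    \sum_p \sum_p' om p * om p' *
      ker (rho j.+1) (xt a z + ep w a p z - (xt b z + ep w b p' z)).

Lemma sum_option (G : option (bool * bool) -> R) :
  \sum_p G p = G None + \sum_c G (Some c).
Proof.
rewrite (bigD1 None) //=; congr (_ + _).
rewrite (reindex_omap Some id) /=; last by case.
by apply: eq_bigl => c; rewrite eqxx.
Qed.

Lemma om_sum : \sum_p om p = 0.
Proof.
rewrite sum_option /= sumr_const card_prod card_bool -[X in _ + X]mulr_natl.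
by rewrite (_ : (2 * 2)%N%:R = 4 :> R) // divff // addNr.
Qed.

Lemma om_norm : \sum_p `|om p| = 2.
Proof.
rewrite sum_option /= normrN normr1 sumr_const card_prod card_bool -[X in _ + X]mulr_natl.
by rewrite (_ : (2 * 2)%N%:R = 4 :> R) // ger0_norm ?invr_ge0 // divff.
Qed.

Lemma spt_prefix N (a b : nat -> bool) (z : R[i]) :
  (forall k, (k < N)%N -> a k = b k) -> spt N a z = spt N b z.
Proof.
move=> h; rewrite /spt; congr (_.[z]); congr (map_poly _ _).
by apply/polyP => k; rewrite !coef_poly; case: ifP => // kN; rewrite h.
Qed.

Lemma fj_diffE j z w u :
  fj j z u - fj j.+1 (z + w) u = 2 ^- Nd j.+1 *
    \sum_(a : (Nd j.+1).-tuple bool) \sum_p om p * phi (rho j.+1) (xt a z + ep w a p z) u.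
Proof.
have NE : Nd j.+1 = (Nd j + L)%N by rewrite /Nd mulSn addnC.
have -> : fj j z u = 2 ^- Nd j.+1 *
    \sum_(a : (Nd j.+1).-tuple bool) phi (rho j) (spt (Nd j) (nth false a) z) u.
  rewrite /fj NE.
  rewrite -(avg_prefix L (G := fun a => phi (rho j) (spt (Nd j) a z) u)) //.
  by move=> a b h; rewrite (spt_prefix z h).
rewrite /fj -mulrBr -sumrB; congr (_ * _); apply: eq_bigr => a _.
rewrite sum_option /= mulN1r (addrC (xt a z)) subrK [RHS]addrC; congr (_ - _).
rewrite rhoS phi_refine ?rho_gt0 // mulr_sumr; apply: eq_bigr => c _.
by congr (_ * phi _ _ _); rewrite addrA (addrC (xt a z)) subrK.
Qed.

Lemma integral_fj_diff j z w :
  (\int[@leb2 R]_u ((fj j z u - fj j.+1 (z + w) u) ^+ 2)%:E = (En j w z)%:E)%E.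
Proof.
under eq_integral do rewrite fj_diffE pair_bigA mulr_sumr.
have E u : \sum_(i : (Nd j.+1).-tuple bool * option (bool * bool))
     2 ^- Nd j.+1 * (om i.2 * phi (rho j.+1) (xt i.1 z + ep w i.1 i.2 z) u) =
  \sum_(i : (Nd j.+1).-tuple bool * option (bool * bool))
     (2 ^- Nd j.+1 * om i.2) * phi (rho j.+1) (xt i.1 z + ep w i.1 i.2 z) u.
  by apply: eq_bigr => i _; rewrite mulrA.
under eq_integral do rewrite E.
rewrite integral_sqr_phi ?rho_gt0 //; congr EFin; rewrite /En.
have -> : (4 : R) ^- Nd j.+1 = 2 ^- Nd j.+1 * 2 ^- Nd j.+1.
  by rewrite -invfM -exprMn; congr ((_ ^+ _)^-1); rewrite -natrM.
transitivity (\sum_(i : (Nd j.+1).-tuple bool * option (bool * bool))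
  \sum_(i' : (Nd j.+1).-tuple bool * option (bool * bool)) 2 ^- Nd j.+1 * 2 ^- Nd j.+1 *
   (om i.2 * om i'.2 * ker (rho j.+1) (xt i.1 z + ep w i.1 i.2 z - (xt i'.1 z + ep w i'.1 i'.2 z)))).
  by apply: eq_bigr => i _; apply: eq_bigr => i' _; ring.
under eq_bigr do rewrite -mulr_sumr.
rewrite -mulr_sumr; congr (_ * _).
rewrite -(pair_bigA _ (fun a p => \sum_(i' : (Nd j.+1).-tuple bool * option (bool * bool))
   (om p * om i'.2 * ker (rho j.+1) (xt a z + ep w a p z - (xt i'.1 z + ep w i'.1 i'.2 z))))) /=.
apply: eq_bigr => a _.
under eq_bigr do rewrite -(pair_bigA _ (fun b p' =>
   (om _ * om p' * ker (rho j.+1) (xt a z + ep w a _ z - (xt b z + ep w b p' z))))) /=.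
by rewrite exchange_big.
Qed.

Lemma En_ge0 j w z : 0 <= En j w z.
Proof.
rewrite -lee_fin -integral_fj_diff; apply: integral_ge0 => u _.
by rewrite lee_fin sqr_ge0.
Qed.

End LevelFunctions.

(** * A Lipschitz cutoff for a square *)

Section Cutoff.
Variable R : realType.
Local Notation nm := (@Normc.normc R).

(** A trapezoid: 1 on [0, 1], 0 outside (-1/2, 3/2), slopes 2 and -2 between. *)
Definition cut1 (t : R) : R := Num.max 0 (Num.min 1 (2 - 2 * `|t - 1/2|)).

Lemma cut1_01 t : 0 <= cut1 t <= 1.
Proof. by rewrite /cut1 le_max lexx ge_max ler01 ge_min lexx. Qed.

Lemma cut1_eq1 t : 0 <= t <= 1 -> cut1 t = 1.
Proof.
move=> /andP[h0 h1]; have : `|t - 1/2| <= 1/2 by rewrite ler_norml; apply/andP; split; lra.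
move=> h; rewrite /cut1 (min_idPl _); last by lra.
by rewrite (max_idPr _).
Qed.

Lemma cut1_neq0 t : cut1 t != 0 -> `|t - 1/2| < 1.
Proof.
apply: contraR; rewrite -leNgt => h; apply/eqP/max_idPl.
by rewrite ge_min; apply/orP; right; lra.
Qed.

Lemma clampP (x : R) : let c := Num.max 0 (Num.min 1 x) in
  [\/ x <= 0 /\ c = 0, 0 <= x <= 1 /\ c = x | 1 <= x /\ c = 1].
Proof.
case: (leP x 0) => h0 /=.
  by apply: Or31; split => //; apply/max_idPl; rewrite ge_min h0 orbT.
case: (leP x 1) => h1.
  by apply: Or32; split; [rewrite (ltW h0) | apply/max_idPr; rewrite ltW].
by apply: Or33; split; [exact: ltW | apply/max_idPr; exact: ler01].
Qed.

Lemma cut1_lip t u : `|cut1 t - cut1 u| <= 2 * `|t - u|.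
Proof.
have : `| `|t - 1/2| - `|u - 1/2| | <= `|t - u|.
  by apply: le_trans (ler_dist_dist _ _) _; rewrite opprB addrA subrK.
rewrite /cut1; have := normr_ge0 (t - u).
move: `|t - u| => d d0; rewrite ler_norml => /andP[].
move: `|t - 1/2| `|u - 1/2| => x y h1 h2.
have := clampP (2 - 2 * x); have := clampP (2 - 2 * y); move=> /=.
move: (Num.max 0 (Num.min 1 (2 - 2 * x))) (Num.max 0 (Num.min 1 (2 - 2 * y))) => a b.
by case=> -[e1 e2]; case=> -[e3 e4]; rewrite e2 e4 ler_norml; apply/andP; split; lra.
Qed.

Variables (z0 : R[i]) (ell : R).
Hypothesis ell0 : 0 < ell.

Definition cut (z : R[i]) : R := cut1 ((Re z - Re z0) / ell) * cut1 ((Im z - Im z0) / ell).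

Lemma cut_01 z : 0 <= cut z <= 1.
Proof.
have /andP[a0 a1] := cut1_01 ((Re z - Re z0) / ell).
have /andP[b0 b1] := cut1_01 ((Im z - Im z0) / ell).
by rewrite /cut mulr_ge0 //= -[leRHS]mulr1 ler_pM.
Qed.

Lemma cut_lip z w : `|cut z - cut w| <= 4 / ell * nm (z - w).
Proof.
rewrite /cut; set a := cut1 _; set b := cut1 _; set c := cut1 _; set d := cut1 _.
have -> : a * b - c * d = (a - c) * b + c * (b - d) by ring.
have ReB : Re (z - w) = Re z - Re w by case: (z) => ? ?; case: (w) => ? ?.
have ImB : Im (z - w) = Im z - Im w by case: (z) => ? ?; case: (w) => ? ?.
have L (x y : R) : `|x - y| <= nm (z - w) -> 2 * `|x / ell - y / ell| <= 2 / ell * nm (z - w).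
  move=> h; rewrite -mulrBl normrM (gtr0_norm (_ : 0 < ell^-1)) ?invr_gt0 //.
  rewrite -mulrA; apply: ler_wpM2l => //; rewrite mulrC; apply: ler_wpM2l => //.
  by rewrite invr_ge0 ltW.
have h1 : `|a - c| <= 2 / ell * nm (z - w).
  apply: le_trans (cut1_lip _ _) _; apply: L.
  rewrite (_ : _ - _ = Re z - Re w); last by ring.
  by rewrite -ReB normRe_le.
have h2 : `|b - d| <= 2 / ell * nm (z - w).
  apply: le_trans (cut1_lip _ _) _; apply: L.
  rewrite (_ : _ - _ = Im z - Im w); last by ring.
  by rewrite -ImB normIm_le.
have /andP[b0 b1] : 0 <= b <= 1 by exact: cut1_01.
have /andP[c0 c1] : 0 <= c <= 1 by exact: cut1_01.
apply: le_trans (ler_normD _ _) _; rewrite !normrM (ger0_norm b0) (ger0_norm c0).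
have -> : 4 / ell * nm (z - w) = 2 / ell * nm (z - w) * 1 + 1 * (2 / ell * nm (z - w)) by ring.
by apply: lerD; apply: ler_pM.
Qed.

Lemma cut_eq1 z : 0 <= Re z - Re z0 <= ell -> 0 <= Im z - Im z0 <= ell -> cut z = 1.
Proof.
have E x : 0 <= x <= ell -> 0 <= x / ell <= 1.
  by move=> /andP[h0 h1]; rewrite divr_ge0 // ?(ltW ell0) //= ler_pdivrMr // mul1r.
by move=> /E h1 /E h2; rewrite /cut !cut1_eq1 // mulr1.
Qed.

Lemma cut_neq0 z : cut z != 0 ->
  - (ell / 2) < Re z - Re z0 < 3 * ell / 2 /\ - (ell / 2) < Im z - Im z0 < 3 * ell / 2.
Proof.
have E x : cut1 (x / ell) != 0 -> - (ell / 2) < x < 3 * ell / 2.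
  move=> /cut1_neq0; rewrite ltr_norml => /andP[h1 h2].
  have h1' : - 1 / 2 < x / ell by lra.
  have h2' : x / ell < 3 / 2 by lra.
  move: h1' h2'; rewrite ltr_pdivlMr // ltr_pdivrMr // => h1' h2'.
  by apply/andP; split; lra.
by rewrite /cut mulf_eq0 negb_or => /andP[/E h1 /E h2].
Qed.

End Cutoff.

Section SquareEnergy.
Variable R : realType.
Local Notation nm := (@Normc.normc R).
Local Notation cpoly := (map_poly (real_complex R)).

Lemma spoly_le2 M (a : nat -> bool) k : `|(spoly R M a)`_k| <= 2.
Proof. by rewrite coef_poly; case: ifP; rewrite ?normr0 // normr_sgn ler1n. Qed.

Lemma spt_tail N M (a : nat -> bool) (z : R[i]) : (N <= M)%N ->
  spt N a z - spt M a z = - (z ^+ N * (cpoly (drop_poly N (spoly R M a))).[z]).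
Proof.
move=> NM; rewrite /spt -{1}(poly_take_drop N (spoly R M a)).
have -> : take_poly N (spoly R M a) = spoly R N a.
  apply/polyP => k; rewrite coef_take_poly !coef_poly; case: ifP => // kN.
  by rewrite (leq_trans kN NM).
by rewrite rmorphD rmorphM /= map_polyXn !hornerE mulrC opprD addrA subrr add0r.
Qed.

(** The lattice of a square is the middle third, in each direction, of the lattice on which the
    cutoff lives. *)
Lemma sum_middle (A : nat) (f : nat -> R) : (forall i, 0 <= f i) ->
  \sum_(n < A) f (A + n)%N <= \sum_(i < 3 * A) f i.
Proof.
move=> f0; rewrite -(big_mkord xpredT f) -(big_mkord xpredT (fun n => f (A + n)%N)).
rewrite [leRHS](@big_cat_nat _ _ _ A) //=; last by lia.
rewrite [X in _ <= _ + X](@big_cat_nat _ _ _ (2 * A)) //=; try lia.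
have -> : \sum_(A <= i < 2 * A) f i = \sum_(0 <= n < A) f (A + n)%N.
  rewrite -{1}(add0n A) big_addn (_ : 2 * A - A = A)%N; last by lia.
  by apply: eq_bigr => i _; rewrite addnC.
by rewrite [leRHS]addrCA lerDl addr_ge0 // sumr_ge0.
Qed.

Lemma pow_le_half (x : R) : 0 <= x < 1 -> exists L, x ^+ L <= 1/4.
Proof.
move=> /andP[x0 x1].
have h : `|x| < 1 by rewrite ger0_norm.
have q0 : 0 < 1/4 :> R by lra.
have [n _ hn] := @cvgr_lt _ _ _ eventually_filter _ _ (cvg_geometric 1 h) _ q0.
by exists n; apply: ltW; have := hn n (leqnn n); rewrite /geometric /= !mul1r.
Qed.

Lemma four_two j : (4 : R) ^- j = 2 ^- j * 2 ^- j.
Proof. by rewrite -invfM -exprMn; congr ((_ ^+ _)^-1); rewrite -natrM. Qed.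

Lemma expN_decay (q : R) L j : 0 <= q -> q ^+ L <= 1/4 -> q ^+ Nd L j <= 4 ^- j.
Proof.
move=> q0 HL; rewrite /Nd mulnC exprM -exprVn lerXn2r ?nnegrE ?exprn_ge0 //.
by apply: le_trans HL _; lra.
Qed.

Lemma expN_decay2 (q : R) L j : 0 <= q -> q ^+ L <= 1/4 -> q ^+ Nd L j <= 2 ^- j.
Proof.
move=> q0 HL; apply: le_trans (expN_decay j q0 HL) _.
by rewrite four_two ler_piMr ?invr_ge0 ?exprn_ge0 // invf_le1 ?exprn_gt0 // exprn_ege1 // ler1n.
Qed.

Lemma natmul_expN_decay (q : R) L j : 0 <= q -> q ^+ L <= 1/4 ->
  (Nd L j)%:R * q ^+ Nd L j <= L%:R * 2 ^- j.
Proof.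
move=> q0 HL; apply: le_trans (_ : (j%:R * L%:R) * 4 ^- j <= _).
  rewrite -natrM -/(Nd L j); apply: ler_wpM2l; [exact: ler0n | exact: expN_decay].
have j2 : (j%:R : R) * 2 ^- j <= 1.
  by rewrite ler_pdivrMr ?exprn_gt0 // mul1r -natrX ler_nat ltnW // ltn_expl.
have h2j0 : 0 <= (2 : R) ^- j by nneg.
rewrite four_two (_ : _ * _ * _ = L%:R * (j%:R * 2 ^- j * 2 ^- j)); last by ring.
by apply: ler_wpM2l => //; rewrite ler_piMl.
Qed.

Lemma rho_two (ell : R) j : 0 < ell -> (2 : R) ^- j = 2 / ell * rho ell j.+1.
Proof. by move=> l0; rewrite /rho exprS; field; rewrite expf_neq0 //= gt_eqF. Qed.

Lemma nm_corner (h : R) c : 0 < h -> nm (corner h c) <= 2 * h.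
Proof.
move=> h0; apply: le_trans (nm_le_ReIm _) _.
rewrite /corner /= (normrM c.1%:R) (normrM c.2%:R) (gtr0_norm h0).
by case: c => -[] -[] /=; rewrite ?normr1 ?normr0 ?mul1r ?mul0r; lra.
Qed.

(** * Size and Lipschitz constant of the perturbations *)

Section EpBounds.
Variables (q rr ell : R) (L j : nat) (w : R[i]).
Hypotheses (q01 : 0 <= q < 1) (HL : q ^+ L <= 1/4) (rr0 : 0 < rr) (rq : rr <= q) (ell0 : 0 < ell).
Hypothesis rw : nm w <= 8 * rho ell j.+1.
Let b0 := 2 / (1 - q).
Let b1 := 2 / (1 - q) ^+ 2.
Let b2 := 4 / (1 - q) ^+ 3.
Let q0 : 0 <= q. Proof. by case/andP: q01. Qed.
Let q1 : 0 < 1 - q. Proof. by rewrite subr_gt0; case/andP: q01. Qed.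
Let b0_0 : 0 <= b0. Proof. by rewrite /b0 divr_ge0 // ltW. Qed.
Let b1_0 : 0 <= b1. Proof. by rewrite /b1 divr_ge0 // exprn_ge0 // ltW. Qed.
Let b2_0 : 0 <= b2. Proof. by rewrite /b2 divr_ge0 // exprn_ge0 // ltW. Qed.
Let r0 : 0 < rho ell j.+1. Proof. exact: rho_gt0. Qed.
Let tl (a : (Nd L j.+1).-tuple bool) := drop_poly (Nd L j) (spoly R (Nd L j.+1) (nth false a)).
Let tl2 a k : `|(tl a)`_k| <= 2. Proof. by rewrite coef_drop_poly spoly_le2. Qed.
Let epS (a : (Nd L j.+1).-tuple bool) c z :
  ep ell w a (Some c) z = - (z ^+ Nd L j * (cpoly (tl a)).[z]) + corner (rho ell j.+1) c.
Proof. by rewrite /ep /xt spt_tail // /Nd leq_mul2r leqnSn orbT. Qed.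
Let zN z : nm z <= q -> nm z ^+ Nd L j <= 2 ^- j.
Proof.
by move=> zq; apply: le_trans (expN_decay2 j q0 HL); rewrite lerXn2r ?nnegrE ?nm_ge0.
Qed.

Lemma ep_le (a : (Nd L j.+1).-tuple bool) p z : nm z <= q -> nm (z + w) <= q ->
  nm (ep ell w a p z) <= (2 / ell * b0 + 2 + 8 * b1) * rho ell j.+1.
Proof.
move=> zq zwq; have e0 : 0 <= 2 / ell * b0 by rewrite mulr_ge0 // divr_ge0 // ltW.
case: p => [c|].
  apply: le_trans (_ : (2 / ell * b0 + 2) * rho ell j.+1 <= _); last first.
    by rewrite ler_wpM2r ?(ltW r0) // lerDl mulr_ge0.
  rewrite epS; apply: le_trans (nmD _ _) _; rewrite nmN nmM nmX.
  apply: le_trans (lerD (ler_pM _ _ (zN zq) (cpoly_bound q01 (tl2 a) zq)) (nm_corner c r0)) _;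
    rewrite ?exprn_ge0 ?nm_ge0 // -/b0.
  by rewrite (rho_two _ ell0) le_eqVlt; apply/orP; left; apply/eqP; ring.
apply: le_trans (_ : 8 * b1 * rho ell j.+1 <= _); last first.
  by rewrite ler_wpM2r ?(ltW r0) // lerDr addr_ge0.
have := cpoly_lip q01 (spoly_le2 (Nd L j.+1) (nth false a)) zq zwq.
rewrite (addrAC z) subrr add0r => h; apply: le_trans h _.
have -> : 8 * b1 * rho ell j.+1 = b1 * (8 * rho ell j.+1) by rewrite [RHS]mulrCA mulrA.
exact: ler_wpM2l.
Qed.

(** For [Some c] the difference is z^N times a bounded polynomial, with derivative of order N q^N,
    small because q^L <= 1/4; for [None] it is a mixed second difference. *)
Lemma ep_lip (a : (Nd L j.+1).-tuple bool) p z z' : nm z <= q -> nm z' <= q ->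
  nm (z + w) <= q -> nm (z' + w) <= q ->
  nm (ep ell w a p z' - ep ell w a p z) <=
    ((L%:R * b0 / rr + b1) * (2 / ell) + 8 * b2) * rho ell j.+1 * nm (z' - z).
Proof.
move=> zq z'q zwq z'wq.
have f0 : 0 <= (L%:R * b0 / rr + b1) * (2 / ell).
  by apply: mulr_ge0; [nneg | rewrite divr_ge0 // ltW].
case: p => [c|].
  apply: le_trans (_ : (L%:R * b0 / rr + b1) * (2 / ell) * rho ell j.+1 * nm (z' - z) <= _); last first.
    by rewrite ler_wpM2r ?nm_ge0 // ler_wpM2r ?(ltW r0) // lerDl mulr_ge0.
  rewrite !epS.
  have hA := cpoly_bound q01 (tl2 a) z'q.
  have hAB := cpoly_lip q01 (tl2 a) zq z'q.
  move: hA hAB; rewrite -/b0 -/b1.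
  move: (cpoly (tl a)).[z'] (cpoly (tl a)).[z] => A B hA hAB.
  have -> : - (z' ^+ Nd L j * A) + corner (rho ell j.+1) c - (- (z ^+ Nd L j * B) + corner (rho ell j.+1) c) =
    - ((z' ^+ Nd L j - z ^+ Nd L j) * A + z ^+ Nd L j * (A - B)) by ring.
  rewrite nmN; apply: le_trans (nmD _ _) _; rewrite !nmM nmX.
  have hz : nm (z' ^+ Nd L j - z ^+ Nd L j) <= L%:R * 2 ^- j / rr * nm (z' - z).
    apply: le_trans (nm_expB (Nd L j) rr0 rq z'q zq) _.
    have := natmul_expN_decay j q0 HL; move: (Nd L j)%:R (q ^+ Nd L j) (2 ^- j) => x y t h.
    have -> : x * nm (z' - z) * y / rr = x * y / rr * nm (z' - z) by ring.
    by rewrite ler_wpM2r ?nm_ge0 // ler_wpM2r // invr_ge0 ltW.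
  apply: le_trans (lerD (ler_pM (nm_ge0 _) (nm_ge0 _) hz hA)
    (ler_pM (exprn_ge0 _ (nm_ge0 z)) (nm_ge0 _) (zN zq) hAB)) _.
  rewrite (rho_two _ ell0) le_eqVlt; apply/orP; left; apply/eqP.
  move: (rho ell j.+1) (nm _) b0 b1 ell^-1 rr^-1 L%:R => x1 x2 x3 x4 x5 x6 x7; ring.
apply: le_trans (_ : 8 * b2 * rho ell j.+1 * nm (z' - z) <= _); last first.
  by rewrite ler_wpM2r ?nm_ge0 // ler_wpM2r ?(ltW r0) // lerDr.
have := cpoly_diff2 q01 (spoly_le2 (Nd L j.+1) (nth false a)) zq z'q zwq z'wq.
rewrite /ep /xt /spt -/b2 => h.
apply: le_trans (_ : b2 * nm w * nm (z' - z) <= _); first exact: h.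
have -> : 8 * b2 * rho ell j.+1 = b2 * (8 * rho ell j.+1) by rewrite [RHS]mulrCA mulrA.
by rewrite ler_wpM2r ?nm_ge0 //; apply: ler_wpM2l.
Qed.

End EpBounds.

(** The domain [D] of the energy bound: it contains the support of the cutoff with a margin
    [ell / 2] on every side, left for the translations. *)
Definition inside (z0 : R[i]) (ell : R) (z : R[i]) : Prop :=
  - ell < Re z - Re z0 < 2 * ell /\ - ell < Im z - Im z0 < 2 * ell.

Lemma inside_le z0 ell z : inside z0 ell z ->
  `|Re z - Re z0| <= 2 * ell /\ `|Im z - Im z0| <= 2 * ell.
Proof.
move=> [/andP[h1 h2] /andP[h3 h4]].
by split; rewrite ler_norml; apply/andP; split; lra.
Qed.

Lemma inside_dist z0 ell z z' : inside z0 ell z -> inside z0 ell z' -> nm (z' - z) <= 6 * ell.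
Proof.
move=> [/andP[h1 h2] /andP[h3 h4]] [/andP[g1 g2] /andP[g3 g4]].
apply: le_trans (nm_le_ReIm _) _.
have -> : Re (z' - z) = Re z' - Re z by case: (z) => ? ?; case: (z') => ? ?.
have -> : Im (z' - z) = Im z' - Im z by case: (z) => ? ?; case: (z') => ? ?.
have : `|Re z' - Re z| <= 3 * ell by rewrite ler_norml; apply/andP; split; lra.
have : `|Im z' - Im z| <= 3 * ell by rewrite ler_norml; apply/andP; split; lra.
by move: (`|_|) (`|_|) => x y; lra.
Qed.

Lemma cut_inside z0 ell z w : 0 < ell -> cut z0 ell z != 0 -> nm w <= ell / 2 -> inside z0 ell (z + w).
Proof.
move=> l0 /(cut_neq0 l0)[/andP[h1 h2] /andP[h3 h4]] hw.
have := le_trans (normRe_le w) hw; have := le_trans (normIm_le w) hw.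
rewrite /inside (_ : Re (z + w) = Re z + Re w); last by case: (z) => ? ?; case: (w) => ? ?.
rewrite (_ : Im (z + w) = Im z + Im w); last by case: (z) => ? ?; case: (w) => ? ?.
rewrite !ler_norml => /andP[g1 g2] /andP[g3 g4].
by split; apply/andP; split; lra.
Qed.

End SquareEnergy.

Section SquareEnergy.
Variable R : realType.
Local Notation nm := (@Normc.normc R).

Lemma lattice_range (ell : R) j (i v : int) : 0 < ell ->
  - (ell / 2) < - ell + kap ell j * i%:~R < 3 * ell / 2 ->
  `|kap ell j * v%:~R| <= ell / 2 -> (0 <= i + v < (3 * 4 ^ j)%N%:Z)%R.
Proof.
move=> l0 /andP[h1 h2]; rewrite ler_norml => /andP[h3 h4].
have k0 : 0 < kap ell j by exact: kap_gt0.
have g1 : 0 < kap ell j * (i + v)%:~R by rewrite rmorphD /= mulrDr; lra.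
have g2 : kap ell j * (i + v)%:~R < 3 * ell by rewrite rmorphD /= mulrDr; lra.
apply/andP; split; first by move: g1; rewrite pmulr_rgt0 // ltr0z => /ltW.
have g3 : kap ell j * (3 * 4 ^ j)%N%:R = 3 * ell.
  rewrite natrM natrX /kap; field; by rewrite expf_neq0.
by move: g2; rewrite -g3 ltr_pM2l // -(ltr_int R).
Qed.

Lemma cut_lattice_range (z0 : R[i]) (ell : R) j (i i' v : int) : 0 < ell ->
  cut z0 ell (lpt (z0 - (ell +i* ell)%C) (kap ell j) i i') != 0 ->
  `|kap ell j * v%:~R| <= ell / 2 ->
  (0 <= i + v < (3 * 4 ^ j)%N%:Z)%R /\ (0 <= i' + v < (3 * 4 ^ j)%N%:Z)%R.
Proof.
move=> l0 /(cut_neq0 l0)[]; rewrite /lpt; case: z0 => a b /=.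
have -> : a - ell + kap ell j * i%:~R - a = - ell + kap ell j * i%:~R by ring.
have -> : b - ell + kap ell j * i'%:~R - b = - ell + kap ell j * i'%:~R by ring.
by move=> h1 h2 hv; split; [exact: (lattice_range l0 h1 hv) | exact: (lattice_range l0 h2 hv)].
Qed.

(** A common upper bound: twice the constants of [ep_le] and [ep_lip], plus the ratio [4 / ell] of
    the mesh to the square of [rho ell j.+1], plus 1. *)
Definition eps_const (q rr ell : R) (L : nat) : R :=
  2 * ((2 / ell * (2 / (1 - q)) + 2 + 8 * (2 / (1 - q) ^+ 2)) +
       ((L%:R * (2 / (1 - q)) / rr + 2 / (1 - q) ^+ 2) * (2 / ell) + 8 * (4 / (1 - q) ^+ 3)))
  + 4 / ell + 1.

Lemma eps_constP q rr ell L : 0 <= q < 1 -> 0 < rr -> 0 < ell ->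
  [/\ 1 <= eps_const q rr ell L, 4 / ell <= eps_const q rr ell L,
   2 / ell * (2 / (1 - q)) + 2 + 8 * (2 / (1 - q) ^+ 2) <= eps_const q rr ell L / 2 &
   (L%:R * (2 / (1 - q)) / rr + 2 / (1 - q) ^+ 2) * (2 / ell) + 8 * (4 / (1 - q) ^+ 3) <=
     eps_const q rr ell L / 2].
Proof.
move=> /andP[q0 q1] rr0 l0; have q1' : 0 < 1 - q by rewrite subr_gt0.
have a0 : 0 <= 2 / ell * (2 / (1 - q)) + 2 + 8 * (2 / (1 - q) ^+ 2) by nneg.
have b0 : 0 <= (L%:R * (2 / (1 - q)) / rr + 2 / (1 - q) ^+ 2) * (2 / ell) + 8 * (4 / (1 - q) ^+ 3) by nneg.
have c0 : 0 <= 4 / ell by nneg.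
rewrite /eps_const; move: (_ + 8 * (2 / (1 - q) ^+ 2)) (_ + 8 * (4 / (1 - q) ^+ 3)) (4 / ell) a0 b0 c0.
by move=> a b c a0 b0 c0; split; lra.
Qed.

Lemma exists_pow2_le (ell : R) : 0 < ell -> exists j0, forall j, (j0 <= j)%N -> 2 ^- j <= ell.
Proof.
move=> ell0.
have h : `|2^-1 : R| < 1 by rewrite ger0_norm ?invr_ge0 // invf_lt1 // ltr1n.
have [n _ hn] := @cvgr_lt _ _ _ eventually_filter _ _ (cvg_geometric 1 h) _ ell0.
by exists n => j nj; apply: ltW; have := hn j nj; rewrite /geometric /= mul1r exprVn.
Qed.

Lemma rho_le1 (ell : R) j : 0 < ell -> ell <= 1 -> rho ell j <= 1.
Proof.
move=> l0 l1; rewrite /rho ler_pdivrMr ?exprn_gt0 // mul1r; apply: le_trans l1 _.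
by rewrite exprn_ege1 // ler1n.
Qed.

Lemma rho_le (ell : R) j : 0 < ell -> rho ell j <= ell.
Proof.
by move=> l0; rewrite /rho ler_pdivrMr ?exprn_gt0 // ler_peMr ?(ltW l0) // exprn_ege1 // ler1n.
Qed.

Lemma Nd_le L j : ((Nd L j.+1).+1 <= L.+1 * j.+1)%N.
Proof. by rewrite /Nd; lia. Qed.

(** Instance of [energy_bound] on the square enlarged to side [3 * ell]: the lattice starts at z0 -
    ell (1 + i) and has [3 * 4 ^ j] points per side. *)
Lemma square_energy_cut (rr Rb eta s : R) : 0 < rr -> rr < 1 -> 0 <= Rb < 1 ->
  5 * Rb ^+ 8 < 256/625 -> 0 < eta -> 0 < s -> s <= 3 -> 2^-1 = rr `^ s -> rr <= Rb ->
  exists2 l0 : R, 0 < l0 & forall ell, 0 < ell -> ell <= l0 -> ell <= 1 ->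
  ell <= (1 - Rb) / 8 -> forall L, ((1 + Rb) / 2) ^+ L <= 1 / 4 -> 
  exists j0, exists2 Y : R, 0 <= Y & forall j (z0 : R[i]), (j0 <= j)%N ->
    (forall z, `|Re z - Re z0| <= 2 * ell -> `|Im z - Im z0| <= 2 * ell ->
       [/\ rr <= nm z, nm z <= Rb & eta <= `|Im z|]) ->
    forall w, nm w <= 4 * rho ell j ->
    \sum_(n1 < 3 * 4 ^ j) \sum_(n2 < 3 * 4 ^ j)
      cut z0 ell (lpt (z0 - (ell +i* ell)%C) (kap ell j) n1%:Z n2%:Z) *
      En ell L j w (lpt (z0 - (ell +i* ell)%C) (kap ell j) n1%:Z n2%:Z) <=
    Y * 2 ^+ 2 * (Nd L j.+1).+1%:R ^+ 4 *
     (rho ell j.+1 `^ s * rho ell j.+1 ^- 2 * kap ell j ^- 2).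
Proof.
move=> rr0 rr1 Rb01 Rb8 eta0 s0 s3 rs rrRb.
have [dm dm0 HE] := energy_bound rr0 rr1 Rb01 Rb8 eta0.
exists (dm / 6); first by rewrite divr_gt0.
move=> ell ell0 elldm ell1 ellRb L HL.
have [Rb0 Rb1] := andP Rb01.
have q01 : 0 <= (1 + Rb) / 2 < 1 by clear -Rb0 Rb1; apply/andP; split; lra.
have Rbq : Rb <= (1 + Rb) / 2 by clear -Rb1; lra.
have [j0 Hj0] := exists_pow2_le ell0.
have [C1_1 C1_l C1_e C1_f] := eps_constP L q01 rr0 ell0.
set C1 := eps_const _ _ _ _ in C1_1 C1_l C1_e C1_f.
have l4 : 0 <= 4 / ell by rewrite divr_ge0 // ltW.
have lh0 : 0 < ell / 2 by rewrite divr_gt0.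
have CK0 : 0 <= 3 * ell by rewrite mulr_ge0 // ltW.
have {HE} [Cst Cst0 H] := HE C1 (4 / ell) (ell / 2) (3 * ell) s C1_1 l4 lh0 CK0 s0 s3 rs.
exists j0, Cst => // j z0 jj0 Hz0 w hw.
have r0 : 0 < rho ell j.+1 by exact: rho_gt0.
have k0 : 0 < kap ell j by exact: kap_gt0.
have rw : nm w <= 8 * rho ell j.+1.
  by apply: le_trans hw _; rewrite (rhoS ell j) le_eqVlt; apply/orP; left; apply/eqP; ring.
have wq : nm w <= (1 - Rb) / 2.
  apply: le_trans hw _; apply: le_trans (ler_wpM2l _ (rho_le j ell0)) _ => //.
  by clear -ellRb; lra.
have DP z : inside z0 ell z -> [/\ rr <= nm z, nm z <= Rb & eta <= `|Im z|].
  by move=> /inside_le[]; apply: Hz0.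
have Dq z : inside z0 ell z -> nm z <= (1 + Rb) / 2 by move=> /DP[_ h _]; exact: le_trans Rbq.
have Dwq z : inside z0 ell z -> nm (z + w) <= (1 + Rb) / 2.
  move=> /DP[_ h _]; apply: le_trans (nmD _ _) _; apply: le_trans (lerD h wq) _.
  by clear; lra.
have Ddm z z' : inside z0 ell z -> inside z0 ell z' -> nm (z' - z) <= dm.
  move=> Dz Dz'; apply: le_trans (inside_dist Dz Dz') _; by rewrite mulrC -ler_pdivlMr.
have kpC : kap ell j <= C1 * rho ell j.+1 ^+ 2.
  apply: le_trans (_ : 4 / ell * rho ell j.+1 ^+ 2 <= _); last first.
    by rewrite ler_wpM2r // sqr_ge0.
  have -> : 4 / ell * rho ell j.+1 ^+ 2 = ell * (2 / ell * rho ell j.+1 * (2 / ell * rho ell j.+1)).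
    by field; rewrite gt_eqF.
  by rewrite -rho_two // -four_two.
have KK : (3 * 4 ^ j)%:R * kap ell j <= 3 * ell.
  rewrite natrM natrX /kap le_eqVlt; apply/orP; left; apply/eqP.
  by field; rewrite expf_neq0.
have rrq : rr <= (1 + Rb) / 2 by exact: le_trans Rbq.
(* For [j >= j0] also 2^-(j+1) <= ell, so the decay 4^-(j+1) is at most [rho ell j.+1]. *)
have rM : rr ^+ (Nd L j.+1) <= rho ell j.+1.
  have q0 : 0 <= (1 + Rb) / 2 by case/andP: q01.
  apply: le_trans (_ : ((1 + Rb) / 2) ^+ Nd L j.+1 <= _).
    by rewrite lerXn2r ?nnegrE ?(ltW rr0).
  apply: le_trans (expN_decay _ q0 HL) _.
  rewrite four_two /rho ler_wpM2r ?invr_ge0 ?exprn_ge0 //; apply: Hj0.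
  by rewrite (leq_trans jj0).
have E1 a p z : inside z0 ell z -> nm (ep (L := L) (j := j) ell w a p z) <= C1 / 2 * rho ell j.+1.
  move=> Dz; apply: le_trans (ep_le q01 HL ell0 rw a p (Dq _ Dz) (Dwq _ Dz)) _.
  by rewrite ler_wpM2r // ltW.
have E2 a p z z' : inside z0 ell z -> inside z0 ell z' ->
    nm (ep (L := L) (j := j) ell w a p z' - ep ell w a p z) <= C1 / 2 * rho ell j.+1 * nm (z' - z).
  move=> Dz Dz'; apply: le_trans (ep_lip q01 HL rr0 rrq ell0 rw a p (Dq _ Dz) (Dq _ Dz') (Dwq _ Dz) (Dwq _ Dz')) _.
  by rewrite ler_wpM2r ?nm_ge0 // ler_wpM2r // ltW.
have := H (rho ell j.+1) (kap ell j) (3 * 4 ^ j)%N (Nd L j.+1) (z0 - (ell +i* ell)%C)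
  (inside z0 ell) (cut z0 ell) _ (@om R) (ep ell w) r0 (rho_le1 _ ell0 ell1) k0 kpC KK rM DP Ddm
  E1 E2 (cut_01 z0 ell) (cut_lip z0 ell0)
  (fun z w' => @cut_inside R z0 ell z w' ell0)
  (fun i i' v => @cut_lattice_range z0 ell j i i' v ell0) (om_sum R).
by rewrite om_norm.
Qed.

(** The base 64 * 2^-s collects 2^-s from rho^s, 4 from rho^-2 and 16 from kap^-2; dividing by the
    16^j lattice points leaves a mean energy of order j^4 2^(j (2 - s)). On the square itself the
    cutoff is 1, and [En] is nonnegative elsewhere. *)
Lemma square_energy (rr Rb eta s : R) : 0 < rr -> rr < 1 -> 0 <= Rb < 1 ->
  5 * Rb ^+ 8 < 256/625 -> 0 < eta -> 0 < s -> s <= 3 -> 2^-1 = rr `^ s -> rr <= Rb ->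
  exists2 l0 : R, 0 < l0 & forall ell, 0 < ell -> ell <= l0 -> ell <= 1 ->
  ell <= (1 - Rb) / 8 -> forall L, ((1 + Rb) / 2) ^+ L <= 1 / 4 -> 
  exists j0, exists2 Y : R, 0 <= Y & forall j (z0 : R[i]), (j0 <= j)%N ->
    (forall z, `|Re z - Re z0| <= 2 * ell -> `|Im z - Im z0| <= 2 * ell ->
       [/\ rr <= nm z, nm z <= Rb & eta <= `|Im z|]) ->
    forall w, nm w <= 4 * rho ell j ->
    \sum_(n1 < 4 ^ j) \sum_(n2 < 4 ^ j) En ell L j w (lpt z0 (kap ell j) n1%:Z n2%:Z) <=
    Y * j.+1%:R ^+ 4 * (64 * 2^-1 `^ s) ^+ j.
Proof.
move=> rr0 rr1 Rb01 Rb8 eta0 s0 s3 rs rrRb.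
have [l0 l0_0 H] := square_energy_cut rr0 rr1 Rb01 Rb8 eta0 s0 s3 rs rrRb.
exists l0 => // ell ell0 elll0 ell1 ellRb L HL.
have k0 j : 0 <= kap ell j by apply/ltW/kap_gt0.
have {H} [j0 [Y Y0 H]] := H ell ell0 elll0 ell1 ellRb L HL.
exists j0, (Y * 2 ^+ 2 * L.+1%:R ^+ 4 * (4 / ell ^+ 2 / ell ^+ 2)).
  by nneg.
move=> j z0 jj0 Hz w hw; have := H j z0 jj0 Hz w hw.
set z0' := z0 - _ => h.
have E (n1 n2 : nat) : lpt z0 (kap ell j) n1%:Z n2%:Z = lpt z0' (kap ell j) (4 ^ j + n1)%N%:Z (4 ^ j + n2)%N%:Z.
  rewrite /lpt /z0'; case: z0 {Hz h z0'} => a b; apply/eqP; rewrite eq_complex /=.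
  rewrite !PoszD !rmorphD /= -!pmulrn !natrX.
  by apply/andP; split; apply/eqP; rewrite /kap; field; rewrite expf_neq0.
apply: le_trans (_ : _ <= \sum_(n1 < 3 * 4 ^ j) \sum_(n2 < 3 * 4 ^ j)
      cut z0 ell (lpt z0' (kap ell j) n1%:Z n2%:Z) *
      En ell L j w (lpt z0' (kap ell j) n1%:Z n2%:Z)) _.
  pose G (n1 n2 : nat) := cut z0 ell (lpt z0' (kap ell j) n1%:Z n2%:Z) *
      En ell L j w (lpt z0' (kap ell j) n1%:Z n2%:Z).
  have g0 n1 n2 : 0 <= G n1 n2.
    by rewrite mulr_ge0 ?En_ge0 //; case/andP: (cut_01 z0 ell (lpt z0' (kap ell j) n1%:Z n2%:Z)).
  apply: le_trans (@sum_middle R (4 ^ j) (fun n1 => \sum_(n2 < 3 * 4 ^ j) G n1 n2) _); last first.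
    by move=> i; apply: sumr_ge0 => i' _; exact: g0.
  apply: ler_sum => n1 _; apply: le_trans (@sum_middle R (4 ^ j) (G (4 ^ j + n1)%N) (g0 _)).
  apply: ler_sum => n2 _; rewrite /G -E cut_eq1 ?mul1r //; rewrite /lpt; case: (z0) => a b /=.
    rewrite addrAC subrr add0r -pmulrn mulr_ge0 ?ler0n //=.
    rewrite /kap mulrAC ler_pdivrMr ?exprn_gt0 // ler_wpM2l ?(ltW ell0) //.
    by rewrite -natrX ler_nat ltnW.
  rewrite addrAC subrr add0r -pmulrn mulr_ge0 ?ler0n //=.
  rewrite /kap mulrAC ler_pdivrMr ?exprn_gt0 // ler_wpM2l ?(ltW ell0) //.
  by rewrite -natrX ler_nat ltnW.
apply: le_trans h _.
have hN : (Nd L j.+1).+1%:R <= L.+1%:R * j.+1%:R :> R by rewrite -natrM ler_nat Nd_le.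
have hr : rho ell j.+1 `^ s <= (2^-1 `^ s) ^+ j.
  rewrite -[leRHS]powR_mulrn ?powR_ge0 // powRAC powR_mulrn ?invr_ge0 // exprVn.
  have r2 : rho ell j.+1 <= 2 ^- j.
    rewrite /rho -[leRHS]mul1r ler_pM ?(ltW ell0) ?invr_ge0 ?exprn_ge0 //.
    by rewrite lef_pV2 ?posrE ?exprn_gt0 // ler_weXn2l // ler1n.
  have r0 : 0 <= rho ell j.+1 by apply/ltW/rho_gt0.
  by apply: ge0_ler_powR => //; [exact: ltW | rewrite nnegrE invr_ge0 exprn_ge0].
have -> : rho ell j.+1 ^- 2 = 4 / ell ^+ 2 * 4 ^+ j.
  have -> : (4 : R) ^+ j = 2 ^+ j * 2 ^+ j by rewrite -exprMn; congr (_ ^+ _); rewrite -natrM.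
  by rewrite /rho (exprS 2 j); field; rewrite ?expf_neq0 ?gt_eqF.
have -> : kap ell j ^- 2 = 16 ^+ j / ell ^+ 2.
  have -> : (16 : R) ^+ j = 4 ^+ j * 4 ^+ j by rewrite -exprMn; congr (_ ^+ _); rewrite -natrM.
  by rewrite /kap; field; rewrite ?expf_neq0 ?gt_eqF.
have -> : Y * 2 ^+ 2 * L.+1%:R ^+ 4 * (4 / ell ^+ 2 / ell ^+ 2) * j.+1%:R ^+ 4 * (64 * 2^-1 `^ s) ^+ j =
   Y * 2 ^+ 2 * (L.+1%:R * j.+1%:R) ^+ 4 * ((2^-1 `^ s) ^+ j * (4 / ell ^+ 2 * 4 ^+ j) * (16 ^+ j / ell ^+ 2)).
  have -> : (64 : R) = 4 * 16 by rewrite -natrM.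
  rewrite !exprMn; move: (_ ^+ j) (_ ^+ j) (_ ^+ j) (ell ^+ 2)^-1 (L.+1%:R) (j.+1%:R) => x1 x2 x3 x4 x5 x6.
  ring.
apply: ler_pM; [by nneg | | | ].
- by rewrite ?mulr_ge0 ?powR_ge0 ?invr_ge0 ?exprn_ge0 ?(ltW ell0) // divr_ge0 ?exprn_ge0 ?(ltW ell0).
- by apply: ler_wpM2l; [nneg | rewrite lerXn2r ?nnegrE ?mulr_ge0].
apply: ler_wpM2r; first by rewrite mulr_ge0 ?invr_ge0 ?exprn_ge0 ?(ltW ell0).
apply: ler_wpM2r => //.
by rewrite mulr_ge0 ?exprn_ge0 // divr_ge0 ?exprn_ge0 ?(ltW ell0).
Qed.

End SquareEnergy.

(** * Averages over dyadic cells *)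

Section BlockSums.
Variable R : realType.

Lemma sum_nat_shift (a n : nat) (f : nat -> R) :
  \sum_(a <= i < n + a) f i = \sum_(0 <= i < n) f (i + a)%N.
Proof. by rewrite -{1}(add0n a) big_addn addnK. Qed.

Lemma sum_blocks (B A : nat) (f : nat -> R) :
  \sum_(i < B) \sum_(m < A) f (A * i + m)%N = \sum_(n < B * A) f n.
Proof.
elim: B => [|B IH]; first by rewrite !big_ord0.
rewrite big_ord_recr /= IH -!(big_mkord xpredT).
rewrite -(big_mkord xpredT (fun m => f (A * B + m)%N)) [RHS](@big_cat_nat _ _ _ (B * A)) //=; last first.
  by rewrite leq_mul2r leqnSn orbT.
congr (_ + _); rewrite mulSn sum_nat_shift.
by apply: eq_bigr => i _; rewrite addnC mulnC.
Qed.

Lemma sum_shift_window (A m : nat) (h : int -> R) : (forall d, 0 <= h d) -> (m < A)%N ->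
  \sum_(k < 4 * A) h (k%:Z - (4 * m)%N%:Z) <= \sum_(d < 8 * A) h (d%:Z - (4 * A)%N%:Z).
Proof.
move=> h0 mA.
rewrite -(big_mkord xpredT (fun d => h (d%:Z - (4 * A)%N%:Z))).
rewrite -(big_mkord xpredT (fun k => h (k%:Z - (4 * m)%N%:Z))).
have l1 : (4 * A - 4 * m <= 8 * A)%N by lia.
have l2 : (4 * A - 4 * m <= 4 * A + (4 * A - 4 * m))%N by lia.
have l3 : (4 * A + (4 * A - 4 * m) <= 8 * A)%N by lia.
rewrite [leRHS](@big_cat_nat _ _ _ (4 * A - 4 * m)) //= [X in _ <= _ + X](@big_cat_nat _ _ _ (4 * A + (4 * A - 4 * m))) //=.
rewrite sum_nat_shift (_ : \sum_(0 <= i < 4 * A) h ((i + (4 * A - 4 * m))%N%:Z - (4 * A)%N%:Z) =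
             \sum_(0 <= k < 4 * A) h (k%:Z - (4 * m)%N%:Z)); last first.
  by apply: eq_bigr => i _; congr h; lia.
by rewrite addrCA lerDl addr_ge0 // sumr_ge0.
Qed.

(** Pairs of points in a common cell are regrouped by displacement: for a fixed displacement, the
    sum over cells and positions is part of one sum over the whole lattice, the kind of sum the
    energy bound controls. *)
Lemma sum_pairs_window (A : nat) (h : nat -> int -> R) : (forall n d, 0 <= h n d) ->
  \sum_(i < A) \sum_(m < A) \sum_(k < 4 * A) h (A * i + m)%N (k%:Z - (4 * m)%N%:Z) <=
  \sum_(n < A * A) \sum_(d < 8 * A) h n (d%:Z - (4 * A)%N%:Z).
Proof.
move=> h0; rewrite -(sum_blocks A A (fun n => \sum_(d < 8 * A) h n (d%:Z - (4 * A)%N%:Z))).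
by apply: ler_sum => i _; apply: ler_sum => m _; apply: sum_shift_window.
Qed.

Lemma sqr_sum_le (T : finType) (g : T -> R) : (\sum_t g t) ^+ 2 <= #|T|%:R * \sum_t g t ^+ 2.
Proof.
have [T0|T0] := eqVneq #|T| 0%N.
  by rewrite T0 mul0r big_pred0 ?expr0n // => t; rewrite -[RHS](card0_eq T0 t).
set S := \sum_t g t; set n : R := #|T|%:R.
have n0 : 0 < n by rewrite ltr0n lt0n.
have E : \sum_t (n * g t - S) ^+ 2 = n * (n * \sum_t g t ^+ 2 - S ^+ 2).
  transitivity (n ^+ 2 * (\sum_t g t ^+ 2) - 2 * n * S * (\sum_t g t) + n * S ^+ 2).
    have -> : n * S ^+ 2 = \sum_(t : T) S ^+ 2 by rewrite sumr_const mulr_natl.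
    rewrite [X in _ = X - _ + _]mulr_sumr [X in _ = _ - X + _]mulr_sumr -sumrB -big_split /=; apply: eq_bigr => t _; ring.
  by rewrite -/S; ring.
have : 0 <= n * (n * \sum_t g t ^+ 2 - S ^+ 2).
  by rewrite -E sumr_ge0 // => t _; rewrite sqr_ge0.
by rewrite pmulr_rge0 // subr_ge0.
Qed.

Lemma avg_diff (T1 T2 : finType) (f : T1 -> R) (g : T2 -> R) : (0 < #|T1|)%N -> (0 < #|T2|)%N ->
  #|T1|%:R^-1 * \sum_x f x - #|T2|%:R^-1 * \sum_y g y =
  #|T1|%:R^-1 * #|T2|%:R^-1 * \sum_(t : T1 * T2) (f t.1 - g t.2).
Proof.
move=> h1 h2; rewrite -(pair_bigA _ (fun x y => f x - g y)) /=.
under [in RHS]eq_bigr do rewrite sumrB sumr_const -mulr_natl.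
rewrite sumrB sumr_const -mulr_sumr -(mulr_natl _ #|T1|).
by field; rewrite !pnatr_eq0 -!lt0n h1 h2.
Qed.

End BlockSums.

Section Cells.
Variables (R : realType) (z0 : R[i]) (ell : R) (L : nat).
Hypothesis ell0 : 0 < ell.
Local Notation nm := (@Normc.normc R).
Local Notation fj := (fj ell L).

Definition cpt (j : nat) (i m : nat * nat) : R[i] :=
  lpt z0 (kap ell j) (2 ^ j * i.1 + m.1)%N%:Z (2 ^ j * i.2 + m.2)%N%:Z.

(** Energies are controlled only in mean over parameters, so the level function at one parameter is
    replaced by its mean over the [4 ^ j] lattice points of a cell. *)
Definition Fbar (j : nat) (i : nat * nat) (u : R * R) : R :=
  4 ^- j * \sum_(m : 'I_(2 ^ j) * 'I_(2 ^ j)) fj j (cpt j i (val m.1, val m.2)) u.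

Definition cellEn (j n1 n2 : nat) (d1 d2 : int) : R :=
  En ell L j (lpt 0 (kap ell j.+1) d1 d2) (lpt z0 (kap ell j) n1%:Z n2%:Z).

(* Jensen bound for the jump of [Fbar] from a cell to any of its four children: the mean
   energy over pairs of lattice points of the two levels lying in the cell. *)
Definition cellV (j : nat) (i : nat * nat) : R :=
  4 ^- j * 4 ^- j.+1 * \sum_(m1 < 2 ^ j) \sum_(k1 < 4 * 2 ^ j) \sum_(m2 < 2 ^ j) \sum_(k2 < 4 * 2 ^ j)
   cellEn j (2 ^ j * i.1 + m1) (2 ^ j * i.2 + m2)
     (k1%:Z - (4 * m1)%N%:Z) (k2%:Z - (4 * m2)%N%:Z).

Lemma cellEn_ge0 j n1 n2 d1 d2 : 0 <= cellEn j n1 n2 d1 d2.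
Proof. exact: En_ge0. Qed.

Lemma cellV_ge0 j i : 0 <= cellV j i.
Proof.
rewrite /cellV !mulr_ge0 ?invr_ge0 ?exprn_ge0 //.
by do 4!(apply: sumr_ge0 => ? _); exact: cellEn_ge0.
Qed.

Lemma Fbar_ge0 j i u : 0 <= Fbar j i u.
Proof. by rewrite mulr_ge0 ?invr_ge0 ?exprn_ge0 // sumr_ge0 // => m _; exact: fj_ge0. Qed.

Lemma measurable_Fbar j i : measurable_fun setT (Fbar j i).
Proof.
apply: measurable_funM => //; apply: measurable_sum => a; exact: measurable_fj.
Qed.

Lemma cpt_child j i c m m' :
  cpt j.+1 (2 * i.1 + c.1, 2 * i.2 + c.2)%N m' =
  cpt j i m + lpt 0 (kap ell j.+1) ((2 ^ j.+1 * c.1 + m'.1)%N%:Z - (4 * m.1)%N%:Z)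
                                   ((2 ^ j.+1 * c.2 + m'.2)%N%:Z - (4 * m.2)%N%:Z).
Proof.
rewrite /cpt /lpt /= (kapS ell j); case: z0 => a b; apply/eqP; rewrite eq_complex /=.
rewrite !rmorphB /= -!pmulrn !(natrD, natrM, natrX) !exprS.
by apply/andP; split; apply/eqP; ring.
Qed.

Lemma pow4_card j : (4 : R) ^- j = (#|{: 'I_(2 ^ j) * 'I_(2 ^ j)}|%:R)^-1.
Proof. by rewrite card_prod card_ord -expnMn natrX. Qed.

Definition child_pairs j := (('I_(2 ^ j) * 'I_(2 ^ j)) * ('I_(2 ^ j.+1) * 'I_(2 ^ j.+1)))%type.

Definition child_term j (i c : nat * nat) (t : child_pairs j) (u : R * R) : R :=
  fj j (cpt j i (val t.1.1, val t.1.2)) u -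
  fj j.+1 (cpt j.+1 (2 * i.1 + c.1, 2 * i.2 + c.2)%N (val t.2.1, val t.2.2)) u.

Lemma Fbar_diffE j (i c : nat * nat) u :
  Fbar j i u - Fbar j.+1 (2 * i.1 + c.1, 2 * i.2 + c.2)%N u =
  4 ^- j * 4 ^- j.+1 * \sum_t @child_term j i c t u.
Proof.
rewrite /Fbar !pow4_card.
rewrite (avg_diff (fun m => fj j (cpt j i (val m.1, val m.2)) u)
   (fun m => fj j.+1 (cpt j.+1 (2 * i.1 + c.1, 2 * i.2 + c.2)%N (val m.1, val m.2)) u)) //.
  by rewrite card_prod card_ord muln_gt0 expn_gt0.
by rewrite card_prod card_ord muln_gt0 expn_gt0.
Qed.

Lemma measurable_child_term j i c t : measurable_fun setT (@child_term j i c t).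
Proof. by apply: measurable_funB; exact: measurable_fj. Qed.

Lemma integral_child_term j i c (t : child_pairs j) :
  (\int[@leb2 R]_u ((child_term i c t u) ^+ 2)%:E =
   (cellEn j (2 ^ j * i.1 + t.1.1) (2 ^ j * i.2 + t.1.2)
     ((2 ^ j.+1 * c.1 + t.2.1)%N%:Z - (4 * t.1.1)%N%:Z)
     ((2 ^ j.+1 * c.2 + t.2.2)%N%:Z - (4 * t.1.2)%N%:Z))%:E)%E.
Proof.
rewrite /child_term; under eq_integral do rewrite (cpt_child j i c (val t.1.1, val t.1.2)).
exact: integral_fj_diff.
Qed.

Lemma sum_half_window (A c : nat) (h : nat -> R) : (forall k, 0 <= h k) -> (c < 2)%N ->
  \sum_(m < 2 * A) h (2 * A * c + m)%N <= \sum_(k < 4 * A) h k.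
Proof.
move=> h0 c2; have -> : (4 * A = 2 * (2 * A))%N by rewrite mulnA.
rewrite -(sum_blocks 2 (2 * A) h) big_ord_recl big_ord1 /=.
case: c c2 => [|[|//]] _; rewrite ?muln0 ?muln1 ?lerDl ?lerDr sumr_ge0 //.
Qed.

Lemma sum_child_terms j i c : (c.1 < 2)%N -> (c.2 < 2)%N ->
  4 ^- j * 4 ^- j.+1 * \sum_(t : child_pairs j)
   cellEn j (2 ^ j * i.1 + t.1.1) (2 ^ j * i.2 + t.1.2)
     ((2 ^ j.+1 * c.1 + t.2.1)%N%:Z - (4 * t.1.1)%N%:Z)
     ((2 ^ j.+1 * c.2 + t.2.2)%N%:Z - (4 * t.1.2)%N%:Z) <= cellV j i.
Proof.
move=> c1 c2; rewrite /cellV; apply: ler_wpM2l; first by rewrite mulr_ge0 ?invr_ge0 ?exprn_ge0.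
pose F (m1 m2 k1 k2 : nat) := cellEn j (2 ^ j * i.1 + m1) (2 ^ j * i.2 + m2)
     (k1%:Z - (4 * m1)%N%:Z) (k2%:Z - (4 * m2)%N%:Z).
have F0 m1 m2 k1 k2 : 0 <= F m1 m2 k1 k2 by exact: cellEn_ge0.
rewrite -(pair_bigA _ (fun (m : 'I_(2 ^ j) * 'I_(2 ^ j)) (m' : 'I_(2 ^ j.+1) * 'I_(2 ^ j.+1)) =>
   F m.1 m.2 (2 ^ j.+1 * c.1 + m'.1)%N (2 ^ j.+1 * c.2 + m'.2)%N)) /=.
rewrite -(pair_bigA _ (fun (m1 m2 : 'I_(2 ^ j)) => \sum_(m' : 'I_(2 ^ j.+1) * 'I_(2 ^ j.+1))
   F m1 m2 (2 ^ j.+1 * c.1 + m'.1)%N (2 ^ j.+1 * c.2 + m'.2)%N)) /=.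
apply: ler_sum => m1 _; rewrite [leRHS]exchange_big; apply: ler_sum => m2 _ /=.
rewrite -(pair_bigA _ (fun (m1' m2' : 'I_(2 ^ j.+1)) =>
   F m1 m2 (2 ^ j.+1 * c.1 + m1')%N (2 ^ j.+1 * c.2 + m2')%N)) /=.
rewrite !expnS.
apply: le_trans (@sum_half_window (2 ^ j) c.1 (fun k1 => \sum_(m2' < 2 * 2 ^ j)
   F m1 m2 k1 (2 * 2 ^ j * c.2 + m2')%N) _ c1) _.
  by move=> k; apply: sumr_ge0.
apply: ler_sum => k1 _.
by apply: (@sum_half_window (2 ^ j) c.2 (fun k2 => F m1 m2 k1 k2)).
Qed.

Lemma integral_Fbar_diff j i c : (c.1 < 2)%N -> (c.2 < 2)%N ->
  (\int[@leb2 R]_u ((Fbar j i u - Fbar j.+1 (2 * i.1 + c.1, 2 * i.2 + c.2)%N u) ^+ 2)%:E <=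
   (cellV j i)%:E)%E.
Proof.
move=> c1 c2; set al : R := 4 ^- j * 4 ^- j.+1.
have al0 : 0 <= al by rewrite mulr_ge0 ?invr_ge0 ?exprn_ge0.
have alE : al = (#|{: child_pairs j}|%:R)^-1.
  by rewrite /al !pow4_card -invfM -natrM -card_prod.
have m2 t : measurable_fun setT (fun u => (((child_term i c (t : child_pairs j) u) ^+ 2)%:E)).
  by apply/measurable_EFinP; apply: measurable_funX; exact: measurable_child_term.
apply: (@le_trans _ _ (\int[@leb2 R]_u (al%:E * \sum_(t : child_pairs j) ((child_term i c t u) ^+ 2)%:E))%E).
  apply: ge0_le_integral => //.
  - by move=> u _; rewrite lee_fin sqr_ge0.
  - apply/measurable_EFinP; apply: measurable_funX; apply: measurable_funB; exact: measurable_Fbar.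
  - apply: measurable_funeM; exact: emeasurable_sum.
  move=> u _; rewrite Fbar_diffE -/al sumEFin -EFinM lee_fin exprMn expr2 -mulrA.
  apply: ler_wpM2l => //; rewrite alE mulrC ler_pdivrMr; last first.
    by rewrite ltr0n !card_prod !card_ord !muln_gt0 !expn_gt0.
  by rewrite mulrC sqr_sum_le.
rewrite ge0_integralZl //; last 2 first.
- exact: emeasurable_sum.
- by move=> u _; apply: sume_ge0 => t _; rewrite lee_fin sqr_ge0.
rewrite ge0_integral_sum //; last by move=> t u _; rewrite lee_fin sqr_ge0.
under eq_bigr do rewrite integral_child_term.
by rewrite sumEFin -EFinM lee_fin; apply: sum_child_terms.
Qed.

(** There are [64 * 4 ^ j] displacements, each of length at most [4 * rho ell j] and with total
    energy at most [Y]; the normalisation [4 ^- j * 4 ^- j.+1] turns this count into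
    [16 * 4 ^- j]. *)
Lemma sum_cellV j (Y : R) :
  (forall w, nm w <= 4 * rho ell j ->
     \sum_(n1 < 4 ^ j) \sum_(n2 < 4 ^ j) En ell L j w (lpt z0 (kap ell j) n1%:Z n2%:Z) <= Y) ->
  \sum_(i1 < 2 ^ j) \sum_(i2 < 2 ^ j) cellV j (val i1, val i2) <= 16 * 4 ^- j * Y.
Proof.
move=> HY; set al : R := 4 ^- j * 4 ^- j.+1.
have al0 : 0 <= al by rewrite mulr_ge0 ?invr_ge0 ?exprn_ge0.
pose A := (2 ^ j)%N.
have AA : (A * A = 4 ^ j)%N by rewrite /A -expnMn.
have E : \sum_(i1 < 2 ^ j) \sum_(i2 < 2 ^ j) cellV j (val i1, val i2) =
  al * \sum_(i1 < A) \sum_(m1 < A) \sum_(k1 < 4 * A)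
       \sum_(i2 < A) \sum_(m2 < A) \sum_(k2 < 4 * A)
       cellEn j (A * i1 + m1) (A * i2 + m2) (k1%:Z - (4 * m1)%N%:Z) (k2%:Z - (4 * m2)%N%:Z).
  rewrite /cellV; under eq_bigr do rewrite -mulr_sumr.
  rewrite -mulr_sumr; congr (_ * _); apply: eq_bigr => i1 _.
  rewrite exchange_big; apply: eq_bigr => m1 _; rewrite exchange_big; apply: eq_bigr => k1 _.
  exact: eq_bigr.
rewrite E.
apply: le_trans (_ : al * \sum_(n1 < A * A) \sum_(d1 < 8 * A) \sum_(n2 < A * A) \sum_(d2 < 8 * A)
   cellEn j n1 n2 (d1%:Z - (4 * A)%N%:Z) (d2%:Z - (4 * A)%N%:Z) <= _).
  apply: ler_wpM2l => //.
  apply: le_trans (@sum_pairs_window R A (fun n1 d1 => \sum_(i2 < A) \sum_(m2 < A) \sum_(k2 < 4 * A)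
       cellEn j n1 (A * i2 + m2) d1 (k2%:Z - (4 * m2)%N%:Z)) _) _.
    by move=> n d; do 3!(apply: sumr_ge0 => ? _); exact: cellEn_ge0.
  apply: ler_sum => n1 _; apply: ler_sum => d1 _.
  by apply: (@sum_pairs_window R A (fun n2 d2 => cellEn j n1 n2 (d1%:Z - (4 * A)%N%:Z) d2)) => *;
    exact: cellEn_ge0.
have -> : \sum_(n1 < A * A) \sum_(d1 < 8 * A) \sum_(n2 < A * A) \sum_(d2 < 8 * A)
   cellEn j n1 n2 (d1%:Z - (4 * A)%N%:Z) (d2%:Z - (4 * A)%N%:Z) =
  \sum_(d1 < 8 * A) \sum_(d2 < 8 * A) \sum_(n1 < A * A) \sum_(n2 < A * A)
   cellEn j n1 n2 (d1%:Z - (4 * A)%N%:Z) (d2%:Z - (4 * A)%N%:Z).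
  rewrite exchange_big; apply: eq_bigr => d1 _ /=.
  by under eq_bigr do rewrite exchange_big; rewrite exchange_big.
rewrite AA.
apply: le_trans (_ : al * \sum_(d1 < 8 * A) \sum_(d2 < 8 * A) Y <= _).
  apply: ler_wpM2l => //; apply: ler_sum => d1 _; apply: ler_sum => d2 _.
  apply: HY; apply: le_trans (nm_le_ReIm _) _; rewrite /lpt /= !add0r.
  have W (d : 'I_(8 * A)) : `|kap ell j.+1 * (d%:Z - (4 * A)%N%:Z)%:~R| <= rho ell j.
    rewrite normrM (gtr0_norm (kap_gt0 ell0 j.+1)).
    have : `|(d%:Z - (4 * A)%N%:Z)%:~R : R| <= 4 * 2 ^+ j.
      rewrite -intr_norm -natrX -natrM -/A pmulrn ler_int.
      by have := ltn_ord d; lia.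
    move=> h; apply: le_trans (ler_wpM2l (ltW (kap_gt0 ell0 j.+1)) h) _.
    have -> : rho ell j = kap ell j.+1 * (4 * 2 ^+ j); last by [].
    rewrite /rho /kap exprS (_ : 4 ^+ j = 2 ^+ j * 2 ^+ j :> R); last first.
      by rewrite -exprMn; congr (_ ^+ _); rewrite -natrM.
    by field; rewrite expf_neq0.
  by apply: le_trans (lerD (W d1) (W d2)) _; have := rho_gt0 ell0 j; lra.
rewrite !sumr_const !card_ord -mulrnA -[X in al * X]mulr_natl mulrA /al.
rewrite le_eqVlt; apply/orP; left; apply/eqP; congr (_ * _).
rewrite (_ : (8 * A * (8 * A) = 64 * 4 ^ j)%N); last by rewrite -AA; lia.
by rewrite natrM natrX exprS; field; rewrite expf_neq0.
Qed.

End Cells.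

(** * The law of the random series *)

Section SeriesSum.
Variable R : realType.
Local Notation nm := (@Normc.normc R).
Local Notation cpoly := (map_poly (real_complex R)).

Definition toP (z : R[i]) : R * R := (Re z, Im z).

Lemma cabs_toP z : cabs (toP z) = nm z.
Proof. by case: z. Qed.

Lemma cpow_toP z k : cpow (toP z) k = toP (z ^+ k).
Proof.
elim: k => [|k IH]; first by rewrite expr0.
by rewrite /cpow iterS -/(cpow _ k) IH exprS; case: z {IH} => a b; case: (_ ^+ k) => c d.
Qed.

Lemma spt_sum n (s : nat -> bool) (z : R[i]) :
  spt n s z = \sum_(k < n) ((sgn R (s k))%:C)%C * z ^+ k.
Proof.
rewrite /spt /spoly poly_def rmorph_sum /= horner_sum; apply: eq_bigr => k _.
by rewrite map_polyZ map_polyXn hornerZ hornerXn.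
Qed.

Lemma psum_toP z s n : psum (toP z) s n = toP (spt n s z).
Proof.
have toPD u v : toP (u + v) = Defs.cadd (toP u) (toP v) by case: u => ? ?; case: v => ? ?.
rewrite spt_sum /psum -(big_mkord xpredT (fun k => ((sgn R (s k))%:C)%C * z ^+ k)) /index_iota subn0.
elim: (iota 0 n) => [|k l IH]; first by rewrite big_nil.
rewrite big_cons /= toPD IH cpow_toP; congr Defs.cadd.
by rewrite /Defs.cscale /toP; case: (z ^+ k) => c d /=; rewrite !mul0r subr0 addr0.
Qed.

Variables (z : R[i]) (q : R).
Hypotheses (q01 : 0 < q < 1) (zq : nm z <= q).
Implicit Types (s : nat -> bool).

Let q01' : 0 <= q < 1. Proof. by case/andP: q01 => /ltW -> ->. Qed.

Lemma spt_cauchy s N M : (N <= M)%N -> nm (spt N s z - spt M s z) <= 2 / (1 - q) * q ^+ N.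
Proof.
move=> NM; rewrite spt_tail // nmN nmM nmX mulrC; apply: ler_pM; rewrite ?exprn_ge0 ?nm_ge0 //.
  by apply: (cpoly_bound q01') => // k; rewrite coef_drop_poly spoly_le2.
by rewrite lerXn2r ?nnegrE ?nm_ge0 //; case/andP: q01'.
Qed.

Let b0 : 0 <= 2 / (1 - q).
Proof. by rewrite divr_ge0 // subr_ge0; case/andP: q01' => _ /ltW. Qed.

Let coord_cvg (f : R[i] -> R) : (forall u v, f (u - v) = f u - f v) -> (forall u, `|f u| <= nm u) ->
  forall s, cvgn (fun n => f (spt n s z)).
Proof.
move=> fB fl s.
have [] := @fast_cvg R (fun n => f (spt n s z)) (2 / (1 - q)) q q01 b0 _ => // j.
by rewrite distrC -fB; apply: le_trans (fl _) _; exact: spt_cauchy.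
Qed.

Let coord_lim (f : R[i] -> R) : (forall u v, f (u - v) = f u - f v) -> (forall u, `|f u| <= nm u) ->
  forall s N, `|f (spt N s z) - limn (fun n => f (spt n s z))| <= 2 / (1 - q) * q ^+ N.
Proof.
move=> fB fl s N; have c : cvgn (fun n => f (spt n s z)) by exact: (@coord_cvg f fB fl s).
have H M : (N <= M)%N -> `|f (spt N s z) - f (spt M s z)| <= 2 / (1 - q) * q ^+ N.
  by move=> NM; rewrite -fB; apply: le_trans (fl _) _; exact: spt_cauchy.
rewrite ler_norml; apply/andP; split.
  rewrite lerBrDl lerBlDr; apply: limr_le => //; exists N => // M /= /H.
  by rewrite ler_norml => /andP[h1 h2]; lra.
rewrite lerBlDr -lerBlDl; apply: limr_ge => //; exists N => // M /= /H.
by rewrite ler_norml => /andP[h1 h2]; lra.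
Qed.

Let ReB (u v : R[i]) : Re (u - v) = Re u - Re v. Proof. by case: u => ? ?; case: v. Qed.
Let ImB (u v : R[i]) : Im (u - v) = Im u - Im v. Proof. by case: u => ? ?; case: v. Qed.

Definition serX s : R * R := (limn (fun n => Re (spt n s z)), limn (fun n => Im (spt n s z))).

Lemma cvg_Re_spt s : (fun n => Re (spt n s z)) @ \oo --> (serX s).1.
Proof. rewrite /serX /=. exact: (@coord_cvg (@complex.Re R) ReB (@normRe_le R) s). Qed.

Lemma cvg_Im_spt s : (fun n => Im (spt n s z)) @ \oo --> (serX s).2.
Proof. rewrite /serX /=; exact: (@coord_cvg (@complex.Im R) ImB (@normIm_le R) s). Qed.

Lemma psum_cvg s : psum (toP z) s @ \oo --> serX s.
Proof.
rewrite (_ : psum (toP z) s = fun n => (Re (spt n s z), Im (spt n s z))).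
  exact: (cvg_pair (@cvg_Re_spt s) (@cvg_Im_spt s)).
by apply/funext => n; rewrite psum_toP.
Qed.

Lemma psum_cvgE s x : (psum (toP z) s @ \oo --> x) <-> x = serX s.
Proof.
split => [h|->]; last exact: psum_cvg.
exact: (@cvg_unique (R * R)%type (@norm_hausdorff R (R * R)%type) _ _ _ _ h (@psum_cvg s)).
Qed.

Lemma serX_tail s N :
  `|Re (spt N s z) - (serX s).1| <= 2 / (1 - q) * q ^+ N /\
  `|Im (spt N s z) - (serX s).2| <= 2 / (1 - q) * q ^+ N.
Proof. by split; [exact: (coord_lim ReB (@normRe_le R)) | exact: (coord_lim ImB (@normIm_le R))]. Qed.

End SeriesSum.

Section PhiIntegral.
Variable R : realType.

Lemma leb2_sq (rho : R) p : 0 < rho -> leb2 (sq rho p) = (rho ^+ 2)%:E.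
Proof.
move=> r0; rewrite -[sq rho p]setIid leb2_sqI // subrr; congr EFin.
rewrite /ker /tent /= !mul0r normr0 subr0 (max_idPr ler01) !mulr1.
by field; rewrite gt_eqF.
Qed.

Lemma integral_phi (rho : R) p (A : set (R * R)) :
  measurable (A : set (measurableTypeR R * measurableTypeR R)) ->
  (\int[@leb2 R]_(u in A) (phi rho p u)%:E = (rho ^- 2)%:E * leb2 (sq rho p `&` A))%E.
Proof.
move=> mA; under eq_integral do rewrite /phi EFinM.
have msq := measurable_sq rho p.
rewrite ge0_integralZl //; last 2 first.
- by apply/measurable_EFinP; apply: measurable_funTS; exact: measurable_indic.
- by rewrite lee_fin invr_ge0 sqr_ge0.
by rewrite integral_indic.
Qed.

Lemma integral_phi_le1 (rho : R) p (A : set (R * R)) : 0 < rho ->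
  measurable (A : set (measurableTypeR R * measurableTypeR R)) ->
  (\int[@leb2 R]_(u in A) (phi rho p u)%:E <= 1)%E.
Proof.
move=> r0 mA; rewrite integral_phi //.
apply: (@le_trans _ _ ((rho ^- 2)%:E * leb2 (sq rho p))%E).
  apply: lee_wpmul2l; first by rewrite lee_fin invr_ge0 sqr_ge0.
  by apply: le_measure; rewrite ?inE //; [apply: measurableI|]; try exact: measurable_sq.
by rewrite leb2_sq // -EFinM mulVf // expf_neq0 // gt_eqF.
Qed.

Lemma integral_phi_in (rho : R) p (A : set (R * R)) : 0 < rho ->
  measurable (A : set (measurableTypeR R * measurableTypeR R)) ->
  sq rho p `<=` A -> (\int[@leb2 R]_(u in A) (phi rho p u)%:E = 1)%E.
Proof.
move=> r0 mA sA; rewrite integral_phi // (setIidl sA) leb2_sq // -EFinM mulVf //.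
by rewrite expf_neq0 // gt_eqF.
Qed.

Lemma integral_phi_out (rho : R) p (A : set (R * R)) :
  measurable (A : set (measurableTypeR R * measurableTypeR R)) ->
  sq rho p `&` A = set0 -> (\int[@leb2 R]_(u in A) (phi rho p u)%:E = 0)%E.
Proof. by move=> mA sA; rewrite integral_phi // sA measure0 mule0. Qed.

End PhiIntegral.

Section Signs.
Variables (R : realType) (d : measure_display) (Omega : measurableType d)
  (P : probability Omega R) (eps : nat -> Omega -> bool).
Hypothesis fair : fair_indep_signs P eps.
Local Notation nm := (@Normc.normc R).
Local Notation RR := (measurableTypeR R * measurableTypeR R)%type.

Definition cyl N (a : N.-tuple bool) : set Omega :=
  [set w | forall n, n \in iota 0 N -> eps n w = nth false a n].

Lemma measurable_eps n b : measurable [set w | eps n w = b].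
Proof.
have m1 : measurable [set w | eps n w] by case: fair.
case: b; first exact: m1.
rewrite (_ : [set w | _] = ~` [set w | eps n w]); first exact: measurableC.
by apply/seteqP; split => w /=; case: (eps n w).
Qed.

Lemma measurable_cyl N a : measurable (@cyl N a).
Proof.
rewrite (_ : @cyl N a = \bigcap_(n in [set n | n \in iota 0 N]) [set w | eps n w = nth false a n]).
  by apply: bigcap_measurableType => n _; exact: measurable_eps.
by apply/seteqP; split => w.
Qed.

Lemma P_cyl N a : P (@cyl N a) = (2 ^- N)%:E.
Proof. by case: fair => _ /(_ (iota 0 N) (nth false a) (iota_uniq _ _)); rewrite size_iota. Qed.

Lemma cyl_nth N a w : @cyl N a w -> forall k, (k < N)%N -> nth false a k = eps k w.
Proof. by move=> h k kN; rewrite h // mem_iota. Qed.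

Lemma cyl_exists N w : exists a, @cyl N a w.
Proof.
exists [tuple of mkseq (fun k => eps k w) N] => n; rewrite mem_iota /= => nN.
by rewrite nth_mkseq.
Qed.

Lemma cyl_inj N a b w : @cyl N a w -> @cyl N b w -> a = b.
Proof.
move=> ha hb; apply: eq_from_tnth => k; rewrite !(tnth_nth false).
by rewrite (cyl_nth ha) // (cyl_nth hb).
Qed.

Lemma P_split N (B : set Omega) : measurable B ->
  P B = (\sum_(a : N.-tuple bool) P (B `&` cyl a))%E.
Proof.
move=> mB.
have mBa (a : N.-tuple bool) : measurable (B `&` cyl a).
  by apply: measurableI => //; exact: measurable_cyl.
have Pf (A : set Omega) : (P A < +oo)%E -> P A = (fine (P A))%:E.
  by move=> h; rewrite fineK // ge0_fin_numE.
have Poo (A : set Omega) : measurable A -> (P A < +oo)%E.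
  by move=> mA; apply: le_lt_trans (probability_le1 P mA) _; rewrite ltry.
have := @integral_lin_indic R d Omega P _ (fun _ => 1) (fun a : N.-tuple bool => B `&` cyl a)
   mBa (fun a => Poo _ (mBa a)).
have -> : (fun x => (\sum_(a : N.-tuple bool) 1 * \1_(B `&` cyl a) x)%:E) = (fun x => (\1_B x)%:E : \bar R).
  apply/funext => w; congr EFin; have [a ha] := cyl_exists N w.
  rewrite (bigD1 a) //= big1 ?addr0 ?mul1r => [|b ba].
    by rewrite !indicE; congr ((nat_of_bool _)%:R); apply/idP/idP => /set_mem h; apply: mem_set;
      [case: h | split].
  rewrite mul1r indicE memNset // => -[_ hb]; move/eqP: ba; apply.
  exact: cyl_inj hb ha.
rewrite integral_indic // setIT => ->; rewrite -sumEFin; apply: eq_bigr => a _.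
by rewrite mul1r -Pf // Poo.
Qed.

Variables (z : R[i]) (q : R).
Hypotheses (q01 : 0 < q < 1) (zq : nm z <= q).

Definition serRV (w : Omega) : RR := serX z (fun n => eps n w).

Let measurable_term (f : R[i] -> R) : (forall u v, f (u + v) = f u + f v) -> f 0 = 0 ->
  (forall (c : R) u, f ((c%:C)%C * u) = c * f u) ->
  forall n, measurable_fun setT (fun w => f (spt n (fun n => eps n w) z)).
Proof.
move=> fD f0 fZ n.
rewrite (_ : (fun w => _) = fun w => \sum_(k < n) sgn R (eps k w) * f (z ^+ k)); last first.
  apply/funext => w; rewrite spt_sum.
  by rewrite (big_morph f fD f0); apply: eq_bigr => k _; rewrite fZ.
apply: measurable_sum => k; apply: measurable_funM => //.
rewrite (_ : (fun w => _) = fun w => 2 * \1_[set w | eps k w = true] w - 1).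
  apply: measurable_funB => //; apply: measurable_funM => //.
  by apply: measurable_indic; exact: measurable_eps.
apply/funext => w; rewrite indicE /sgn; case E: (eps k w).
  by rewrite mem_set // mulr1; ring.
by rewrite memNset /= ?E // mulr0 sub0r.
Qed.

Lemma measurable_serRV : measurable_fun setT serRV.
Proof.
apply/measurable_fun_pairP; split.
  apply: (measurable_fun_cvg (h := fun n w => Re (spt n (fun n => eps n w) z))).
    apply: measurable_term => [[? ?] [? ?]||c [? ?]] //=.
    by rewrite mul0r subr0.
  by move=> w _; apply: (cvg_Re_spt q01 zq).
apply: (measurable_fun_cvg (h := fun n w => Im (spt n (fun n => eps n w) z))).
  apply: measurable_term => [[? ?] [? ?]||c [? ?]] //=.
  by rewrite mul0r addr0.
by move=> w _; apply: (cvg_Im_spt q01 zq).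
Qed.

Definition serLaw : {measure set RR -> \bar R} :=
  measure_function_pushforward__canonical__measure_function_Measure P measurable_serRV.

Lemma serLawE A : serLaw A = P (serRV @^-1` A).
Proof. by []. Qed.

Lemma serLaw_setT : (serLaw setT < +oo)%E.
Proof. by rewrite serLawE preimage_setT probability_setT ltry. Qed.

Lemma nu_serLaw : nu P eps (toP z) = serLaw.
Proof.
apply/funext => A; rewrite serLawE /nu; congr (P _); apply/seteqP; split => w /=.
  by move=> [x [/(psum_cvgE q01 zq) -> ]].
by move=> h; exists (serRV w); split => //; apply/(psum_cvgE q01 zq).
Qed.

Section QuadrantBounds.
Variables (N : nat) (y : N.-tuple bool -> R[i]) (rho dl e : R).
Hypotheses (rho0 : 0 < rho) (ydl : forall a, nm (y a - xt a z) <= dl)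
  (dle : dl + 2 / (1 - q) * q ^+ N + rho <= e).

Let y_serRV a w : cyl a w -> [/\ Re (y a) - (serRV w).1 <= e - rho, (serRV w).1 - Re (y a) <= e - rho,
  Im (y a) - (serRV w).2 <= e - rho & (serRV w).2 - Im (y a) <= e - rho].
Proof.
move=> ha; have := serX_tail q01 zq (fun n => eps n w) N; rewrite -/(serRV w).
have -> : spt N (fun n => eps n w) z = xt a z by apply: spt_prefix => k kN; rewrite -(cyl_nth ha).
have h1 := le_trans (normRe_le (y a - xt a z)) (ydl a).
have h2 := le_trans (normIm_le (y a - xt a z)) (ydl a).
move: h1 h2 dle; rewrite (_ : Re (y a - xt a z) = Re (y a) - Re (xt a z)); last first.
  by case: (y a) => ? ?; case: (xt a z).
rewrite (_ : Im (y a - xt a z) = Im (y a) - Im (xt a z)); last first.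
  by case: (y a) => ? ?; case: (xt a z).
rewrite !ler_norml; move: (serRV w).1 (serRV w).2 (2 / (1 - q) * q ^+ N) => u v t.
move: (Re (y a)) (Re (xt a z)) (Im (y a)) (Im (xt a z)) => a1 a2 a3 a4.
by clear; move=> /andP[? ?] /andP[? ?] ? [/andP[? ?] /andP[? ?]]; split; lra.
Qed.

Let measurable_pre x1 x2 : measurable (serRV @^-1` quad x1 x2).
Proof.
rewrite -[X in measurable X]setTI; apply: measurable_serRV => //; exact: measurable_quad.
Qed.

Let e2N : (0 <= (2 ^- N : R)%:E)%E. Proof. by rewrite lee_fin invr_ge0 exprn_ge0. Qed.

Let int_ge0 A (a : N.-tuple bool) : (0 <= \int[@leb2 R]_(u in A) (phi rho (y a) u)%:E)%E.
Proof. by apply: integral_ge0 => u _; rewrite lee_fin phi_ge0. Qed.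

(** On the cylinder of a word, the sum of the series and all of the square at [y a] differ by at
    most [e] in each coordinate. So a cylinder that meets the smaller quadrant has its square inside
    the larger one, and both carry mass [2 ^- N]. *)
Lemma serLaw_quad_le x1 x2 : (serLaw (quad (x1 - e) (x2 - e)) <=
  (2 ^- N)%:E * \sum_(a : N.-tuple bool) \int[@leb2 R]_(u in quad x1 x2) (phi rho (y a) u)%:E)%E.
Proof.
rewrite serLawE (P_split N) // ge0_sume_distrr; last by move=> a _; exact: int_ge0.
apply: lee_sum => a _; have [[w [hw ha]]|no] := pselect (exists w, (serRV @^-1` quad (x1 - e) (x2 - e) `&` cyl a) w).
  rewrite integral_phi_in //; last 2 first.
  - exact: measurable_quad.
  - move=> u; move: hw (y_serRV ha); rewrite /sq /quad /= !in_itv /=.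
    move: (serRV w).1 (serRV w).2 (Re (y a)) (Im (y a)) => ? ? ? ?.
    by clear; move=> -[? ?] [? ? ? ?] [/andP[? ?] /andP[? ?]]; split; lra.
  rewrite mule1 -(P_cyl a); apply: le_measure; rewrite ?inE //.
  + by apply: measurableI => //; exact: measurable_cyl.
  + exact: measurable_cyl.
rewrite (_ : _ `&` _ = set0) ?measure0 ?mule_ge0 //.
by apply/seteqP; split => // w hw; apply: no; exists w.
Qed.

(** Conversely, a square that meets the smaller quadrant forces its whole cylinder into the larger
    one. *)
Lemma serLaw_quad_ge x1 x2 :
  ((2 ^- N)%:E * \sum_(a : N.-tuple bool) \int[@leb2 R]_(u in quad (x1 - e) (x2 - e)) (phi rho (y a) u)%:E
   <= serLaw (quad x1 x2))%E.
Proof.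
rewrite serLawE (P_split N) // ge0_sume_distrr; last by move=> a _; exact: int_ge0.
apply: lee_sum => a _; have [no|/set0P[u hu]] := eqVneq (sq rho (y a) `&` quad (x1 - e) (x2 - e)) set0.
  by rewrite integral_phi_out ?mule0 //; exact: measurable_quad.
rewrite (setIidr _); last first.
  move=> w ha; move: hu (y_serRV ha) rho0; rewrite /sq /quad /= !in_itv /=.
  move: (serRV w).1 (serRV w).2 (Re (y a)) (Im (y a)) => ? ? ? ?.
  by clear; move=> -[[/andP[? ?] /andP[? ?]] [? ?]] [? ? ? ?] ?; split; lra.
rewrite P_cyl -[leRHS]mule1; apply: lee_wpmul2l => //.
by apply: integral_phi_le1 => //; exact: measurable_quad.
Qed.

End QuadrantBounds.

End Signs.

(** * The dyadic cells that contain a given parameter *)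

Section DyadicIndex.
Variables (R : realType) (ell : R).
Hypothesis ell0 : 0 < ell.

Definition idx1 (j : nat) (x : R) : nat := Num.truncn (x / rho ell j).

Lemma idx1_itv j x : 0 <= x -> rho ell j * (idx1 j x)%:R <= x < rho ell j * (idx1 j x).+1%:R.
Proof.
move=> x0; have r0 := rho_gt0 ell0 j.
have : 0 <= x / rho ell j by rewrite divr_ge0 // ltW.
by move=> /truncn_itv; rewrite ler_pdivlMr // ltr_pdivrMr // !(mulrC _ (rho ell j)).
Qed.

Lemma idx1_lt j x : 0 <= x < ell -> (idx1 j x < 2 ^ j)%N.
Proof.
move=> /andP[x0 xl]; have /andP[h _] := idx1_itv j x0.
rewrite -(ltr_nat R) natrX -(ltr_pM2l (rho_gt0 ell0 j)); apply: le_lt_trans h _.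
by rewrite /rho divfK // expf_neq0.
Qed.

Lemma idx1S j x : 0 <= x -> exists2 c, (c < 2)%N & idx1 j.+1 x = (2 * idx1 j x + c)%N.
Proof.
move=> x0; have r0 := rho_gt0 ell0 j.+1.
have /andP[h1 h2] := idx1_itv j x0; have /andP[h3 h4] := idx1_itv j.+1 x0.
have E (r a : R) : 2 * r * a = r * (2 * a) by ring.
move: h1 h2; rewrite (rhoS ell j) !E => h1 h2.
have := le_lt_trans h1 h4; have := le_lt_trans h3 h2.
rewrite !ltr_pM2l // -!natrM !ltr_nat => g1 g2.
by exists (idx1 j.+1 x - 2 * idx1 j x)%N; lia.
Qed.

End DyadicIndex.

Section FbarIntegrals.
Variables (R : realType) (z0 : R[i]) (ell : R) (L : nat).
Local Notation nm := (@Normc.normc R).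
Local Notation RR := (measurableTypeR R * measurableTypeR R)%type.
Variables (j : nat) (i : nat * nat).

Let pt (m : 'I_(2 ^ j) * 'I_(2 ^ j)) := cpt z0 ell j i (val m.1, val m.2).

Lemma Fbar_sumE u : Fbar z0 ell L j i u =
  \sum_(t : ('I_(2 ^ j) * 'I_(2 ^ j)) * (Nd L j).-tuple bool)
    (4 ^- j * 2 ^- Nd L j) * phi (rho ell j) (xt t.2 (pt t.1)) u.
Proof.
rewrite -(pair_bigA _ (fun m a => (4 ^- j * 2 ^- Nd L j) * phi (rho ell j) (xt a (pt m)) u)) /=.
rewrite /Fbar mulr_sumr; apply: eq_bigr => m _; rewrite /fj mulrA mulr_sumr.
by [].
Qed.

Lemma integral_Fbar (A : set (R * R)) : measurable (A : set RR) ->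
  (\int[@leb2 R]_(u in A) (Fbar z0 ell L j i u)%:E =
   \sum_(m : 'I_(2 ^ j) * 'I_(2 ^ j)) (4 ^- j)%:E * ((2 ^- Nd L j)%:E *
     \sum_(a : (Nd L j).-tuple bool) \int[@leb2 R]_(u in A) (phi (rho ell j) (xt a (pt m)) u)%:E))%E.
Proof.
move=> mA; rewrite /Fbar.
under eq_integral do rewrite EFinM.
have mf y : measurable_fun (A : set RR) (fun u : RR => (fj ell L j y u)%:E).
  by apply/measurable_EFinP; apply: measurable_funTS; exact: measurable_fj.
have f0 y u : (0 <= (fj ell L j y u)%:E)%E by rewrite lee_fin fj_ge0.
rewrite ge0_integralZl //; last 2 first.
- apply/measurable_EFinP; apply: measurable_funTS; apply: measurable_sum => m; exact: measurable_fj.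
- by move=> u _; rewrite lee_fin sumr_ge0 // => m _; exact: fj_ge0.
under eq_integral do rewrite -sumEFin.
rewrite ge0_integral_sum // ge0_sume_distrr; last by move=> m _; apply: integral_ge0.
apply: eq_bigr => m _; congr (_ * _)%E; rewrite /fj.
under eq_integral do rewrite EFinM.
have mphi y : measurable_fun (A : set RR) (fun u : RR => (phi (rho ell j) y u)%:E).
  by apply/measurable_EFinP; apply: measurable_funTS; exact: measurable_phi.
rewrite ge0_integralZl //; last 2 first.
- apply/measurable_EFinP; apply: measurable_funTS; apply: measurable_sum => a; exact: measurable_phi.
- by move=> u _; rewrite lee_fin sumr_ge0 // => a _; exact: phi_ge0.
congr (_ * _)%E; under eq_integral do rewrite -sumEFin.
by rewrite ge0_integral_sum // => a u _; rewrite lee_fin phi_ge0.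
Qed.

Lemma integral_Fbar_sqr : 0 < ell -> (\int[@leb2 R]_u ((Fbar z0 ell L j i u) ^+ 2)%:E < +oo)%E.
Proof.
move=> ell0; under eq_integral do rewrite Fbar_sumE.
by rewrite integral_sqr_phi ?ltry // rho_gt0.
Qed.

Lemma Fbar_neq0 u : Fbar z0 ell L j i u != 0 ->
  exists m, exists a : (Nd L j).-tuple bool, sq (rho ell j) (xt a (pt m)) u.
Proof.
apply: contra_neqP => no; rewrite Fbar_sumE big1 // => -[m a] _ /=.
rewrite /phi indicE memNset ?mulr0 // => h; apply: no; by exists m, a.
Qed.

Lemma sum_avg_const (c : R) : \sum_(m : 'I_(2 ^ j) * 'I_(2 ^ j)) 4 ^- j * c = c.
Proof.
by rewrite sumr_const card_prod card_ord -expnMn -[LHS]mulr_natl natrX mulVKf ?expf_neq0.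
Qed.

End FbarIntegrals.

Section GoodPoint.
Variables (R : realType) (d : measure_display) (Omega : measurableType d)
  (P : probability Omega R) (eps : nat -> Omega -> bool).
Hypothesis fair : fair_indep_signs P eps.
Local Notation nm := (@Normc.normc R).
Variables (z0 z : R[i]) (ell q : R) (L : nat).
Hypotheses (ell0 : 0 < ell) (q01 : 0 < q < 1) (qL : q ^+ L <= 1/4).
Hypotheses (zRe : 0 <= Re z - Re z0 < ell) (zIm : 0 <= Im z - Im z0 < ell).
Hypothesis qz : forall y : R[i], `|Re y - Re z0| <= 2 * ell -> `|Im y - Im z0| <= 2 * ell -> nm y <= q.

Definition cell_idx j : nat * nat := (idx1 ell j (Re z - Re z0), idx1 ell j (Im z - Im z0)).

Lemma cell_idxS j : exists2 c, (c.1 < 2)%N /\ (c.2 < 2)%N &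
  cell_idx j.+1 = (2 * (cell_idx j).1 + c.1, 2 * (cell_idx j).2 + c.2)%N.
Proof.
have [/andP[h1 _] /andP[h2 _]] := (zRe, zIm).
have [c1 c12 e1] := idx1S ell0 j h1; have [c2 c22 e2] := idx1S ell0 j h2.
by exists (c1, c2); rewrite // /cell_idx e1 e2.
Qed.

Let pt j (m : 'I_(2 ^ j) * 'I_(2 ^ j)) := cpt z0 ell j (cell_idx j) (val m.1, val m.2).

Let pt_coord j x (m : 'I_(2 ^ j)) : 0 <= x ->
  - rho ell j <= kap ell j * (2 ^ j * idx1 ell j x + m)%N%:R - x <= rho ell j /\
  0 <= kap ell j * (2 ^ j * idx1 ell j x + m)%N%:R.
Proof.
move=> x0; have r0 := rho_gt0 ell0 j; have k0 := kap_gt0 ell0 j.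
have /andP[h1 h2] := idx1_itv ell0 j x0.
have E : kap ell j * (2 ^ j)%:R = rho ell j.
  rewrite /kap /rho natrX (_ : 4 ^+ j = 2 ^+ j * 2 ^+ j :> R); last first.
    by rewrite -exprMn; congr (_ ^+ _); rewrite -natrM.
  by field; rewrite expf_neq0.
have m0 : 0 <= kap ell j * m%:R by rewrite mulr_ge0 // ltW.
have m1 : kap ell j * m%:R <= rho ell j by rewrite -E ler_wpM2l ?(ltW k0) // ler_nat ltnW.
have i0 : 0 <= rho ell j * (idx1 ell j x)%:R by rewrite mulr_ge0 // ltW.
rewrite natrD natrM mulrDr mulrA E.
move: h2; rewrite -natr1 mulrDr mulr1.
move: m0 m1 h1 i0; move: (kap ell j * m%:R) (rho ell j * (idx1 ell j x)%:R) => a b.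
move: (rho ell j) => r.
by move=> ? ? ? ? ?; split; [apply/andP; split; lra | lra].
Qed.

Let pt_near j m : nm (pt (j := j) m - z) <= 2 * rho ell j.
Proof.
have [/andP[h1 _] /andP[h2 _]] := (zRe, zIm).
have [g1 _] := pt_coord m.1 h1; have [g2 _] := pt_coord m.2 h2.
apply: le_trans (nm_le_ReIm _) _.
have -> : Re (pt m - z) = kap ell j * (2 ^ j * idx1 ell j (Re z - Re z0) + m.1)%N%:R - (Re z - Re z0).
  by rewrite /pt /cpt /lpt /cell_idx /=; case: (z0) (z) => ? ? [? ?] /=; rewrite -pmulrn; ring.
have -> : Im (pt m - z) = kap ell j * (2 ^ j * idx1 ell j (Im z - Im z0) + m.2)%N%:R - (Im z - Im z0).
  by rewrite /pt /cpt /lpt /cell_idx /=; case: (z0) (z) => ? ? [? ?] /=; rewrite -pmulrn; ring.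
by move: g1 g2; rewrite -!ler_norml (mulr_natl _ 2) mulr2n; apply: lerD.
Qed.

Let pt_le j m : nm (pt (j := j) m) <= q.
Proof.
have [/andP[h1 h1'] /andP[h2 h2']] := (zRe, zIm).
have [/andP[_ g1] g1'] := pt_coord m.1 h1; have [/andP[_ g2] g2'] := pt_coord m.2 h2.
have rl := rho_le j ell0.
apply: qz; rewrite /pt /cpt /lpt /cell_idx /=; move: h1' h2' g1 g1' g2 g2'; case: (z0) (z) => a b [a' b'] /=; rewrite -pmulrn.
  rewrite (addrAC a) subrr add0r; move: (kap ell j * _) (rho ell j) rl => ? ?.
  by move=> ? ? ? ? ? ? ?; rewrite ler_norml; apply/andP; split; lra.
rewrite (addrAC b) subrr add0r; move: (kap ell j * _) (kap ell j * _) (rho ell j) rl => ? ? ?.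
by move=> ? ? ? ? ? ? ?; rewrite ler_norml; apply/andP; split; lra.
Qed.

Let dl j := 2 / (1 - q) ^+ 2 * (2 * rho ell j).

Let q01' : 0 <= q < 1. Proof. by case/andP: q01 => /ltW -> ->. Qed.
Let q1 : 0 < 1 - q. Proof. by rewrite subr_gt0; case/andP: q01. Qed.

Let zq : nm z <= q.
Proof.
have [/andP[h1 h1'] /andP[h2 h2']] := (zRe, zIm).
have l2 : ell <= 2 * ell by rewrite mulr_natl mulr2n lerDl ltW.
by apply: qz; rewrite ger0_norm //; apply: le_trans l2; apply: ltW.
Qed.

Let pt_xt j m (a : (Nd L j).-tuple bool) : nm (xt a (pt (j := j) m) - xt a z) <= dl j.
Proof.
apply: le_trans (cpoly_lip q01' (spoly_le2 R _ _) zq (pt_le m)) _.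
apply: ler_wpM2l; last exact: pt_near.
by rewrite divr_ge0 // exprn_ge0 // ltW.
Qed.

Let dl_small e : 0 < e -> \forall j \near \oo, dl j + 2 / (1 - q) * q ^+ Nd L j + rho ell j <= e.
Proof.
move=> e0; pose K := 2 / (1 - q) ^+ 2 * (2 * ell) + 2 / (1 - q) + ell.
have K0 : 0 < K.
  have A0 : 0 <= 2 / (1 - q) ^+ 2 * (2 * ell) by rewrite mulr_ge0 ?divr_ge0 ?exprn_ge0 ?mulr_ge0 ?(ltW ell0) ?(ltW q1).
  have B0 : 0 <= 2 / (1 - q) by rewrite divr_ge0 // ltW.
  by rewrite /K; apply: lt_le_trans ell0 _; rewrite lerDr addr_ge0.
have [j0 H] := exists_pow2_le (divr_gt0 e0 K0).
exists j0 => // j /= /H h; apply: le_trans (_ : K * 2 ^- j <= _); last first.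
  by rewrite mulrC -ler_pdivlMr.
have -> : K * 2 ^- j = dl j + 2 / (1 - q) * 2 ^- j + rho ell j.
  by rewrite /K /dl /rho; ring.
rewrite lerD2r lerD2l ler_wpM2l //; first by rewrite divr_ge0 // ltW.
by apply: expN_decay2 => //; case/andP: q01'.
Qed.

Variables (J : nat) (ze : R).
Hypotheses (ze01 : 0 < ze < 1).
Hypothesis good : forall j, (J <= j)%N -> cellV z0 ell L j (cell_idx j) <= (ze ^+ 4) ^+ j.

(** The averages over the cells containing [z] satisfy, from level [J] on, the geometric decay of
    the L2 criterion. These cells shrink to [z], so their partial sums are within [dl j] of those at
    [z], and the averages squeeze the law of the series on quadrants. *)
Lemma good_point_density : has_L2_density (nu P eps (toP z)).
Proof.
rewrite (nu_serLaw fair q01 zq).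
pose F n u := Fbar z0 ell L (J + n) (cell_idx (J + n)) u.
have near_shift (Q : nat -> Prop) : (\forall j \near \oo, Q j) -> \forall n \near \oo, Q (J + n)%N.
  by move=> [j0 _ H]; exists j0 => // n /= jn; apply: H => /=; rewrite (leq_trans jn) // leq_addl.
have mq x y : measurable (quad x y : set (measurableTypeR R * measurableTypeR R)) by exact: measurable_quad.
have finE (A : set (R * R)) : measurable (A : set (measurableTypeR R * measurableTypeR R)) ->
    serLaw fair q01 zq A = (fine (serLaw fair q01 zq A))%:E.
  move=> mA; rewrite fineK // ge0_fin_numE //; apply: le_lt_trans (serLaw_setT fair q01 zq).
  by apply: le_measure; rewrite ?inE.
apply: (@L2_density_criterion R F (serLaw fair q01 zq) ((ze ^+ 4) ^+ J) ze (2 / (1 - q) + ell)).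
- by move=> n; exact: measurable_Fbar.
- by move=> n u; exact: Fbar_ge0.
- exact: ze01.
- by rewrite !exprn_ge0 //; case/andP: ze01 => /ltW.
- move=> n; rewrite -exprD; apply: le_trans (_ : _ <= (cellV z0 ell L (J + n) (cell_idx (J + n)))%:E)%E _; last first.
    by rewrite lee_fin good // leq_addr.
  rewrite /F addnS; have [c [c1 c2] ->] := cell_idxS (J + n).
  under eq_integral do rewrite -sqrrN opprB.
  exact: integral_Fbar_diff.
- exact: integral_Fbar_sqr.
- move=> n u /Fbar_neq0[m [a]].
  have ha : nm (xt a (pt m)) <= 2 / (1 - q) := cpoly_bound q01' (spoly_le2 R _ _) (pt_le m).
  have := le_trans (normRe_le _) ha; have := le_trans (normIm_le _) ha.
  have := rho_le (J + n) ell0.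
  rewrite -/(pt m) /sq /= !in_itv /=; move: (xt a (pt m)) => [x y] /=.
  move: (2 / (1 - q)) (rho ell (J + n)) => b r; rewrite !ler_norml.
  by move=> ? /andP[? ?] /andP[? ?] [/andP[? ?] /andP[? ?]]; split; apply/andP; split; lra.
- exact: serLaw_setT.
- move=> x y e e0; apply: filterS (near_shift _ (dl_small e0)) => n hn.
  rewrite integral_Fbar //.
  apply: (@le_trans _ _ (\sum_(m : 'I_(2 ^ (J + n)) * 'I_(2 ^ (J + n))) (4 ^- (J + n))%:E * serLaw fair q01 zq (quad (x - e) (y - e)))%E).
    by rewrite finE //; under eq_bigr do rewrite -EFinM; rewrite sumEFin sum_avg_const.
  apply: lee_sum => m _; apply: lee_wpmul2l; first by rewrite lee_fin invr_ge0 exprn_ge0.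
  by apply: (serLaw_quad_le fair q01 zq (rho_gt0 ell0 (J + n)) (pt_xt m) hn).
move=> x y e e0; apply: filterS (near_shift _ (dl_small e0)) => n hn.
rewrite integral_Fbar //.
apply: (@le_trans _ _ (\sum_(m : 'I_(2 ^ (J + n)) * 'I_(2 ^ (J + n))) (4 ^- (J + n))%:E * serLaw fair q01 zq (quad x y))%E); last first.
  by rewrite finE //; under eq_bigr do rewrite -EFinM; rewrite sumEFin sum_avg_const.
apply: lee_sum => m _; apply: lee_wpmul2l; first by rewrite lee_fin invr_ge0 exprn_ge0.
by apply: (serLaw_quad_ge fair q01 zq (rho_gt0 ell0 (J + n)) (pt_xt m) hn).
Qed.

End GoodPoint.

(** * Hausdorff null sets *)

Section HausdorffNull.
Variable R : realType.
Implicit Types (E : set (R * R)) (U : nat -> set (R * R)) (t : R).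

Lemma hcontrib_ge0 t (U : set (R * R)) : (0 <= hcontrib t U)%E.
Proof. by rewrite /hcontrib; case: ifP => // _; rewrite lee_fin powR_ge0. Qed.

Lemma hcontrib0 t : hcontrib t (set0 : set (R * R)) = 0%E.
Proof. by rewrite /hcontrib eqxx. Qed.

Lemma diam_ge0 (U : set (R * R)) : (0 <= diam U)%E.
Proof. by apply: ereal_sup_ubound; left. Qed.

Lemma diam_le (U : set (R * R)) (D : R) : 0 <= D ->
  (forall x y, U x -> U y -> cdist x y <= D) -> (diam U <= D%:E)%E.
Proof.
by move=> D0 h; apply: ge_ereal_sup => _ [->|[x Ux [y Uy <-]]]; rewrite lee_fin // h.
Qed.

Lemma diam_set0 : (diam (set0 : set (R * R)) = 0)%E.
Proof. by apply/eqP; rewrite eq_le diam_ge0 andbT; apply: diam_le. Qed.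

Lemma hcontrib_le t (U : set (R * R)) (D : R) : 0 <= t -> 0 <= D -> (diam U <= D%:E)%E ->
  (hcontrib t U <= (D `^ t)%:E)%E.
Proof.
move=> t0 D0 h; rewrite /hcontrib; case: ifP => _; first by rewrite lee_fin powR_ge0.
have fd : diam U \is a fin_num.
  by rewrite ge0_fin_numE ?diam_ge0 //; apply: le_lt_trans h _; rewrite ltry.
rewrite lee_fin ge0_ler_powR ?nnegrE //; last by rewrite -lee_fin fineK.
exact: fine_ge0 (diam_ge0 _).
Qed.

Definition fine_cover t E (dl eta : R) : Prop := exists U : nat -> set (R * R),
  [/\ E `<=` \bigcup_n U n, forall n, (diam (U n) <= dl%:E)%E &
      (\sum_(0 <= n <oo) hcontrib t (U n) <= eta%:E)%E].

Lemma hausdorff_nullP t E :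
  hausdorff_measure t E = 0%E <-> forall dl eta, 0 < dl -> 0 < eta -> fine_cover t E dl eta.
Proof.
have ge0 dl : (0 <= hausdorff_delta t dl E)%E.
  by apply: le_ereal_inf_tmp => _ [U _ <-]; apply: nneseries_ge0 => n _ _; exact: hcontrib_ge0.
split=> [h dl eta dl0 eta0|h].
  have : (hausdorff_delta t dl E < eta%:E)%E.
    apply: (@le_lt_trans _ _ 0%E); last by rewrite lte_fin.
    by rewrite -h; apply: ereal_sup_ubound; exists dl.
  by move=> /ereal_inf_lt[_ [U [cU dU] <-]] /ltW hU; exists U.
apply/eqP; rewrite eq_le; apply/andP; split; last first.
  by apply: le_trans (ge0 1) _; apply: ereal_sup_ubound; exists 1 => //=.
apply: ge_ereal_sup => _ [dl /= dl0 <-]; apply/lee_addgt0Pr => eta eta0; rewrite add0e.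
have [U [cU dU hU]] := h dl eta dl0 eta0; apply: le_trans hU.
by apply: ereal_inf_lbound; exists U.
Qed.

Lemma merge_sum (g : nat -> nat -> \bar R) (f : {bij [set: nat] >-> [set: nat * nat]}) :
  (forall k m, 0 <= g k m)%E ->
  (\sum_(0 <= n <oo) g (f n).1 (f n).2 = \sum_(0 <= k <oo) \sum_(0 <= m <oo) g k m)%E.
Proof.
move=> g0; rewrite nneseries_esumT // -(@reindex_esum R _ _ setT setT f (fun p => g p.1 p.2)); last first.
  exact: bij.
rewrite [RHS]nneseries_esumT; last by move=> k; exact: nneseries_ge0.
under [RHS]eq_esum do rewrite nneseries_esumT //.
by rewrite esum_esum //; congr esum; apply/seteqP; split => -[].
Qed.

(** The covers of all [E k] are listed as one sequence through a bijection of N with N x N;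
    nonnegative terms allow the rearrangement. *)
Lemma fine_cover_bigcup t (E : nat -> set (R * R)) (dl : R) (a : nat -> R) (eta : R) :
  (forall k, fine_cover t (E k) dl (a k)) -> (forall n, \sum_(0 <= k < n) a k <= eta) ->
  fine_cover t (\bigcup_k E k) dl eta.
Proof.
move=> /choice[U HU] ha.
have /card_esym/ppcard_eqP[f] := card_nat2.
exists (fun n => U (f n).1 (f n).2); split.
- move=> x [k _ Ekx]; have [cU _ _] := HU k; have [m _ Ux] := cU x Ekx.
  exists (f^-1%FUN (k, m)) => //=.
  by rewrite invK ?inE.
- by move=> n; have [_ dU _] := HU (f n).1.
rewrite (@merge_sum (fun k m => hcontrib t (U k m)) f) => [|*]; last exact: hcontrib_ge0.
apply: le_nneseries_bound => [k|n]; first by apply: nneseries_ge0 => *; exact: hcontrib_ge0.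
apply: le_trans (_ : _ <= \sum_(0 <= k < n) (a k)%:E)%E _; last by rewrite sumEFin lee_fin.
by apply: lee_sum => k _; have [] := HU k.
Qed.

Lemma hausdorff_null_bigcup t (E : nat -> set (R * R)) :
  (forall k, hausdorff_measure t (E k) = 0%E) -> hausdorff_measure t (\bigcup_k E k) = 0%E.
Proof.
move=> h; apply/hausdorff_nullP => dl eta dl0 eta0.
apply: (@fine_cover_bigcup t E dl (fun k => eta / 2 * 2^-1 ^+ k)).
  move=> k; have /hausdorff_nullP := h k; apply => //.
  by rewrite mulr_gt0 // ?divr_gt0 // exprn_gt0.
move=> n; apply: le_trans (le_geometric_sum _ _ _) _; first by rewrite divr_ge0 // ltW.
  by apply/andP; split; lra.
by rewrite le_eqVlt; apply/orP; left; apply/eqP; field.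
Qed.

Lemma hausdorff_nullS t (E F : set (R * R)) : E `<=` F ->
  hausdorff_measure t F = 0%E -> hausdorff_measure t E = 0%E.
Proof.
move=> EF /hausdorff_nullP h; apply/hausdorff_nullP => dl eta dl0 eta0.
by have [U [cU dU hU]] := h dl eta dl0 eta0; exists U; split => //; exact: subset_trans cU.
Qed.

(** The list is continued by empty sets, whose contribution is 0 by the convention in [hcontrib];
    this matters at [t = 0]. *)
Lemma fine_cover_seq t E (dl eta D : R) (l : seq (set (R * R))) : 0 <= t -> 0 <= D -> D <= dl ->
  (forall x, E x -> exists2 i, (i < size l)%N & nth set0 l i x) ->
  (forall i, (i < size l)%N -> (diam (nth set0 l i) <= D%:E)%E) ->
  (size l)%:R * D `^ t <= eta -> fine_cover t E dl eta.
Proof.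
move=> t0 D0 Ddl cl dl' hl; exists (nth set0 l); split.
- by move=> x /cl[i _ h]; exists i.
- move=> n; case: (ltnP n (size l)) => h; first by apply: le_trans (dl' n h) _; rewrite lee_fin.
  by rewrite nth_default // diam_set0 lee_fin (le_trans D0).
apply: le_nneseries_bound => [n|n]; first exact: hcontrib_ge0.
apply: le_trans (_ : _ <= ((size l)%:R * D `^ t)%:E)%E _; last by rewrite lee_fin.
apply: (@le_trans _ _ (\sum_(0 <= j < n) (if (j < size l)%N then D `^ t else 0)%:E)%E).
  apply: lee_sum => j _; case: ltnP => h; last by rewrite nth_default // hcontrib0.
  by apply: hcontrib_le => //; exact: dl'.
rewrite sumEFin lee_fin -big_mkcond /=.
apply: (@le_trans _ _ (\sum_(0 <= i < n + size l | (i < size l)%N) D `^ t)).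
  rewrite [leRHS](@big_cat_nat _ _ _ n) ?leq_addr //= lerDl sumr_ge0 // => *; exact: powR_ge0.
rewrite (@big_cat_nat _ _ _ (size l)) ?leq_addl //= [X in _ + X]big1_seq ?addr0; last first.
  by move=> i /andP[h]; rewrite mem_index_iota leqNgt h.
rewrite big_mkcond /= (eq_big_nat _ _ (F2 := fun _ => D `^ t)); last by move=> i /andP[_ ->].
by rewrite big_const_nat subn0 iter_addr addr0 mulr_natl.
Qed.

End HausdorffNull.

Section HausdorffNullSets.
Variable R : realType.
Implicit Types (E : set (R * R)) (t : R).

Lemma exists_expn_le (x e : R) : 0 <= x < 1 -> 0 < e ->
  exists j0, forall j, (j0 <= j)%N -> x ^+ j <= e.
Proof.
move=> /andP[x0 x1] e0; have h : `|x| < 1 by rewrite ger0_norm.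
have [n _ hn] := @cvgr_lt _ _ _ eventually_filter _ _ (cvg_geometric 1 h) _ e0.
by exists n => j nj; apply: ltW; have := hn j nj; rewrite /geometric /= mul1r.
Qed.

(** Borel-Cantelli for covers: the union of all levels from [J] on still covers [E], and its total
    contribution is at most a geometric tail. *)
Lemma hausdorff_null_limsup t E (Q : nat -> seq (set (R * R))) (c C b : R) (j0 : nat) :
  0 <= t -> 0 < c -> 0 <= C -> 0 < b < 1 ->
  (forall J x, E x -> exists j, (J <= j)%N /\ exists2 i, (i < size (Q j))%N & nth set0 (Q j) i x) ->
  (forall j i, (i < size (Q j))%N -> (diam (nth set0 (Q j) i) <= (c / 2 ^+ j)%:E)%E) ->
  (forall j, (j0 <= j)%N -> (size (Q j))%:R * (c / 2 ^+ j) `^ t <= C * b ^+ j) ->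
  hausdorff_measure t E = 0%E.
Proof.
move=> t0 c0 C0 b01 cov dQ sQ; have [b0 b1] := andP b01.
apply/hausdorff_nullP => dl eta dl0 eta0.
have h0 : 0 <= (2^-1 : R) < 1 by rewrite invr_ge0 ler0n /= invf_lt1 // ltr1n.
have [J1 HJ1] := exists_expn_le h0 (divr_gt0 dl0 c0).
have e0 : 0 < eta * (1 - b) / (C + 1) by rewrite divr_gt0 ?mulr_gt0 ?subr_gt0 // ltr_wpDl.
have b01' : 0 <= b < 1 by rewrite (ltW b0).
have [J2 HJ2] := exists_expn_le b01' e0.
pose J := (j0 + (J1 + J2))%N.
have Jj0 : (j0 <= J)%N by rewrite leq_addr.
have JJ1 : (J1 <= J)%N by rewrite /J addnCA leq_addr.
have JJ2 : (J2 <= J)%N by rewrite /J addnA leq_addl.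
pose Ek k : set (R * R) := fun x => exists2 i, (i < size (Q (J + k)))%N & nth set0 (Q (J + k)%N) i x.
have : fine_cover t (\bigcup_k Ek k) dl eta.
  apply: (@fine_cover_bigcup R t Ek dl (fun k => C * b ^+ J * b ^+ k)).
    move=> k; apply: (@fine_cover_seq R t _ dl _ (c / 2 ^+ (J + k)) (Q (J + k)%N)) => //.
    - by rewrite divr_ge0 ?exprn_ge0 // ltW.
    - rewrite mulrC -ler_pdivlMr // -exprVn; apply: HJ1; exact: leq_trans JJ1 (leq_addr _ _).
    - exact: dQ.
    - by rewrite -mulrA -exprD; apply: sQ; exact: leq_trans Jj0 (leq_addr _ _).
  move=> n; apply: le_trans (le_geometric_sum _ _ b01) _; first by rewrite mulr_ge0 // exprn_ge0 // ltW.
  rewrite ler_pdivrMr ?subr_gt0 //; have := HJ2 J JJ2.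
  rewrite ler_pdivlMr ?ltr_wpDl //; apply: le_trans.
  by rewrite mulrC ler_wpM2l ?exprn_ge0 ?(ltW b0) // lerDl.
move=> [U [cU dU sU]]; exists U; split => //; apply: subset_trans cU => x /(cov J)[j [Jj [i hi hx]]].
by exists (j - J)%N => //; exists i; rewrite subnKC.
Qed.

Lemma cdist_le (x y : R * R) D : `|x.1 - y.1| <= D -> `|x.2 - y.2| <= D -> cdist x y <= 2 * D.
Proof.
move=> h1 h2; have D0 : 0 <= D by apply: le_trans h1.
rewrite /cdist /cabs /= -(ger0_norm (_ : 0 <= 2 * D)) ?mulr_ge0 // -sqrtr_sqr ler_wsqrtr //.
rewrite -(real_normK (num_real (x.1 - y.1))) -(real_normK (num_real (x.2 - y.2))).
have g1 : `|x.1 - y.1| ^+ 2 <= D ^+ 2 by rewrite lerXn2r ?nnegrE.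
have g2 : `|x.2 - y.2| ^+ 2 <= D ^+ 2 by rewrite lerXn2r ?nnegrE.
apply: le_trans (lerD g1 g2) _.
have -> : (2 * D) ^+ 2 = D ^+ 2 + D ^+ 2 + 2 * D ^+ 2 by ring.
by rewrite lerDl mulr_ge0 // sqr_ge0.
Qed.

Lemma cdist_ge (x y : R * R) : `|x.1 - y.1| <= cdist x y /\ `|x.2 - y.2| <= cdist x y.
Proof.
rewrite /cdist /cabs /= -!sqrtr_sqr; split; apply: ler_wsqrtr.
  by rewrite lerDl sqr_ge0.
by rewrite lerDr sqr_ge0.
Qed.

Lemma scale_powR (c t : R) j : 0 <= c -> (c / 2 ^+ j) `^ t = c `^ t * (2^-1 `^ t) ^+ j.
Proof.
move=> c0; rewrite powRM ?invr_ge0 ?exprn_ge0 //; congr (_ * _).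
by rewrite -[RHS]powR_mulrn ?powR_ge0 // powRAC powR_mulrn ?invr_ge0 // exprVn.
Qed.

(** A measurable enclosure, needed because the sets of a cover are arbitrary: a square centred at a
    chosen point of [U]. *)
Definition box (U : set (R * R)) : set (R * R) :=
  if U == set0 then set0 else
  let x := get U in let D := fine (diam U) in
  `[x.1 - D, x.1 + D] `*` `[x.2 - D, x.2 + D].

Local Notation RR := (measurableTypeR R * measurableTypeR R)%type.

Lemma measurable_box U : measurable (box U : set RR).
Proof. by rewrite /box; case: ifP => _ //; apply: measurableX; exact: measurable_itv. Qed.

Lemma sub_box U : (diam U <= 1%:E)%E -> U `<=` box U.
Proof.
move=> dU x Ux; rewrite /box; case: ifPn => [/eqP U0|/set0P[y Uy]]; first by move: Ux; rewrite U0.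
have Ug : U (get U) := getPex (ex_intro U y Uy).
have fd : diam U \is a fin_num.
  by rewrite ge0_fin_numE ?diam_ge0 //; apply: le_lt_trans dU _; rewrite ltry.
have : cdist x (get U) <= fine (diam U).
  by rewrite -lee_fin fineK //; apply: ereal_sup_ubound; right; exists x => //; exists (get U).
have [h1 h2] := cdist_ge x (get U).
move=> h; move: (le_trans h1 h) (le_trans h2 h).
by rewrite !ler_norml => /andP[? ?] /andP[? ?] /=; rewrite !in_itv /=; split; apply/andP; split; lra.
Qed.

Lemma leb2_box t U : 0 <= t <= 2 -> (diam U <= 1%:E)%E -> (leb2 (box U) <= 4%:E * hcontrib t U)%E.
Proof.
move=> /andP[t0 t2] dU; rewrite /box /hcontrib; case: ifP => _; first by rewrite measure0 mule0.
have fd : diam U \is a fin_num.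
  by rewrite ge0_fin_numE ?diam_ge0 //; apply: le_lt_trans dU _; rewrite ltry.
move: dU (fine_ge0 (diam_ge0 U)); rewrite -{1}(fineK fd) lee_fin; move: (fine (diam U)) => D D1 D0.
rewrite /leb2 product_measure1E; try exact: measurable_itv.
rewrite [X in (X * _)%E]lebesgue_measure_itv [X in (_ * X)%E]lebesgue_measure_itv /= !lte_fin.
have [D00|D_gt0] := eqVneq D 0.
  by rewrite D00 subr0 addr0 !ltxx mul0e mule_ge0 ?lee_fin ?powR_ge0.
have Dp : 0 < D by rewrite lt_def D_gt0.
have L (x : R) : x - D < x + D by lra.
rewrite !L -!EFinB -!EFinM lee_fin.
have -> : ((get U).1 + D - ((get U).1 - D)) * ((get U).2 + D - ((get U).2 - D)) = 4 * D ^+ 2 by ring.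
rewrite ler_wpM2l // -powR_mulrn // ger_powR // Dp //.
Qed.

(** For [t <= 2] and diameters at most 1 the area of a [box] is at most four times the contribution
    of its set. Intersecting the enclosures of covers with sums at most 1 / (n + 1) gives a
    measurable null set. *)
Lemma hausdorff_null_negligible t E : 0 <= t <= 2 -> hausdorff_measure t E = 0%E ->
  (@leb2 R).-negligible E.
Proof.
move=> t02 /hausdorff_nullP h.
have /choice[U HU] : forall n : nat, exists U : nat -> set (R * R),
    [/\ E `<=` \bigcup_n U n, forall n, (diam (U n) <= 1%:E)%E &
      (\sum_(0 <= n <oo) hcontrib t (U n) <= (n.+1%:R^-1)%:E)%E].
  by move=> n; apply: h => //; rewrite invr_gt0.
pose N n : set RR := \bigcup_m box (U n m).
have mN n : measurable (N n) by apply: bigcup_measurable => m _; exact: measurable_box.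
exists (\bigcap_n N n : set RR); split.
- exact: bigcapT_measurable.
- apply/eqP; rewrite eq_le measure_ge0 andbT; apply/lee_addgt0Pr => e e0; rewrite add0e.
  have [n hn] : exists n : nat, 4 * n.+1%:R^-1 <= e.
    exists (Num.truncn (4 / e)); rewrite ler_pdivrMr // mulrC -ler_pdivrMr //.
    by apply: ltW; case/andP: (truncn_itv (divr_ge0 (ler0n R 4) (ltW e0))).
  have [_ dU sU] := HU n.
  apply: (@le_trans _ _ (leb2 (N n))).
    apply: le_measure; rewrite ?inE //; first exact: bigcapT_measurable.
    exact: bigcap_inf.
  apply: (@le_trans _ _ (\sum_(0 <= m <oo) leb2 (box (U n m)))%E).
    by apply: measure_sigma_subadditive => // m; exact: measurable_box.
  apply: (@le_trans _ _ (\sum_(0 <= m <oo) (4%:E * hcontrib t (U n m)))%E).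
    by apply: lee_nneseries => m _ //; exact: leb2_box.
  rewrite nneseriesZl; last by move=> *; exact: hcontrib_ge0.
  apply: (@le_trans _ _ (4%:E * (n.+1%:R^-1)%:E)%E); first by apply: lee_wpmul2l.
  by rewrite -EFinM lee_fin.
- move=> x Ex n _; have [cU dU _] := HU n; have [m _ Ux] := cU x Ex.
  by exists m => //; apply: sub_box.
Qed.

Lemma exp_gt_linear (x : R) n : 0 < x -> x <= 1 -> n.+1%:R * x <= (1 + x) ^+ n.
Proof.
move=> x0 x1; elim: n => [|n IH]; first by rewrite expr0 mul1r.
rewrite exprS -natr1 mulrDl mul1r mulrDl mul1r lerD //.
apply: ler_peMr; first exact: ltW.
by rewrite exprn_ege1 // lerDl ltW.
Qed.

Lemma pow4_le_exp (th : R) : 1 < th -> exists2 K, 0 <= K & forall n, n.+1%:R ^+ 4 <= K * th ^+ n.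
Proof.
(* For x <= 1 the binomial expansion gives (1 + x)^4 <= 1 + 15 x. *)
move=> th1; pose x := Num.min 1 ((th - 1) / 15).
have x0 : 0 < x by rewrite /x lt_min ltr01 divr_gt0 // subr_gt0.
have x1 : x <= 1 by rewrite /x ge_min lexx.
have xt : x <= (th - 1) / 15 by rewrite /x ge_min lexx orbT.
have h4 : (1 + x) ^+ 4 <= th.
  have x2 : x ^+ 2 <= x by rewrite expr2 ler_piMr // ltW.
  have x3 : x ^+ 3 <= x by rewrite exprS; apply: le_trans (_ : x * x <= _); [rewrite ler_wpM2l // ltW | rewrite -expr2].
  have x4 : x ^+ 4 <= x by rewrite exprS; apply: le_trans (_ : x * x <= _); [rewrite ler_wpM2l // ltW | rewrite -expr2].
  have -> : (1 + x) ^+ 4 = 1 + 4 * x + 6 * x ^+ 2 + 4 * x ^+ 3 + x ^+ 4 by ring.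
  by lra.
exists (x ^- 4); first by rewrite invr_ge0 exprn_ge0 // ltW.
move=> n; rewrite mulrC ler_pdivlMr ?exprn_gt0 // -exprMn.
apply: le_trans (_ : ((1 + x) ^+ n) ^+ 4 <= _).
  by rewrite lerXn2r ?nnegrE ?mulr_ge0 ?exprn_ge0 ?addr_ge0 ?(ltW x0) ?exp_gt_linear // ltW.
rewrite -exprM mulnC exprM lerXn2r ?nnegrE ?exprn_ge0 ?addr_ge0 ?(ltW x0) //.
by rewrite (le_trans ler01) // ltW.
Qed.

Lemma half_powR_lt (t m : R) : m < t -> 2^-1 `^ t < 2^-1 `^ m.
Proof. 
move=> mt; rewrite /powR gt_eqF ?invr_gt0 // ltr_expR.
rewrite ltr_nM2r //; rewrite ln_lt0 // invr_gt0 ltr0n /= invf_lt1 // ltr1n //.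
Qed.

Lemma hausdorff_null_segment t (a l : R) : 1 < t -> 0 < l ->
  hausdorff_measure t [set p : R * R | 0 <= p.1 - a < l /\ p.2 = 0] = 0%E.
Proof.
move=> t1 l0.
pose piece j i : set (R * R) := [set p : R * R | l / 2 ^+ j * i%:R <= p.1 - a <= l / 2 ^+ j * i.+1%:R /\ p.2 = 0].
have c0 : 0 < 2 * l by rewrite mulr_gt0.
have b1 : 2 * 2^-1 `^ t < 1.
  have := half_powR_lt t1; rewrite powRr1 ?invr_ge0 // => h.
  by rewrite mulrC -ltr_pdivlMr // mul1r.
apply: (@hausdorff_null_limsup t _ (fun j => mkseq (piece j) (2 ^ j)) (2 * l) ((2 * l) `^ t) (2 * 2^-1 `^ t) 0).
- by rewrite (le_trans ler01) // ltW.
- exact: c0.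
- exact: powR_ge0.
- by rewrite b1 andbT mulr_gt0 // powR_gt0 // invr_gt0.
- move=> J [x0 y] /= []; move xE : (x0 - a) => x /andP[xge0 xl] ->; exists J; split => //; rewrite size_mkseq.
  have r0 : 0 < l / 2 ^+ J by rewrite divr_gt0 // exprn_gt0.
  have xr0 : 0 <= x / (l / 2 ^+ J) by rewrite divr_ge0 // ltW.
  have /andP[h1 h2] := truncn_itv xr0.
  have hi : (Num.truncn (x / (l / 2 ^+ J)) < 2 ^ J)%N.
    rewrite -(ltr_nat R) natrX; apply: le_lt_trans h1 _.
    by rewrite ltr_pdivrMr // mulrC divfK // expf_neq0.
  exists (Num.truncn (x / (l / 2 ^+ J))) => //; rewrite nth_mkseq //; split => //=.
  by rewrite xE mulrC -ler_pdivlMr // h1 /= mulrC -ler_pdivrMr // ltW.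
- move=> j i; rewrite size_mkseq => hi; rewrite nth_mkseq //.
  have r0 : 0 <= l / 2 ^+ j by rewrite divr_ge0 ?exprn_ge0 // ltW.
  apply: diam_le => [|x y [/andP[h1 h2] x2] [/andP[h3 h4] y2]].
    by rewrite -mulrA mulr_ge0.
  rewrite -mulrA; apply: cdist_le; last by rewrite x2 y2 subrr normr0.
  move: h1 h2 h3 h4 r0; rewrite -(@natr1 R i) mulrDr mulr1.
  move: (l / 2 ^+ j * i%:R) => e; move: (l / 2 ^+ j) => r h1 h2 h3 h4 r0.
  by rewrite ler_norml; apply/andP; split; lra.
move=> j _; rewrite size_mkseq scale_powR ?(ltW c0) // natrX exprMn.
by rewrite le_eqVlt; apply/orP; left; apply/eqP; ring.
Qed.

End HausdorffNullSets.

(** * The exceptional set *)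

Section Midpoints.
Variable R : realFieldType.
Implicit Types x : R.

Lemma mid_01 x : 0 <= x < 1 -> 0 < (1 + x) / 2 < 1.
Proof. by move=> /andP[? ?]; apply/andP; split; lra. Qed.

Lemma le_mid x : x < 1 -> x <= (1 + x) / 2.
Proof. by move=> ?; lra. Qed.

Lemma mid_gt1 x : 1 < x -> 1 < (1 + x) / 2.
Proof. by move=> ?; lra. Qed.

Lemma mid_lt1 x : x < 1 -> (x + 1) / 2 < 1.
Proof. by move=> ?; lra. Qed.

End Midpoints.

Section ExceptionalSquare.
Variables (R : realType) (d : measure_display) (Omega : measurableType d)
  (P : probability Omega R) (eps : nat -> Omega -> bool).
Hypothesis fair : fair_indep_signs P eps.
Local Notation nm := (@Normc.normc R).

Definition toC (p : R * R) : R[i] := (p.1 +i* p.2)%C.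

Lemma toCK p : toP (toC p) = p. Proof. by case: p. Qed.

(** Bernoulli: with x = (1 - g) / 8 one has (1 - x)^4 >= 1 - 4x = (1 + g) / 2 > g. The fourth power
    is the form in which the density criterion expects the rate. *)
Lemma exists_contraction (g : R) : 0 <= g < 1 -> exists2 ze, 0 < ze < 1 & g < ze ^+ 4.
Proof.
move=> /andP[g0 g1]; pose x := (1 - g) / 8.
have x0 : 0 < x by rewrite divr_gt0 // subr_gt0.
have x1 : x <= 8^-1 by rewrite /x ler_pdivrMr // mulVf // lerBlDl lerDr.
exists (1 - x); first by apply/andP; split; lra.
have h : 1 - 4 * x <= (1 - x) ^+ 4.
  have -> : (1 - x) ^+ 4 = 1 - 4 * x + x ^+ 2 * (6 - 4 * x + x ^+ 2) by ring.
  by rewrite lerDl mulr_ge0 ?sqr_ge0 // addr_ge0 ?sqr_ge0 //; lra.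
apply: lt_le_trans h; rewrite /x; lra.
Qed.

Section BadCells.
Variables (z0 : R[i]) (ell : R) (L : nat) (be : R).
Hypotheses (ell0 : 0 < ell) (be0 : 0 < be).

Definition bad_cell j : pred ('I_(2 ^ j) * 'I_(2 ^ j)) :=
  fun i => be ^+ j < cellV z0 ell L j (val i.1, val i.2).

Definition cell_set j (i : nat * nat) : set (R * R) :=
  [set p | [/\ rho ell j * i.1%:R <= p.1 - Re z0, p.1 - Re z0 <= rho ell j * i.1.+1%:R,
   rho ell j * i.2%:R <= p.2 - Im z0 & p.2 - Im z0 <= rho ell j * i.2.+1%:R]].

Definition bad_cells j : seq (set (R * R)) :=
  [seq cell_set j (val i.1, val i.2) | i <- enum (@bad_cell j)].

Lemma size_bad_cells j : size (bad_cells j) = #|@bad_cell j|.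
Proof. by rewrite size_map -cardE. Qed.

Lemma diam_bad_cells j i : (i < size (bad_cells j))%N ->
  (diam (nth set0 (bad_cells j) i) <= (2 * ell / 2 ^+ j)%:E)%E.
Proof.
move=> hi; have r0 := rho_gt0 ell0 j.
have : nth set0 (bad_cells j) i \in map (fun i => cell_set j (val i.1, val i.2)) (enum (@bad_cell j)).
  exact: mem_nth.
move=> /mapP[i0 _ ->]; apply: diam_le; first by rewrite -mulrA mulr_ge0 // ltW.
move=> x y [h1 h2 h3 h4] [g1 g2 g3 g4]; rewrite -mulrA; apply: cdist_le.
  move: h1 h2 g1 g2; rewrite -(@natr1 R (val i0.1)) mulrDr mulr1 -/(rho ell j) /=.
  move: (rho ell j * _) => e; move: (rho ell j) => r h1 h2 g1 g2.
  by rewrite ler_norml; apply/andP; split; lra.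
move: h3 h4 g3 g4; rewrite -(@natr1 R (val i0.2)) mulrDr mulr1 -/(rho ell j) /=.
move: (rho ell j * _) => e; move: (rho ell j) => r h3 h4 g3 g4.
by rewrite ler_norml; apply/andP; split; lra.
Qed.

(** Markov's inequality for [cellV] at the threshold [be ^+ j]. *)
Lemma card_bad_cells j : #|@bad_cell j|%:R * be ^+ j <=
  \sum_(i1 < 2 ^ j) \sum_(i2 < 2 ^ j) cellV z0 ell L j (val i1, val i2).
Proof.
rewrite pair_bigA /= -sum1_card natr_sum mulr_suml.
rewrite [leRHS](bigID (@bad_cell j)) /= -[leLHS]addr0; apply: lerD.
  by apply: ler_sum => i hi; rewrite mul1r ltW.
by apply: sumr_ge0 => i _; exact: cellV_ge0.
Qed.

(** Contrapositive of [good_point_density]: a parameter in no bad cell from level [J] on would have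
    a density. *)
Lemma bad_cells_cover J p (q : R) : 0 < q < 1 -> q ^+ L <= 1/4 ->
  0 <= p.1 - Re z0 < ell -> 0 <= p.2 - Im z0 < ell ->
  (forall y : R[i], `|Re y - Re z0| <= 2 * ell -> `|Im y - Im z0| <= 2 * ell -> nm y <= q) ->
  (exists2 ze, 0 < ze < 1 & be = ze ^+ 4) ->
  ~ has_L2_density (nu P eps p) ->
  exists j, (J <= j)%N /\ exists2 i, (i < size (bad_cells j))%N & nth set0 (bad_cells j) i p.
Proof.
move=> q01 qL p1 p2 qz [ze ze01 beE]; apply: contra_notP => no.
rewrite -[p]toCK; apply: (good_point_density fair (z := toC p) ell0 q01 qL p1 p2 qz (J := J) ze01).
move=> j Jj; rewrite leNgt; apply/negP => bad; apply: no; exists j; split => //.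
set i := cell_idx _ _ _ _ in bad.
have i1 : (i.1 < 2 ^ j)%N by exact: idx1_lt.
have i2 : (i.2 < 2 ^ j)%N by exact: idx1_lt.
pose i' : 'I_(2 ^ j) * 'I_(2 ^ j) := (Ordinal i1, Ordinal i2).
have bi : @bad_cell j i' by rewrite /bad_cell beE.
have ie : i' \in enum (@bad_cell j) by rewrite mem_enum.
exists (index i' (enum (@bad_cell j))); first by rewrite size_map index_mem.
rewrite (nth_map i') ?index_mem // nth_index //=.
have /andP[a1 a2] := idx1_itv ell0 j (proj1 (andP p1)).
have /andP[a3 a4] := idx1_itv ell0 j (proj1 (andP p2)).
by split => //=; apply: ltW.
Qed.

End BadCells.

(* There are about [(16 * 2 `^ - s / be) ^+ j] bad cells of diameter of order [2 ^- j] at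
   level [j], summable against the gauge [t] once [be] is close enough to 1. *)
Lemma square_null (rr Rb eta s t : R) : 0 < rr -> rr < 1 -> 0 <= Rb < 1 ->
  5 * Rb ^+ 8 < 256/625 -> 0 < eta -> 0 < s -> s <= 3 -> 2^-1 = rr `^ s -> rr <= Rb ->
  0 <= t -> 4 - s < t ->
  exists2 l0 : R, 0 < l0 & forall ell (z0 : R[i]), 0 < ell -> ell <= l0 ->
   (forall z, `|Re z - Re z0| <= 2 * ell -> `|Im z - Im z0| <= 2 * ell ->
       [/\ rr <= nm z, nm z <= Rb & eta <= `|Im z|]) ->
   hausdorff_measure t [set p : R * R | [/\ 0 <= p.1 - Re z0 < ell, 0 <= p.2 - Im z0 < ell &
     ~ has_L2_density (nu P eps p)]] = 0%E.
Proof.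
move=> rr0 rr1 Rb01 Rb8 eta0 s0 s3 rs rrRb t0 st; have [Rb0 Rb1] := andP Rb01.
have [l0 l0_0 HE] := square_energy rr0 rr1 Rb01 Rb8 eta0 s0 s3 rs rrRb.
have q01 : 0 < (1 + Rb) / 2 < 1 by exact: mid_01.
have [L HL] : exists L, ((1 + Rb) / 2) ^+ L <= 1 / 4.
  by apply: pow_le_half; case/andP: q01 => /ltW -> ->.
exists (Num.min l0 (Num.min 1 ((1 - Rb) / 8))).
  by rewrite !lt_min l0_0 ltr01 divr_gt0 // subr_gt0.
move=> ell z0 ell0; rewrite !le_min => /and3P[ll0 l1 lR] Hz0.
have [j0 [Y Y0 HY]] := HE ell ell0 ll0 l1 lR L HL.
pose u : R := 2^-1 `^ s; pose v : R := 2^-1 `^ t.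
have u0 : 0 < u by rewrite powR_gt0 // invr_gt0.
have v0 : 0 < v by rewrite powR_gt0 // invr_gt0.
(* This is exactly s + t > 4. *)
have g1 : 16 * u * v < 1.
  rewrite /u /v -mulrA -powRD; last by rewrite invr_neq0 // implybT.
  have : 2^-1 `^ (s + t) < 2^-1 `^ 4 :> R by apply: half_powR_lt; rewrite -ltrBlDl.
  rewrite (powR_mulrn 4) ?invr_ge0 // exprVn => h.
  rewrite -(ltr_pM2l (_ : 0 < 16)) // in h.
  by apply: lt_le_trans h _; rewrite -natrX -[16]/(2 ^ 4)%:R divff // pnatr_eq0.
have g0 : 0 < 16 * u * v by rewrite !mulr_gt0.
have [ze ze01 gze] : exists2 ze, 0 < ze < 1 & 16 * u * v < ze ^+ 4.
  by apply: exists_contraction; rewrite g1 ltW.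
pose be := ze ^+ 4.
have be0 : 0 < be by rewrite exprn_gt0 //; case/andP: ze01.
pose b := 16 * u * v / be.
have b0 : 0 < b by rewrite divr_gt0.
have b1 : b < 1 by rewrite ltr_pdivrMr // mul1r.
(* Any number strictly between 1 and 1 / b absorbs the polynomial factor and keeps the ratio
   [th * b] below 1. *)
pose th := (1 + b^-1) / 2.
have bi : 1 < b^-1 by rewrite invf_gt1.
have th1 : 1 < th by exact: mid_gt1.
have [K K0 HK] := pow4_le_exp th1.
have thb : 0 < th * b < 1.
  apply/andP; split; first by rewrite mulr_gt0 // (lt_trans ltr01).
  rewrite /th mulrAC mulrDl mulVf ?gt_eqF // mul1r.
  exact: mid_lt1.
apply: (@hausdorff_null_limsup R t _ (bad_cells z0 ell L be) (2 * ell) ((2 * ell) `^ t * (16 * Y * K)) (th * b) j0) => //.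
- by rewrite mulr_gt0.
- by rewrite mulr_ge0 ?powR_ge0 // !mulr_ge0.
- move=> J p [p1 p2 nd]; apply: (bad_cells_cover ell0 J q01 HL p1 p2 _ _ nd).
    move=> y h1 h2; have [_ h _] := Hz0 y h1 h2; apply: le_trans h _.
    exact: le_mid.
  by exists ze.
- move=> j i; exact: diam_bad_cells.
move=> j jj0; rewrite size_bad_cells scale_powR ?mulr_ge0 ?(ltW ell0) // -/v.
have h1 : #|bad_cell z0 ell L be (j:=j)|%:R * be ^+ j <= 16 * Y * K * (th * (16 * u)) ^+ j.
  apply: le_trans (@card_bad_cells z0 ell L be ell0 j) _.
  apply: le_trans (sum_cellV ell0 (HY j z0 jj0 Hz0)) _.
  rewrite -/u; have -> : 16 * 4 ^- j * (Y * j.+1%:R ^+ 4 * (64 * u) ^+ j) = 16 * Y * (j.+1%:R ^+ 4 * (16 * u) ^+ j).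
    rewrite (_ : 64 * u = 4 * (16 * u)); last by ring.
    by rewrite (exprMn j 4); field; rewrite expf_neq0.
  have -> : 16 * Y * K * (th * (16 * u)) ^+ j = 16 * Y * (K * th ^+ j * (16 * u) ^+ j).
    by rewrite (exprMn j th); ring.
  apply: ler_wpM2l; first by rewrite mulr_ge0.
  by apply: ler_wpM2r => //; rewrite exprn_ge0 // mulr_ge0 // ltW.
have -> : (2 * ell) `^ t * (16 * Y * K) * (th * b) ^+ j =
  (16 * Y * K * (th * (16 * u)) ^+ j) * (v ^+ j / be ^+ j) * (2 * ell) `^ t.
  have -> : (th * b) ^+ j = (th * (16 * u)) ^+ j * (v ^+ j / be ^+ j).
    by rewrite -exprVn -[v ^+ j * _]exprMn -[RHS]exprMn /b; congr (_ ^+ _); ring.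
  ring.
have h2 : #|bad_cell z0 ell L be (j:=j)|%:R <= 16 * Y * K * (th * (16 * u)) ^+ j / be ^+ j.
  by rewrite ler_pdivlMr // exprn_gt0.
apply: le_trans (ler_wpM2r _ h2) _; first by rewrite mulr_ge0 ?powR_ge0 ?exprn_ge0 ?(ltW v0).
by rewrite le_eqVlt; apply/orP; left; apply/eqP; ring.
Qed.

End ExceptionalSquare.

(** * Covering the annulus by small squares off the real axis *)

Section Annulus.
Variable R : realType.
Local Notation nm := (@Normc.normc R).

Lemma hausdorff_null_set0 (t : R) : 0 <= t -> hausdorff_measure t (set0 : set (R * R)) = 0%E.
Proof.
move=> t0; apply/hausdorff_nullP => dl eta dl0 eta0.
apply: (@fine_cover_seq R t set0 dl eta dl [::]) => //; first exact: ltW.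
by rewrite mul0r ltW.
Qed.

Lemma hausdorff_null_real_axis (t : R) : 1 < t ->
  hausdorff_measure t [set p : R * R | cabs p < 1 /\ p.2 = 0] = 0%E.
Proof.
move=> t1; have l2 : (0 : R) < 2 by [].
apply: hausdorff_nullS (@hausdorff_null_segment R t (-1) 2 t1 l2) => -[x y] /= [h ->]; split => //.
have : `|x| < 1.
  apply: le_lt_trans h; rewrite /cabs /= -sqrtr_sqr ler_wsqrtr // lerDl sqr_ge0 //.
by rewrite ltr_norml => /andP[? ?]; apply/andP; split; lra.
Qed.

(** Each such [z] is within [3 * ell] of [p] in both coordinates, hence within [6 * ell <= eta] in
    modulus, which the margins assumed for [p] absorb. *)
Lemma square_margin (r Rb eta ell : R) (p : R * R) (z0 : R[i]) : 6 * ell <= eta -> 0 < ell ->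
  0 <= p.1 - Re z0 < ell -> 0 <= p.2 - Im z0 < ell ->
  r + eta <= cabs p -> cabs p <= Rb - eta -> 2 * eta <= `|p.2| ->
  forall z : R[i], `|Re z - Re z0| <= 2 * ell -> `|Im z - Im z0| <= 2 * ell ->
     [/\ r <= nm z, nm z <= Rb & eta <= `|Im z|].
Proof.
move=> le l0 /andP[h1 h2] /andP[h3 h4] c1 c2 c3 z; rewrite !ler_norml => /andP[g1 g2] /andP[g3 g4].
have d1 : `|Re z - p.1| <= 3 * ell by rewrite ler_norml; apply/andP; split; lra.
have d2 : `|Im z - p.2| <= 3 * ell by rewrite ler_norml; apply/andP; split; lra.
have dz : nm (z - toC p) <= eta.
  apply: le_trans (nm_le_ReIm _) _; case: p z d1 d2 {h1 h2 h3 h4 c1 c2 c3 g1 g2 g3 g4} => a b [x y] /= d1 d2.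
  by apply: le_trans (lerD d1 d2) _; lra.
have e1 : cabs p = nm (toC p) by case: (p).
have t1 : nm z <= nm (z - toC p) + nm (toC p) by rewrite -{1}(subrK (toC p) z) nmD.
have t2 : nm (toC p) <= nm (z - toC p) + nm z.
  have -> : nm (z - toC p) = nm (toC p - z) by rewrite -nmN opprB.
  by rewrite -{1}(subrK z (toC p)) nmD.
have t3 : `|p.2| <= `|Im z - p.2| + `|Im z|.
  rewrite distrC -{1}(subrK (Im z) p.2); exact: ler_normD.
rewrite e1 in c1 c2; move: dz t1 t2 c1 c2; move: (nm (z - toC p)) (nm z) (nm (toC p)) => x y w.
move: t3 d2 c3 le; move: `|Im z - p.2| `|Im z| `|p.2| => x1 x2 x3 t3 d2 c3 le dz t1 t2 c1 c2.
by clear -t3 d2 c3 le dz t1 t2 c1 c2 l0; split; lra.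
Qed.

Variables (d : measure_display) (Omega : measurableType d)
  (P : probability Omega R) (eps : nat -> Omega -> bool).
Hypothesis fair : fair_indep_signs P eps.
Variables (r Rb s t : R).
Hypotheses (r0 : 0 < r) (r1 : r < 1) (Rb01 : 0 <= Rb < 1) (Rb8 : 5 * Rb ^+ 8 < 256/625)
  (s0 : 0 < s) (s3 : s <= 3) (rs : 2^-1 = r `^ s) (rRb : r <= Rb) (t1 : 1 < t) (st : 4 - s < t).

Let t0 : 0 <= t. Proof. by apply: ltW; apply: lt_trans t1. Qed.

Definition inner_set (eta : R) : set (R * R) := [set p : R * R |
  [/\ r + eta <= cabs p, cabs p <= Rb - eta, 2 * eta <= `|p.2| & ~ has_L2_density (nu P eps p)]].

Lemma inner_set_null eta : 0 < eta -> hausdorff_measure t (inner_set eta) = 0%E.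
Proof.
move=> eta0.
have [l0 l0_0 HS] := square_null fair r0 r1 Rb01 Rb8 eta0 s0 s3 rs rRb t0 st.
pose ell := Num.min l0 (eta / 6).
have ell0 : 0 < ell by rewrite lt_min l0_0 divr_gt0.
have elll : ell <= l0 by rewrite ge_min lexx.
have elle : 6 * ell <= eta by rewrite mulrC -ler_pdivlMr // ge_min lexx orbT.
pose z m : R[i] := ((ell * (m.1 : int)%:~R) +i* (ell * (m.2 : int)%:~R))%C.
pose S m : set (R * R) := [set p | [/\ 0 <= p.1 - Re (z m) < ell, 0 <= p.2 - Im (z m) < ell &
  inner_set eta p]].
have S0 m : hausdorff_measure t (S m) = 0%E.
  have [->|/set0P[p0 [h1 h2 [c1 c2 c3 _]]]] := eqVneq (S m) set0; first exact: hausdorff_null_set0.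
  apply: hausdorff_nullS (HS ell (z m) ell0 elll (square_margin elle ell0 h1 h2 c1 c2 c3)).
  by move=> p [? ? []].
apply: (@hausdorff_nullS R t _ (\bigcup_n (if unpickle n is Some m then S m else set0))).
  move=> p hp; exists (pickle (Num.floor (p.1 / ell), Num.floor (p.2 / ell))); first exact: I.
  rewrite pickleK.
  have F x : 0 <= x - ell * (Num.floor (x / ell))%:~R < ell.
    have /andP[] := floor_itv (x / ell).
    rewrite ler_pdivlMr // ltr_pdivrMr // rmorphD /= mulrDl mul1r => g1 g2.
    by rewrite subr_ge0 mulrC g1 /= ltrBlDl.
  by split => //=.
apply: hausdorff_null_bigcup => n; case: unpickle => [m|]; [exact: S0 | exact: hausdorff_null_set0].
Qed.

Lemma annulus_null :
  hausdorff_measure t [set p : R * R | (r < cabs p < Rb)%R /\ ~ has_L2_density (nu P eps p)] = 0%E.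
Proof.
apply: (@hausdorff_nullS R t _ (\bigcup_n
   (if n is k.+1 then inner_set k.+1%:R^-1 else [set p : R * R | cabs p < 1 /\ p.2 = 0]))).
  move=> p [/andP[h1 h2] nd]; have [p20|p20] := eqVneq p.2 0.
    by exists 0%N => //; split => //; apply: lt_trans h2 _; case/andP: Rb01.
  pose m := Num.min (cabs p - r) (Num.min (Rb - cabs p) (`|p.2| / 2)).
  have m0 : 0 < m by rewrite !lt_min !subr_gt0 h1 h2 divr_gt0 // normr_gt0.
  exists (Num.truncn m^-1).+1 => //.
  set e := _.+1%:R^-1.
  have em : e <= m.
    have mi : 0 <= m^-1 by rewrite invr_ge0 ltW.
    by rewrite /e invf_ple ?posrE //; apply: ltW; case/andP: (truncn_itv mi).
  move: em; rewrite /m !le_min => /and3P[e1 e2 e3]; split => //.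
  - by rewrite addrC -lerBrDr.
  - by rewrite lerBrDr -lerBrDl.
  - by rewrite mulrC -ler_pdivlMr.
apply: hausdorff_null_bigcup => -[|k]; first exact: hausdorff_null_real_axis.
by apply: inner_set_null; rewrite invr_gt0.
Qed.

End Annulus.

(** * The attractor *)

Section Attractor.
Variable R : realType.
Local Notation nm := (@Normc.normc R).
Local Notation RR := (measurableTypeR R * measurableTypeR R)%type.
Variables (z : R[i]) (q : R).
Hypotheses (q01 : 0 < q < 1) (zq : nm z <= q).

Let dl N := 2 / (1 - q) * q ^+ N.

(** [dl] bounds the tail of the series after a prefix, so the sum of any series passes this test at
    each of its prefixes. *)
Definition near_prefix (u : R * R) (c : seq bool) : Prop :=
  `|Re (spt (size c) (nth false c) z) - u.1| <= dl (size c) /\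
  `|Im (spt (size c) (nth false c) z) - u.2| <= dl (size c).

(* Koenig's lemma in the form needed for [Aset_bigcap]: [near_prefix] is not closed
   under prefixes, hence arbitrarily long extensions instead of all lengths. *)
Definition extendable u (a : seq bool) : Prop :=
  forall M, exists2 b, (M <= size b)%N & near_prefix u (a ++ b).

Lemma extendable_rcons u a : extendable u a -> extendable u (rcons a true) \/ extendable u (rcons a false).
Proof.
move=> ha; apply: contrapT => /not_orP[/existsNP[M1 h1] /existsNP[M2 h2]].
have [[|c b] hb hn] := ha (M1 + M2).+1; first by [].
move: hn; rewrite -cat_rcons; case: c hb => hb hn; [apply: h1 | apply: h2];
  exists b => //; move: hb => /=; lia.
Qed.

Let step u a := if pselect (extendable u (rcons a true)) then rcons a true else rcons a false.

Let branch u n := iter n (step u) [::].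

Let branchS u n : branch u n.+1 = step u (branch u n). Proof. by []. Qed.

Let branch_extendable u n : extendable u [::] -> extendable u (branch u n).
Proof.
move=> h0; elim: n => [//|n IH]; rewrite branchS /step.
by case: pselect => [//|h]; case: (extendable_rcons IH).
Qed.

Let size_branch u n : size (branch u n) = n.
Proof.
elim: n => [//|n IH]; rewrite branchS /step.
by case: pselect => ? /=; rewrite size_rcons IH.
Qed.

Let nth_branch u n k : (k < n)%N -> nth false (branch u n) k = nth false (branch u k.+1) k.
Proof.
elim: n => [//|n IH]; rewrite ltnS leq_eqVlt => /predU1P[-> //|kn].
rewrite -(IH kn) /branch iterS -/(branch u n) /step.
by case: pselect => ? /=; rewrite nth_rcons size_branch kn.
Qed.

Let dl_le N M : (N <= M)%N -> dl M <= dl N.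
Proof.
move=> NM; have [q0 q1] := andP q01.
rewrite /dl ler_wpM2l ?divr_ge0 ?subr_ge0 ?(ltW q1) // ler_wiXn2l // ltW //.
Qed.

Let dl_small e : 0 < e -> exists N, 2 * dl N <= e.
Proof.
move=> e0; have [q0 q1] := andP q01.
have K0 : 0 < 2 * (2 / (1 - q)) by rewrite mulr_gt0 // divr_gt0 // subr_gt0.
have q01' : 0 <= q < 1 by rewrite ltW.
have [N hN] := exists_expn_le q01' (divr_gt0 e0 K0).
by exists N; rewrite /dl mulrA mulrC -ler_pdivlMr //; exact: hN.
Qed.

(** Always stepping to an extendable child defines an infinite word. Each of its prefixes of length
    N extends to a word whose partial sum is near [u], and both errors made are at most [dl N]. *)
Lemma extendable_serX u : extendable u [::] -> exists s, u = serX z s.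
Proof.
move=> h0; pose s k := nth false (branch u k.+1) k.
have near N : exists2 b, near_prefix u (branch u N ++ b) & (0 <= size b)%N.
  by have [b _ hb] := branch_extendable N h0 0%N; exists b.
have B N : `|Re (spt N s z) - u.1| <= 2 * dl N /\ `|Im (spt N s z) - u.2| <= 2 * dl N.
  have [b [h1 h2] _] := near N.
  have sN : (N <= size (branch u N ++ b))%N by rewrite size_cat size_branch leq_addr.
  have hc := spt_cauchy q01 zq (nth false (branch u N ++ b)) sN.
  have e : spt N (nth false (branch u N ++ b)) z = spt N s z.
    by apply: spt_prefix => k kN; rewrite nth_cat size_branch kN nth_branch.
  rewrite e -/(dl N) in hc.
  have := le_trans (normRe_le _) hc; have := le_trans (normIm_le _) hc.
  move: (le_trans h1 (dl_le sN)) (le_trans h2 (dl_le sN)).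
  case: (spt _ s z) => a1 a2; case: (spt _ _ z) => b1 b2 /=; move: (dl N) => D0.
  rewrite !ler_norml => /andP[? ?] /andP[? ?] /andP[? ?] /andP[? ?].
  by split; apply/andP; split; lra.
exists s; have C (x y : R) : (forall N, `|x - y| <= 2 * dl N) -> x = y.
  move=> h; apply/eqP; rewrite -subr_eq0 -normr_le0; apply/ler_addgt0Pr => e e0; rewrite add0r.
  by have [N hN] := dl_small e0; exact: le_trans (h N) hN.
have two N : dl N + 2 * dl N <= 2 * (2 * dl N).
  have : 0 <= dl N by rewrite /dl mulr_ge0 ?divr_ge0 ?exprn_ge0 // ?subr_ge0; case/andP: q01 => /ltW ? /ltW ?.
  lra.
have C' (x y : R) : (forall N, `|x - y| <= 2 * (2 * dl N)) -> x = y.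
  move=> h; have : x / 2 = y / 2.
    apply: C => N; rewrite -mulrBl normrM (ger0_norm (_ : 0 <= 2^-1)) ?invr_ge0 //.
    by rewrite ler_pdivrMr // mulrC; exact: h.
  by move=> /(congr1 (fun t => t * 2)); rewrite !divfK.
rewrite [LHS]surjective_pairing [RHS]surjective_pairing; congr (_, _); apply: C' => N; apply: le_trans (two N).
  have [h1 _] := B N; have [g1 _] := serX_tail q01 zq s N.
  rewrite (_ : u.1 - _ = (Re (spt N s z) - (serX z s).1) - (Re (spt N s z) - u.1)); last by ring.
  by apply: le_trans (ler_normB _ _) _; apply: lerD.
have [_ h1] := B N; have [_ g1] := serX_tail q01 zq s N.
rewrite (_ : u.2 - _ = (Im (spt N s z) - (serX z s).2) - (Im (spt N s z) - u.2)); last by ring.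
by apply: le_trans (ler_normB _ _) _; apply: lerD.
Qed.

Let closed_box N (a : N.-tuple bool) : set (R * R) := [set u | near_prefix u a].

(** Compactness of the space of sign sequences, phrased with finite unions of closed boxes so that
    measurability of the attractor follows. *)
Lemma Aset_bigcap : Aset (toP z) = \bigcap_N \bigcup_(a in [set: N.-tuple bool]) closed_box a.
Proof.
apply/seteqP; split => u.
  move=> [s /(psum_cvgE q01 zq) ->] N _; exists [tuple of mkseq s N] => //.
  rewrite /closed_box /near_prefix /= size_mkseq.
  rewrite (_ : spt N (nth false (mkseq s N)) z = spt N s z); last first.
    by apply: spt_prefix => k kN; rewrite nth_mkseq.
  exact: (serX_tail q01 zq).
move=> hu; have [|s ->] := @extendable_serX u.
  by move=> M; have [a _ ha] := hu M I; exists a; rewrite ?size_tuple.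
by exists s; apply/(psum_cvgE q01 zq).
Qed.

Lemma measurable_Aset : measurable (Aset (toP z) : set RR).
Proof.
rewrite Aset_bigcap; apply: bigcapT_measurable => N.
apply: fin_bigcup_measurable; first exact: finite_finset.
move=> a _; rewrite (_ : closed_box a =
  `[Re (xt a z) - dl N, Re (xt a z) + dl N] `*` `[Im (xt a z) - dl N, Im (xt a z) + dl N]).
  by apply: measurableX; exact: measurable_itv.
apply/seteqP; split => u; rewrite /closed_box /near_prefix /= size_tuple /xt /= !in_itv /= !ler_norml.
  by move=> [/andP[? ?] /andP[? ?]]; split; apply/andP; split; lra.
by move=> [/andP[? ?] /andP[? ?]]; split; apply/andP; split; lra.
Qed.

Variables (d : measure_display) (Omega : measurableType d)
  (P : probability Omega R) (eps : nat -> Omega -> bool).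

Lemma Aset_pos : has_L2_density (nu P eps (toP z)) -> (0 < @leb2 R (Aset (toP z)))%E.
Proof.
move=> [f [mf f0 nuE _]]; rewrite lt_neqAle measure_ge0 andbT eq_sym; apply/eqP => h.
have := nuE _ measurable_Aset.
have -> : nu P eps (toP z) (Aset (toP z)) = 1%E.
  rewrite /nu -(probability_setT P); congr (P _); apply/seteqP; split => // w _.
  exists (serX z (fun n => eps n w)); split; first exact: (psum_cvg q01 zq).
  by exists (fun n => eps n w); exact: (psum_cvg q01 zq).
rewrite null_set_integral //.
- by move/eqP; rewrite onee_eq0.
- exact: measurable_Aset.
- by apply/measurable_EFinP; apply: measurable_funTS.
Qed.

End Attractor.

Section Circles.
Variable R : realType.
Local Notation RR := (measurableTypeR R * measurableTypeR R)%type.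

Lemma measurable_cabs_sqr : measurable_fun setT (fun p : RR => p.1 ^+ 2 + p.2 ^+ 2 : R).
Proof.
apply: measurable_funD; apply: measurable_funX; [exact: measurable_fst | exact: measurable_snd].
Qed.

(** Each vertical section has at most two points. This serves the two boundary circles, which the
    open annuli used for the rest do not reach. *)
Lemma circle_negligible (c : R) : (@leb2 R).-negligible [set p : R * R | cabs p = c].
Proof.
pose S : set RR := (fun p : RR => p.1 ^+ 2 + p.2 ^+ 2 : R) @^-1` [set c ^+ 2].
exists S; split.
- by rewrite -[S]setTI; apply: measurable_cabs_sqr => //; exact: measurable_set1.
- rewrite /leb2 /product_measure1; apply: integral0_eq => x _ /=.
  apply: countable_lebesgue_measure0; apply: finite_set_countable.
  pose w := Num.sqrt (c ^+ 2 - x ^+ 2).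
  apply: (@sub_finite_set _ _ [set w; - w]); last exact: finite_set2.
  move=> y /=; rewrite /xsection /= inE /S /= => h.
  have : y ^+ 2 = w ^+ 2.
    rewrite sqr_sqrtr; last by rewrite -h (addrC (x ^+ 2)) addrK sqr_ge0.
    by rewrite -h (addrC (x ^+ 2)) addrK.
  by move/eqP; rewrite eqf_sqr => /orP[/eqP ->|/eqP ->]; [left|right].
move=> p /= hp; rewrite /S /= -hp /cabs sqr_sqrtr // addr_ge0 ?sqr_ge0 //.
Qed.

End Circles.

(** * Arithmetic of the two radii and of the exponent; the two assertions *)

Section Exponents.
Variable R : realType.
Local Notation lb := (2 `^ (- 2^-1) : R).
Local Notation ub := (2 * 5 `^ (- (5 / 8)) : R).

Lemma lb_gt0 : 0 < lb. Proof. exact: powR_gt0. Qed.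

Lemma ub_gt0 : 0 < ub. Proof. by rewrite mulr_gt0 // powR_gt0. Qed.

Lemma lb_sqr : lb ^+ 2 = 2^-1.
Proof.
rewrite -powR_mulrn ?powR_ge0 // -powRrM mulNr mulVf ?pnatr_eq0 //.
by rewrite powR_inv1.
Qed.

(** One fifth of the transversality threshold 256/625. *)
Lemma ub_exp8 : ub ^+ 8 = 256 / 3125.
Proof.
have e5 : (5 `^ (- (5 / 8)) : R) ^+ 8 = 5 ^- 5.
  rewrite -powR_mulrn ?powR_ge0 // -powRrM.
  have -> : - (5 / 8) * 8%:R = - (5%:R) :> R by field.
  by rewrite powR_invn.
rewrite exprMn e5 -!natrX; congr (_%:R / _%:R).
Qed.

Section AnnulusBounds.
Variables (r Rb : R).
Hypotheses (hr : lb < r) (rR : r < Rb) (hR : Rb < ub).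

Lemma r_gt0 : 0 < r. Proof. exact: lt_trans lb_gt0 hr. Qed.

Lemma Rb_exp8 : 5 * Rb ^+ 8 < 256 / 625.
Proof.
have R0 : 0 <= Rb by apply: ltW; exact: lt_trans r_gt0 rR.
have : Rb ^+ 8 < 256 / 3125 by rewrite -ub_exp8 ltrXn2r // nnegrE // ltW // ub_gt0.
by move: (Rb ^+ 8) => x; lra.
Qed.

Lemma Rb_01 : 0 <= Rb < 1.
Proof.
have R0 : 0 <= Rb by apply: ltW; exact: lt_trans r_gt0 rR.
rewrite R0 ltNge /=; apply/negP => R1; have := Rb_exp8; apply/negP; rewrite -leNgt.
have := exprn_ege1 8 R1; move: (Rb ^+ 8) => x; lra.
Qed.

Lemma r_lt1 : r < 1.
Proof. by case/andP: Rb_01 => _; exact: lt_trans. Qed.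

Let lnr : 0 < - ln r.
Proof. by rewrite oppr_gt0 ln_lt0 // r_gt0 r_lt1. Qed.

Let lnX n : ln (r ^+ n) = n%:R * ln r.
Proof. by rewrite lnXn ?r_gt0 // mulr_natl. Qed.

Let ln_half : ln 2^-1 = - ln 2 :> R.
Proof. by rewrite lnV ?posrE. Qed.

Definition dim_exponent : R := ln 2 / - ln r.

(** Equivalent to r^2 > 1/2, that is, to [r] lying beyond the inner radius. *)
Lemma dim_exponent_gt2 : 2 < dim_exponent.
Proof.
rewrite /dim_exponent ltr_pdivlMr // mulrN ltrNl -ln_half -lnX ltr_ln ?posrE ?exprn_gt0 ?r_gt0 //.
by rewrite -lb_sqr ltrXn2r // nnegrE ltW // ?lb_gt0 ?r_gt0.
Qed.

(** Equivalent to r^3 <= 1/2. What is known is r^8 < 256/3125, so 24th powers are compared: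
    (256/3125)^3 < 2^-8. *)
Lemma dim_exponent_le3 : dim_exponent <= 3.
Proof.
rewrite /dim_exponent ler_pdivrMr // mulrN lerNr -ln_half -lnX ler_ln ?posrE ?exprn_gt0 ?r_gt0 //.
have r80 : 0 <= r ^+ 8 by rewrite exprn_ge0 // ltW // r_gt0.
have r8 : r ^+ 8 < 256 / 3125.
  apply: le_lt_trans (_ : Rb ^+ 8 < _); first by rewrite lerXn2r ?nnegrE ?(ltW rR) // ltW ?r_gt0 // (lt_trans r_gt0).
  by have := Rb_exp8; move: (Rb ^+ 8) => x; lra.
rewrite leNgt; apply/negP => h.
have : (2^-1 : R) ^+ 8 < (r ^+ 3) ^+ 8 by rewrite ltrXn2r // nnegrE ?invr_ge0 // exprn_ge0 // ltW // r_gt0.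
rewrite -exprM mulnC exprM => h1.
have cube (x c : R) : 0 <= x -> x < c -> x ^+ 3 <= c ^+ 3.
  by move=> x0 xc; rewrite lerXn2r ?nnegrE // ltW // (le_lt_trans x0).
have := lt_le_trans h1 (cube _ _ r80 r8); apply/negP; rewrite -leNgt; lra.
Qed.

Lemma half_dim_exponent : 2^-1 = r `^ dim_exponent.
Proof.
rewrite /powR gt_eqF ?r_gt0 // /dim_exponent mulrC invrN mulrN mulrN mulrCA divff ?mulr1.
  by rewrite -ln_half lnK // posrE invr_gt0.
by rewrite lt_eqF // -oppr_gt0.
Qed.

Variables (d : measure_display) (Omega : measurableType d)
  (P : probability Omega R) (eps : nat -> Omega -> bool).
Hypothesis fair : fair_indep_signs P eps.

Let bad : set (R * R) := [set p : R * R | (r < cabs p < Rb)%R /\ ~ has_L2_density (nu P eps p)].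

Lemma bad_annulus_null t : 4 - dim_exponent < t -> hausdorff_measure t bad = 0%E.
Proof.
move=> st; have s3 := dim_exponent_le3; have s2 := dim_exponent_gt2.
have t1 : 1 < t by apply: le_lt_trans st; move: dim_exponent s3 => x; lra.
have s0 : 0 < dim_exponent by apply: lt_trans s2.
exact: (annulus_null fair r_gt0 r_lt1 Rb_01 Rb_exp8 s0 s3 half_dim_exponent (ltW rR) t1 st).
Qed.

Lemma dimH_bad_annulus : (dimH bad <= (4 - dim_exponent)%:E)%E.
Proof.
apply/lee_addgt0Pr => e e0; apply: ereal_inf_lbound; exists (4 - dim_exponent + e) => //=.
split; last by apply: bad_annulus_null; rewrite ltrDl.
by have := dim_exponent_le3; move: dim_exponent => x; lra.
Qed.

Lemma bad_annulus_negligible : (@leb2 R).-negligible bad.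
Proof.
have h2 : 4 - dim_exponent < 2 by have := dim_exponent_gt2; move: dim_exponent => x; lra.
by apply: hausdorff_null_negligible (bad_annulus_null h2); rewrite ler0n lexx.
Qed.

End AnnulusBounds.

Variables (d : measure_display) (Omega : measurableType d)
  (P : probability Omega R) (eps : nat -> Omega -> bool).
Hypothesis fair : fair_indep_signs P eps.

Lemma ub_lt1 : ub < 1.
Proof.
rewrite ltNge; apply/negP => h; have := exprn_ege1 8 h; rewrite ub_exp8; apply/negP.
by rewrite -ltNge; lra.
Qed.

Lemma density_Aset_pos (lam : R * R) : cabs lam <= ub -> has_L2_density (nu P eps lam) ->
  (0 < @leb2 R (Aset lam))%E.
Proof.
move=> h; rewrite -[lam]toCK; apply: (@Aset_pos R (toC lam) ub); first by rewrite ub_gt0 ub_lt1.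
by rewrite -cabs_toP toCK.
Qed.

(** The closed annulus consists of its two boundary circles and countably many open annuli strictly
    inside, to each of which the null set statement with exponent 2 applies. *)
Lemma ae_density : {ae @leb2 R, forall lam : R * R, lb <= cabs lam <= ub ->
   has_L2_density (nu P eps lam) /\ (0 < @leb2 R (Aset lam))%E}.
Proof.
pose B n : set (R * R) := match n with 0%N => [set p | cabs p = lb] | 1%N => [set p | cabs p = ub]
  | k.+2 => [set p : R * R | (lb + k.+1%:R^-1 < cabs p < ub - k.+1%:R^-1)%R /\ ~ has_L2_density (nu P eps p)] end.
have : (@leb2 R).-negligible (\bigcup_n B n).
  apply: negligible_bigcup => -[|[|k]]; [exact: circle_negligible | exact: circle_negligible |].
  have e0 : 0 < k.+1%:R^-1 :> R by rewrite invr_gt0.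
  rewrite /B; case: (ltP (lb + k.+1%:R^-1) (ub - k.+1%:R^-1)) => h.
    by apply: bad_annulus_negligible => //; rewrite ?ltrDl // ltrBlDr ltrDl.
  rewrite (_ : [set p | _] = set0); first exact: negligible_set0.
  apply/seteqP; split => // p [/andP[h1 h2] _]; have := lt_trans h1 h2.
  by rewrite ltNge h.
apply: negligibleS => p /= /not_implyP[/andP[h1 h2] nd].
have [e1|n1] := eqVneq (cabs p) lb; first by exists 0%N.
have [e2|n2] := eqVneq (cabs p) ub; first by exists 1%N.
have g1 : 0 < cabs p - lb by rewrite subr_gt0 lt_def n1.
have g2 : 0 < ub - cabs p by rewrite subr_gt0 lt_def eq_sym n2.
pose m := Num.min (cabs p - lb) (ub - cabs p).
have m0 : 0 < m by rewrite lt_min g1 g2.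
have mi : 0 <= m^-1 by rewrite invr_ge0 ltW.
exists (Num.truncn m^-1).+2 => //=; split; last first.
  by move=> hd; apply: nd; split => //; exact: density_Aset_pos.
have em : (Num.truncn m^-1).+1%:R^-1 < m.
  by rewrite invf_plt ?posrE //; case/andP: (truncn_itv mi).
move: em; rewrite {2}/m lt_min => /andP[e1 e2].
by apply/andP; split; [rewrite addrC -ltrBrDr | rewrite ltrBrDr -ltrBrDl].
Qed.

End Exponents.

Unset Implicit Arguments.

Theorem mainTheorem16 (R : realType) (d : measure_display) (Omega : measurableType d)
    (P : probability Omega R) (eps : nat -> Omega -> bool) :
  fair_indep_signs P eps ->
  {ae @leb2 R, forall lam : R * R,
     2 `^ (- 2^-1) <= cabs lam <= 2 * 5 `^ (- (5 / 8)) ->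
     has_L2_density (nu P eps lam) /\ (0 < @leb2 R (Aset lam))%E} /\
  (forall r Rb : R,
     2 `^ (- 2^-1) < r -> r < Rb -> Rb < 2 * 5 `^ (- (5 / 8)) ->
     (dimH [set lam : R * R | (r < cabs lam < Rb)%R /\ ~ has_L2_density (nu P eps lam)]
        <= ((4 - ln 2 / (- ln r))%R)%:E)%E).
Proof.
move=> fair; split; first exact: ae_density.
by move=> r Rb hr rR hR; exact: dimH_bad_annulus.
Qed.
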